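(* Assume in addition $\mathbb E X_0^3<\infty$ and $\mathbb E\varepsilon_1^3<\infty$. Then $\sqrt n(\tilde\alpha_n-\alpha)\to\mathcal N(0,\sigma_{\alpha,\varepsilon}^2)$ in distribution as $n\to\infty$. Moreover, conditionally on the values $(Y_{s-1},Y_{s+1})$, $$\sqrt n\Big(\tilde\theta_n-\Big(Y_s-\frac{\alpha}{1+\alpha^2}(Y_{s-1}+Y_{s+1})-\frac{1-\alpha}{1+\alpha^2}\mu_\varepsilon\Big)\Big)\to\mathcal N(0,c_{\alpha,\varepsilon}^2)$$ in distribution as $n\to\infty$, where $$c_{\alpha,\varepsilon}^2=\frac{\sigma_{\alpha,\varepsilon}^2}{(1+\alpha^2)^4}\Big((\alpha^2-1)(Y_{s-1}+Y_{s+1})+(1+2\alpha-\alpha^2)\mu_\varepsilon\Big)^2 .$$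
   Context: INAR(1) process: Let $\alpha\in(0,1)$. Let $(\varepsilon_k)_{k\in\mathbb N}$ be i.i.d. non-negative integer-valued random variables with $\mathbb E\varepsilon_1^2<\infty$ and $\mathbb P(\varepsilon_1\ne 0)>0$; write $\mu_\varepsilon=\mathbb E\varepsilon_1$ (assumed known) and $\sigma_\varepsilon^2=\operatorname{Var}\varepsilon_1$. For each $k\in\mathbb N$ let $(\xi_{k,j})_{j\in\mathbb N}$ be i.i.d. Bernoulli random variables with mean $\alpha$, these sequences being mutually independent and independent of $(\varepsilon_k)$. Let $X_0$ be a non-negative integer-valued random variable with $\mathbb E X_0^2<\infty$, independent of all $\xi_{k,j}$ and $\varepsilon_k$, and set $X_k=\sum_{j=1}^{X_{k-1}}\xi_{k,j}+\varepsilon_k$ for $k\in\mathbb N$. This Markov chain has a unique stationary distribution; $\tilde X$ denotes a random variable with that distribution, and $$\sigma_{\alpha,\varepsilon}^2=\frac{\alpha(1-\alpha)\mathbb E\tilde X^3+\sigma_\varepsilon^2\mathbb E\tilde X^2}{(\mathbb E\tilde X^2)^2}.$$ Additive outlier: fix a known time $s\in\mathbb N$ and size $\theta\in\mathbb N$, and let $Y_k=X_k+\delta_{k,s}\theta$, $k\in\mathbb Z_+$. Write $\mathbf Y_n=(Y_0,\dots,Y_n)$. For $n\ge s+1$ and $\alpha',\theta'\in\mathbb R$, $$Q_n(\mathbf y_n;\alpha',\theta')=\sum_{\substack{k=1\\k\notin\{s,s+1\}}}^n(y_k-\alpha'y_{k-1}-\mu_\varepsilon)^2+(y_s-\alpha'y_{s-1}-\mu_\varepsilon-\theta')^2+(y_{s+1}-\alpha'y_s-\mu_\varepsilon+\alpha'\theta')^2,$$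 and $(\tilde\alpha_n,\tilde\theta_n)$ is the unique global minimizer of $(\alpha',\theta')\mapsto Q_n(\mathbf Y_n;\alpha',\theta')$ when such a unique minimizer exists, and $(0,0)$ otherwise. Conditional convergence: for random variables $\zeta_n$ and a random vector $\eta$ with values in $\mathbb Z_+^d$, ''conditionally on the values $\eta$, $\zeta_n\to\mathcal N(0,v(\eta))$ in distribution'' means: for every $m\in\mathbb Z_+^d$ with $\mathbb P(\eta=m)>0$, the conditional distribution of $\zeta_n$ given $\{\eta=m\}$ converges weakly to $\mathcal N(0,v(m))$ (and analogously for random vectors and covariance matrices). *)

(* Defs.v *)
From HB Require Import structures.
From mathcomp Require Import all_boot all_order all_algebra.
From mathcomp Require Import all_classical all_reals all_analysis.

Set Implicit Arguments.
Unset Strict Implicit.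
Unset Printing Implicit Defensive.

Import Order.TTheory GRing.Theory Num.Def Num.Theory.
Import numFieldTopology.Exports numFieldNormedType.Exports.

Local Open Scope classical_set_scope.
Local Open Scope ring_scope.

Section INAR.
Context {R : realType} {d : measure_display} {T : measurableType d}.
Variable P : probability T R.

(* Index set of the primitive random variables:
   None            ~ X_0
   Some (inl k)    ~ eps_k            (k >= 1)
   Some (inr (k,j)) ~ xi_{k,j}        (k, j >= 1) *)
Definition inar_idx := option (nat + (nat * nat)).

Definition valid_idx (i : inar_idx) : bool :=
  match i with
  | None => true
  | Some (inl k) => (0 < k)%N
  | Some (inr (k, j)) => (0 < k)%N && (0 < j)%N
  end.

Definition inar_family (X0 : T -> nat) (eps : nat -> T -> nat)
  (xi : nat -> nat -> T -> bool) (i : inar_idx) : T -> nat :=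
  match i with
  | None => X0
  | Some (inl k) => eps k
  | Some (inr (k, j)) => fun t => nat_of_bool (xi k j t)
  end.

Definition mutually_independent (I : eqType) (valid : I -> bool)
  (Z : I -> T -> nat) : Prop :=
  forall J : seq I, uniq J -> all valid J -> forall m : I -> nat,
    fine (P (\bigcap_(i in [set` J]) [set t | Z i t = m i]))
    = \prod_(i <- J) fine (P [set t | Z i t = m i]).

Definition inar_model (alpha : R) (X0 : T -> nat) (eps : nat -> T -> nat)
  (xi : nat -> nat -> T -> bool) : Prop :=
  [/\ (forall i m, valid_idx i ->
         measurable [set t | inar_family X0 eps xi i t = m]),
      (forall k m, (0 < k)%N ->
         P [set t | eps k t = m] = P [set t | eps 1 t = m]),
      (forall k j, (0 < k)%N -> (0 < j)%N ->
         P [set t | xi k j t] = alpha%:E) &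
      mutually_independent valid_idx (inar_family X0 eps xi)].

Fixpoint inar_X (X0 : T -> nat) (eps : nat -> T -> nat)
  (xi : nat -> nat -> T -> bool) (k : nat) (t : T) : nat :=
  match k with
  | 0 => X0 t
  | k'.+1 => ((\sum_(j < inar_X X0 eps xi k' t) nat_of_bool (xi k'.+1 j.+1 t))
              + eps k'.+1 t)%N
  end.

Definition expect_pow (Z : T -> nat) (k : nat) : \bar R :=
  (\int[P]_t ((Z t)%:R ^+ k)%:E)%E.

(* Convergence in distribution of Z_n restricted to the event A
   (i.e., for P A > 0, convergence of the conditional law given A) to
   N(0, v) (with N(0,0) the Dirac mass at 0): for every bounded continuous f,
   E[f(Z_n) 1_A] -> P(A) * E f(N(0,v)). *)
Definition gauss_expect (v : R) (f : R -> R) : \bar R :=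
  if v == 0 then (f 0)%:E
  else (\int[normal_prob 0 (Num.sqrt v)]_y (f y)%:E)%E.

Definition cvg_law_on (A : set T) (Z : nat -> T -> R) (v : R) : Prop :=
  forall f : R -> R, continuous f -> (exists M : R, forall x, `|f x| <= M) ->
    (fun n => \int[P]_(t in A) (f (Z n t))%:E)%E @ \oo
      --> (P A * gauss_expect v f)%E.

Definition cvg_law (Z : nat -> T -> R) (v : R) : Prop := cvg_law_on setT Z v.

End INAR.

Definition inar_Y {R : realType} {T : Type} (X : nat -> T -> nat) (s theta : nat)
  (k : nat) (t : T) : R :=
  (X k t)%:R + (if k == s then theta%:R else 0).

Definition Qn {R : realType} (mu : R) (s n : nat) (y : nat -> R) (a th : R) : R :=
  \sum_(1 <= k < n.+1 | (k != s) && (k != s.+1)) (y k - a * y k.-1 - mu) ^+ 2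
  + (y s - a * y s.-1 - mu - th) ^+ 2
  + (y s.+1 - a * y s - mu + a * th) ^+ 2.

Definition CLS_est {R : realType} (mu : R) (s n : nat) (y : nat -> R) : R * R :=
  let ismin := [set p : R * R | forall q : R * R, Qn mu s n y p.1 p.2 <= Qn mu s n y q.1 q.2] in
  if pselect (exists! p, ismin p) then xget (0, 0) ismin else (0, 0).

(* transition probabilities of the INAR(1) chain; q m = P(eps_1 = m) *)
Definition trans_prob {R : realType} (alpha : R) (q : nat -> R) (i j : nat) : R :=
  \sum_(l < (minn i j).+1)
     ('C(i, l)%:R * alpha ^+ l * (1 - alpha) ^+ (i - l) * q (j - l)%N).

Definition is_stationary {R : realType} (alpha : R) (q : nat -> R) (pi : nat -> R) : Prop :=
  [/\ (forall j, 0 <= pi j),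
      (\sum_(j <oo) (pi j)%:E = 1)%E &
      (forall j, (pi j)%:E = \sum_(i <oo) (pi i * trans_prob alpha q i j)%:E)%E].

Definition pmf_moment {R : realType} (pi : nat -> R) (k : nat) : R :=
  fine (\sum_(j <oo) ((j%:R) ^+ k * pi j)%:E)%E.

Definition sigma2_alpha_eps {R : realType} (alpha sigeps2 : R) (pi : nat -> R) : R :=
  (alpha * (1 - alpha) * pmf_moment pi 3 + sigeps2 * pmf_moment pi 2)
  / (pmf_moment pi 2) ^+ 2.

(* Main.v *)
Require Import Defs.
From HB Require Import structures.
From mathcomp Require Import all_boot all_order all_algebra.
From mathcomp Require Import all_classical all_reals all_analysis.
From mathcomp Require Import measurable_realfun lebesgue_integral_under.
From mathcomp Require Import ring lra zify.

Set Implicit Arguments.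
Unset Strict Implicit.
Unset Printing Implicit Defensive.

Import Order.TTheory GRing.Theory Num.Def Num.Theory.
Import numFieldTopology.Exports numFieldNormedType.Exports.
Local Open Scope classical_set_scope.
Local Open Scope ring_scope.

(** Eliminating $\theta'$ from $Q_n$ by completing a square leaves a function of $\alpha'$ alone:
    $D\alpha'^2-2\alpha' E$ plus a term of bounded curvature, up to a constant, where $D=\sum
    Y_{k-1}^2$ and $E=\sum Y_{k-1}(Y_k-\mu_\varepsilon)$ run over the indices untouched by the
    outlier ([Qn_profile]). As $D$ grows like $n$, this profile has, with probability tending to
    one, a unique minimizer, at distance $O(1/n)$ from $E/D$ ([CLS_est_profile]). On the retained
    indices $Y=X$, so $E/D-\alpha=S/D$ with the martingale $S=\sum X_{k-1}(X_k-\alpha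
    X_{k-1}-\mu_\varepsilon)$.

    Two limits are needed: $D/n\to m_2=\mathbb E\tilde X^2$ in probability ([square_average_lln]),
    and $S/\sqrt n\to\mathcal N(0,V)$ with $V=\alpha(1-\alpha)\mathbb E\tilde
    X^3+\sigma_\varepsilon^2\mathbb E\tilde X^2$ ([martingale_clt]). Slutsky's argument then gives
    the variance $V/m_2^2=\sigma_{\alpha,\varepsilon}^2$. The estimator of $\theta$ is an explicit
    function [theta_hat] of the estimator of $\alpha$, whose value at the true $\alpha$ is the
    centering in the theorem, so the second claim is the delta method. Conditioning on
    $(Y_{s-1},Y_{s+1})$ does not change the limit of $\sqrt n(\tilde\alpha_n-\alpha)$: the event
    belongs to the past at time $s+1$, and the central limit theorem is proved with an arbitrary
    weight from that past.

    Laws are compared through the real functions $\cos(uz+b)$, the phase $b$ replacing complex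
    exponentials ([levy_criterion]). One step of the chain multiplies $\mathbb E[A\cos(rS_k+b)]$ by
    about $e^{-r^2V/2}$ ([clt_step]). The conditional variance of a step is
    $\alpha(1-\alpha)X_k^3+\sigma_\varepsilon^2X_k^2$ rather than $V$; the difference telescopes
    through a polynomial solution of the Poisson equation ([step_poisson]).

    Only third moments are available. They give the Lindeberg condition through uniform
    integrability of $X_k^3$ ([chain_uniform_integrability]), while in the law of large numbers
    $X_k^2$ has only moments of order $3/2$, which the potential $\sqrt{1+x^2}$ handles in place of
    a variance. The ergodic input is elementary: each individual survives $n$ steps with probability
    $\alpha^n$ ([iter_kernel_forget]). *)

Lemma integrable_le d (T : measurableType d) (R : realType)
    (mu : {measure set T -> \bar R}) (D : set T) (f g : T -> R) :
  measurable D -> measurable_fun D f -> mu.-integrable D (EFin \o g) ->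
  (forall x, D x -> `|f x| <= g x) -> mu.-integrable D (EFin \o f).
Proof.
move=> mD mf ig fg; apply: (le_integrable mD _ _ ig) => //.
  exact/measurable_EFinP.
by move=> x Dx /=; rewrite lee_fin (le_trans (fg x Dx))// ler_norm.
Qed.

(** * Characteristic function of the normal law, in real form *)

Section GaussCharacteristic.
Context {R : realType}.
Local Notation leb := (@lebesgue_measure R).
Implicit Types (s u b y : R).

Lemma integral_normal_prob s (f : R -> \bar R) :
  measurable_fun setT f -> (\int[normal_prob 0 s]_x `|f x| < +oo)%E ->
  (\int[normal_prob 0 s]_x f x = \int[leb]_x (f x * (normal_pdf 0 s x)%:E))%E.
Proof.
move=> mf finf.
rewrite -(Radon_Nikodym_change_of_variables (normal_prob_dominates 0 s))//=; last first.
  by apply/integrableP; split.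
apply: ae_eq_integral => //.
- apply: emeasurable_funM => //; apply: (measurable_int leb).
  by apply: Radon_Nikodym_integrable; exact: normal_prob_dominates.
- apply: emeasurable_funM => //=; apply/measurableT_comp => //=.
  exact: measurable_normal_pdf.
- apply: ae_eqe_mul2l => /=.
  rewrite Radon_NikodymE//=; first exact: normal_prob_dominates.
  move=> ?; case: cid => /= h [h1 h2 h3].
  apply: integral_ae_eq => //=.
  + by apply/measurableT_comp =>//; exact: measurable_normal_pdf.
  + by move=> E ET mE; rewrite -h3.
Qed.

Lemma is_derive_normal_pdf s y : s != 0 ->
  is_derive y 1 (normal_pdf 0 s) (- (y / s ^+ 2) * normal_pdf 0 s y).
Proof.
move=> s0; rewrite normal_pdfE// /normal_fun.
apply: is_derive_eq.
rewrite /GRing.scale /= !subr0.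
field.
by rewrite s0.
Qed.

(** The exponential factor of the density is a square $e\cdot e$, where $e$ is that of the normal
    density of variance $2s^2$. One copy absorbs $|y|$, since $|y|\le 1+y^2$ and $1+z\le e^z$; the
    other stays integrable. This yields the dominating function for differentiating under the
    integral sign. *)
Lemma normal_pdf_poly_bound s y : s != 0 ->
  `|y| * normal_pdf 0 s y <=
  ((1 + 4 * s ^+ 2) * normal_peak s / normal_peak (Num.sqrt 2 * s)) * normal_pdf 0 (Num.sqrt 2 * s) y.
Proof.
move=> s0.
have t0 : Num.sqrt 2 * s != 0 by rewrite mulf_neq0// sqrtr_eq0 -ltNge.
have tE : (Num.sqrt 2 * s) ^+ 2 = 2 * s ^+ 2 by rewrite exprMn sqr_sqrtr.
rewrite !normal_pdfE// /normal_fun tE subr0.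
have pt := normal_peak_gt0 t0; have ps := normal_peak_gt0 s0.
set e := expR (- y ^+ 2 / (2 * s ^+ 2 *+ 2)).
have s2 : 0 < s ^+ 2 by rewrite exprn_even_gt0.
have -> : expR (- y ^+ 2 / (s ^+ 2 *+ 2)) = e * e.
  by rewrite /e -expRD; congr expR; field; rewrite s0.
have e0 : 0 < e by exact: expR_gt0.
have He : `|y| * e <= 1 + 4 * s ^+ 2.
  rewrite /e mulNr expRN ler_pdivrMr ?expR_gt0//.
  set z := y ^+ 2 / _.
  have := expR_ge1Dx z.
  have yz : y ^+ 2 = 4 * s ^+ 2 * z by rewrite /z; field; rewrite s0.
  have z0 : 0 <= z by rewrite /z divr_ge0 ?sqr_ge0// mulrn_wge0// mulr_ge0// ltW.
  have : `|y| <= 1 + y ^+ 2.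
    rewrite -[y ^+ 2]real_normK ?num_real//; have := sqr_ge0 (`|y| - 1); nra.
  rewrite yz => H1 H2.
  apply: (le_trans H1).
  apply: (@le_trans _ _ ((1 + 4 * s ^+ 2) * (1 + z))); last by rewrite ler_wpM2l//; nra.
  nra.
have -> : (1 + 4 * s ^+ 2) * normal_peak s / normal_peak (Num.sqrt 2 * s) * (normal_peak (Num.sqrt 2 * s) * e)
  = (1 + 4 * s ^+ 2) * (normal_peak s * e) by field; rewrite gt_eqF.
have -> : `|y| * (normal_peak s * (e * e)) = (`|y| * e) * (normal_peak s * e) by ring.
by rewrite ler_wpM2r// mulr_ge0 ?ltW.
Qed.

Lemma integrable_abs_normal_pdf s : s != 0 ->
  leb.-integrable setT (EFin \o (fun y => `|y| * normal_pdf 0 s y)).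
Proof.
move=> s0.
apply: (@integrable_le _ _ _ leb setT _ (fun y => ((1 + 4 * s ^+ 2) * normal_peak s / normal_peak (Num.sqrt 2 * s)) * normal_pdf 0 (Num.sqrt 2 * s) y)) => //.
- apply: measurable_funM; last exact: measurable_normal_pdf.
  exact: normr_measurable.
- exact: (integrableZl measurableT _ (integrable_normal_pdf 0 (Num.sqrt 2 * s))).
- by move=> y _; rewrite ger0_norm ?normal_pdf_poly_bound// mulr_ge0// normal_pdf_ge0.
Qed.

(** Integration by parts over the line: the fundamental theorem on $[-n,n]$, then dominated
    convergence. Vanishing of [F] along the integers is enough. *)
Lemma Rintegral_derivative_eq0 (F f : R -> R) :
  (forall y, is_derive y 1 F (f y)) -> continuous f ->
  leb.-integrable setT (EFin \o f) ->
  (F n%:R @[n --> \oo] --> 0) -> (F (- n%:R) @[n --> \oo] --> 0) ->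
  \int[leb]_y f y = 0.
Proof.
move=> dF cf intf F1 F2.
pose fn (n : nat) := (EFin \o f) \_ (`[- n%:R, n%:R] : set R).
have FTC n : (0 < n)%N -> (\int[leb]_y fn n y = (F n%:R - F (- n%:R))%:E)%E.
  move=> n0; rewrite /fn -integral_mkcond.
  have cF : continuous F.
    by move=> y; apply/differentiable_continuous/derivable1_diffP; case: (dF y).
  rewrite (@continuous_FTC2 _ f F)//.
  - by rewrite ltrNl -subr_lt0 -opprD oppr_lt0 addr_gt0 ?ltr0n.
  - by apply: continuous_subspaceT.
  - split.
    + by move=> y _; case: (dF y).
    + exact/cvg_at_right_filter/cF.
    + exact/cvg_at_left_filter/cF.
  - by move=> y _; rewrite derive1E; apply: derive_val.
have mf : measurable_fun setT (EFin \o f) by case/integrableP: intf.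
have H1 : forall n, measurable_fun setT (fn n).
  by move=> n; apply/(measurable_restrictT _ _).1 => //; exact: measurable_funTS.
have H2 : {ae leb, forall x, setT x -> fn ^~ x @ \oo --> (EFin \o f) x}.
  apply: aeW => y _; apply: cvg_near_cst.
  near=> n; rewrite /fn patchE ifT// inE /= in_itv /= -ler_norml.
  by near: n; exact: nbhs_infty_ger.
have H3 : {ae leb, forall x n, setT x -> (`|fn n x| <= `|(f x)%:E|)%E}.
  apply: aeW => y n _; rewrite /fn patchE; case: ifP => // _.
  by rewrite abse0 abse_ge0.
have [_ _ L] := @dominated_convergence _ _ R leb setT measurableT fn (EFin \o f) (fun y => `|(f y)%:E|%E) H1 mf H2 (integrable_abse intf) H3.
rewrite /Rintegral.
have : (fun n => \int[leb]_y fn n y)%E @ \oo --> (0 : R)%:E.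
  apply: (@cvg_trans _ ((fun n => (F n%:R - F (- n%:R))%:E) @ \oo)).
    apply: near_eq_cvg; near=> n; rewrite FTC//.
    by near: n; exact: nbhs_infty_gt.
  by apply: cvg_EFin; [exact: nearW| rewrite -[0](subr0 0); exact: cvgB].
by move=> /(cvg_unique _ L) -> //.
Unshelve. all: by end_near.
Qed.

Lemma normal_pdf_cvg0 s : s != 0 ->
  (normal_pdf 0 s n%:R @[n --> \oo] --> 0).
Proof.
move=> s0.
have H n : `|normal_pdf 0 s n.+1%:R| <=
   ((1 + 4 * s ^+ 2) * normal_peak s / normal_peak (Num.sqrt 2 * s) * normal_peak (Num.sqrt 2 * s)) * n.+1%:R^-1.
  rewrite ger0_norm ?normal_pdf_ge0// -[leLHS](mulKf (x := n.+1%:R)) ?pnatr_eq0//.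
  rewrite [leRHS]mulrC ler_wpM2l ?invr_ge0//.
  have := @normal_pdf_poly_bound s n.+1%:R s0; rewrite ger0_norm// => /le_trans; apply.
  rewrite ler_wpM2l//; last by apply: normal_pdf_ub; rewrite mulf_neq0// sqrtr_eq0 -ltNge.
  rewrite divr_ge0 ?normal_peak_ge0// mulr_ge0 ?normal_peak_ge0//.
  by rewrite addr_ge0// mulr_ge0// sqr_ge0.
rewrite -(cvg_shiftS (fun n => normal_pdf 0 s n%:R)).
apply/norm_cvg0P.
set C := _ * _ in H.
apply: (@squeeze_cvgr _ _ _ _ (cst 0) (fun n => C * n.+1%:R^-1)).
- by apply: nearW => n; rewrite normr_ge0 H.
- exact: cvg_cst.
- rewrite -(mulr0 C); apply: cvgMr; exact: cvg_harmonic.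
Qed.

Lemma normal_pdfN s y : normal_pdf 0 s (- y) = normal_pdf 0 s y :> R \/ s = 0.
Proof.
have [->|s0] := eqVneq s 0; [by right|left].
by rewrite !normal_pdfE// /normal_fun !subr0 sqrrN.
Qed.

End GaussCharacteristic.

Section GaussCharacteristicFunction.
Context {R : realType}.
Local Notation leb := (@lebesgue_measure R).
Implicit Types (s u b y : R).

Lemma continuous_cos_affine u b : continuous (fun y : R => cos (u * y + b)).
Proof.
move=> y; apply: (@continuous_comp _ _ _ (fun y => u * y + b)); last exact: continuous_cos.
by apply: cvgD; [apply: cvgM; [exact: cvg_cst|exact: cvg_id]|exact: cvg_cst].
Qed.

Lemma continuous_sin_affine u b : continuous (fun y : R => sin (u * y + b)).
Proof.
move=> y; apply: (@continuous_comp _ _ _ (fun y => u * y + b)); last exact: continuous_sin.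
by apply: cvgD; [apply: cvgM; [exact: cvg_cst|exact: cvg_id]|exact: cvg_cst].
Qed.

Lemma measurable_cos_affine u b : measurable_fun [set: R] (fun y => cos (u * y + b)).
Proof. by apply: continuous_measurable_fun; exact: continuous_cos_affine. Qed.

Lemma measurable_sin_affine u b : measurable_fun [set: R] (fun y => sin (u * y + b)).
Proof. by apply: continuous_measurable_fun; exact: continuous_sin_affine. Qed.

Lemma integrable_normal_pdf_cos s u b :
  leb.-integrable setT (EFin \o (fun y => normal_pdf 0 s y * cos (u * y + b))).
Proof.
apply: (@integrable_le _ _ _ leb setT _ (normal_pdf 0 s)) => //.
- apply: measurable_funM; first exact: measurable_normal_pdf.
  exact: measurable_cos_affine.
- exact: integrable_normal_pdf.
- move=> y _; rewrite normrM ger0_norm ?normal_pdf_ge0// ler_piMr ?normal_pdf_ge0//.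
  by rewrite ler_norml cos_geN1 cos_le1.
Qed.

Lemma integrable_normal_pdf_ysin s u b : s != 0 ->
  leb.-integrable setT (EFin \o (fun y => y * normal_pdf 0 s y * sin (u * y + b))).
Proof.
move=> s0.
apply: (@integrable_le _ _ _ leb setT _ (fun y => `|y| * normal_pdf 0 s y)) => //.
- apply: measurable_funM; first by apply: measurable_funM => //; exact: measurable_normal_pdf.
  exact: measurable_sin_affine.
- exact: integrable_abs_normal_pdf.
- move=> y _; rewrite 2!normrM (ger0_norm (normal_pdf_ge0 _ _ _)).
  rewrite ler_piMr ?mulr_ge0 ?normal_pdf_ge0//.
  by rewrite ler_norml sin_geN1 sin_le1.
Qed.

(** With the phase [b], this single real function contains both the cosine and the sine part of the
    characteristic function. *)
Let psi s b u := \int[leb]_y (normal_pdf 0 s y * cos (u * y + b)).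

Let is_derive_integrand s b y u :
  is_derive u 1 (fun u => normal_pdf 0 s y * cos (u * y + b))
    (- (y * normal_pdf 0 s y * sin (u * y + b))).
Proof. by apply: is_derive_eq; rewrite /GRing.scale /=; ring. Qed.

Let psi_derive s b u : s != 0 ->
  is_derive u 1 (psi s b) (- \int[leb]_y (y * normal_pdf 0 s y * sin (u * y + b))).
Proof.
move=> s0.
have Iu : `]u - 1, u + 1[%classic u by rewrite /= in_itv /= ltrBlDr ltrDl ltr01.
pose f u y := normal_pdf 0 s y * cos (u * y + b).
have intf u' : `]u - 1, u + 1[%classic u' -> leb.-integrable setT (EFin \o f u').
  by move=> _; exact: integrable_normal_pdf_cos.
have df u' y : `]u - 1, u + 1[%classic u' -> (setT : set R) y -> derivable (f ^~ y) u' 1.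
  by move=> _ _; case: (is_derive_integrand s b y u').
have dE u' y : derive1 (f ^~ y) u' = - (y * normal_pdf 0 s y * sin (u' * y + b)).
  by rewrite derive1E; case: (is_derive_integrand s b y u') => _ <-.
have dub u' y : `]u - 1, u + 1[%classic u' -> (setT : set R) y ->
    `|derive1 (f ^~ y) u'| <= `|y| * normal_pdf 0 s y.
  move=> _ _; rewrite dE normrN 2!normrM (ger0_norm (normal_pdf_ge0 _ _ _)).
  rewrite ler_piMr ?mulr_ge0 ?normal_pdf_ge0//.
  by rewrite ler_norml sin_geN1 sin_le1.
have G0 (y : R) : 0 <= `|y| * normal_pdf 0 s y by rewrite mulr_ge0 ?normal_pdf_ge0.
have H1 := @derivable_under_integral R _ _ leb f setT measurableT u (u - 1) (u + 1)
  Iu intf df _ G0 (integrable_abs_normal_pdf s0) dub.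
have H2 := @differentiation_under_integral R _ _ leb f setT measurableT u (u - 1) (u + 1)
  Iu intf df _ G0 (integrable_abs_normal_pdf s0) dub.
split; first exact: H1.
rewrite -derive1E H2 -mulN1r -RintegralZl//; last exact: integrable_normal_pdf_ysin.
by apply: eq_Rintegral => y _; rewrite [LHS]dE mulN1r.
Qed.

(** Integrates the derivative of $\varphi_s(y)\sin(uy+b)$, using $\varphi_s'(y)=-y\varphi_s(y)/s^2$.
    It turns the derivative of [psi] into $-s^2u$ times [psi]. *)
Let psi_parts s b u : s != 0 ->
  \int[leb]_y (y * normal_pdf 0 s y * sin (u * y + b)) = s ^+ 2 * u * psi s b u.
Proof.
move=> s0.
pose F y := normal_pdf 0 s y * sin (u * y + b).
pose f y := u * (normal_pdf 0 s y * cos (u * y + b)) -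
            (s ^+ 2)^-1 * (y * normal_pdf 0 s y * sin (u * y + b)).
have cn := continuous_normal_pdf (m := 0) s0.
have i1 := integrable_normal_pdf_cos s u b; have i2 := integrable_normal_pdf_ysin u b s0.
have F0 (x : R^nat) : normal_pdf 0 s (x n) @[n --> \oo] --> 0 -> F (x n) @[n --> \oo] --> 0.
  move=> h0; have h : `|normal_pdf 0 s (x n)| @[n --> \oo] --> 0 by have := cvg_norm h0; rewrite normr0; apply.
   apply/norm_cvg0P.
  apply: (@squeeze_cvgr _ _ _ _ (cst 0) (fun n => `|normal_pdf 0 s (x n)|)) => //.
    apply: nearW => n; rewrite normr_ge0 /= normrM ler_piMr//.
    by rewrite ler_norml sin_geN1 sin_le1.
  exact: cvg_cst.
have : \int[leb]_y f y = 0.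
  apply: (@Rintegral_derivative_eq0 _ F).
  - move=> y; have := is_derive_normal_pdf y s0 => dn.
    by apply: is_derive_eq; rewrite /GRing.scale /= /f; field; rewrite s0.
  - move=> y; apply: cvgB; apply: cvgM; try exact: cvg_cst.
      by apply: cvgM; [exact: cn|exact: continuous_cos_affine].
    by apply: cvgM; [apply: cvgM; [exact: cvg_id|exact: cn]|exact: continuous_sin_affine].
  - have := integrableB measurableT (integrableZl measurableT u i1) (integrableZl measurableT (s ^+ 2)^-1 i2).
    exact.
  - by apply: (F0 (fun n => n%:R)); exact: normal_pdf_cvg0.
  - apply: (F0 (fun n => - n%:R)).
    rewrite (_ : (fun n : nat => _) = fun n => normal_pdf 0 s n%:R); first exact: normal_pdf_cvg0.
    by apply/funext => n; have [//|s00] := @normal_pdfN R s n%:R; rewrite s00 eqxx in s0.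
rewrite /f RintegralB//; last 2 first.
- exact: (integrableZl measurableT u i1).
- exact: (integrableZl measurableT _ i2).
rewrite !RintegralZl// -/(psi s b u) => /eqP; rewrite subr_eq0 => /eqP E.
by rewrite -mulrA E mulrA mulfV ?mul1r// sqrf_eq0.
Qed.

(** The differential equation $\psi'=-s^2u\psi$ makes $\psi(u)e^{u^2s^2/2}$ constant; its value at
    $0$ is $\cos b$. *)
Let psiE s b u : s != 0 -> psi s b u = expR (- (u ^+ 2 * s ^+ 2 / 2)) * cos b.
Proof.
move=> s0.
pose K u := psi s b u * expR (u ^+ 2 * s ^+ 2 / 2).
have dK (x : R) : is_derive x 1 (K : R -> R) 0.
  have dp := psi_derive b x s0; rewrite psi_parts// in dp.
  by apply: is_derive_eq; rewrite /GRing.scale /=; field.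
have K0 : K 0 = cos b.
  rewrite /K expr0n /= !mul0r expR0 mulr1 /psi.
  under eq_Rintegral do rewrite mul0r add0r.
  rewrite RintegralZr//; last exact: integrable_normal_pdf.
  by rewrite /Rintegral integral_normal_pdf /= mul1r.
rewrite -K0 (is_derive_0_is_cst 0 u dK) /K mulrCA -expRD.
by rewrite addNr expR0 mulr1.
Qed.

Lemma gauss_expect_cos v u b : 0 <= v ->
  gauss_expect v (fun y => cos (u * y + b)) = (expR (- (u ^+ 2 * v / 2)) * cos b)%:E.
Proof.
move=> v0; rewrite /gauss_expect; case: eqVneq => [->|vn0].
  by rewrite !mulr0 !mul0r oppr0 expR0 mul1r add0r.
have s0 : Num.sqrt v != 0 by rewrite sqrtr_eq0 -ltNge lt_neqAle eq_sym vn0.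
rewrite integral_normal_prob.
- have := psiE b u s0; rewrite /psi sqr_sqrtr// => <-.
  rewrite /Rintegral fineK.
    by apply: eq_integral => y _; rewrite muleC.
  by apply: integrable_fin_num => //; exact: integrable_normal_pdf_cos.
- apply/measurable_EFinP; exact: measurable_cos_affine.
- apply: (@le_lt_trans _ _ (\int[normal_prob 0 (Num.sqrt v)]_x cst 1 x)%E).
    apply: ge0_le_integral => //.
    + apply: measurableT_comp => //; apply/measurable_EFinP; exact: measurable_cos_affine.
    + by move=> y _; rewrite lee_fin ler_norml cos_geN1 cos_le1.
  by rewrite integral_cst//= mul1e probability_setT ltry.
Qed.

End GaussCharacteristicFunction.

(** * Approximation of bounded continuous functions by trigonometric polynomials *)

Section TrigonometricApproximation.
Context {R : realType}.
Implicit Types (f g : R -> R).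

(** Frequencies are arbitrary reals and phases stand in for sines. The class is then closed under
    multiplication by a cosine, and convergence of expectations has to be checked on one kind of
    generator only. *)
Inductive trig : (R -> R) -> Prop :=
| trig_cos u b : trig (fun y => cos (u * y + b))
| trig_add f g : trig f -> trig g -> trig (fun y => f y + g y)
| trig_scale c f : trig f -> trig (fun y => c * f y).

Lemma trig_cst c : trig (fun=> c).
Proof.
rewrite (_ : (fun=> c) = fun y : R => c * cos (0 * y + 0)).
  by apply: trig_scale; exact: trig_cos.
by apply/funext => y; rewrite mul0r addr0 cos0 mulr1.
Qed.

Lemma trig_mul_cos u b f : trig f -> trig (fun y => cos (u * y + b) * f y).
Proof.
elim=> [u' b'|{}f g _ tf _ tg|c {}f _ tf].
- rewrite (_ : (fun y => _) = fun y : R => 2^-1 * (cos ((u + u') * y + (b + b')) + cos ((u - u') * y + (b - b')))).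
    by apply: trig_scale; apply: trig_add; exact: trig_cos.
  apply/funext => y.
  rewrite (_ : (u + u') * y + (b + b') = (u * y + b) + (u' * y + b')); last by ring.
  rewrite (_ : (u - u') * y + (b - b') = (u * y + b) - (u' * y + b')); last by ring.
  by move: (u * y + b) (u' * y + b') => x x'; rewrite cosD cosB; field.
- by under eq_fun do rewrite mulrDr; exact: trig_add.
- by under eq_fun do rewrite mulrCA; exact: trig_scale.
Qed.

(* The expectation of [f K] for a binomial variable [K], by recursion on the
   number of trials. *)
Fixpoint binom_expect (p : R) (n : nat) (f : nat -> R) : R :=
  if n is n'.+1 then
    (1 - p) * binom_expect p n' f + p * binom_expect p n' (f \o S)
  else f 0%N.

Section binom_expect.
Variables (p : R).
Hypothesis p01 : 0 <= p <= 1.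
Implicit Types F G : nat -> R.

Lemma binom_expect_le n F G : (forall k, (k <= n)%N -> F k <= G k) ->
  binom_expect p n F <= binom_expect p n G.
Proof.
elim: n F G => [|n IH] F G FG /=; first exact: FG.
have /andP[p0 p1] := p01.
apply: lerD; rewrite ler_wpM2l ?subr_ge0//; apply: IH => k kn; apply: FG => //.
exact: leqW.
Qed.

Lemma binom_expect_lin n a b F G :
  binom_expect p n (fun k => a * F k + b * G k) =
  a * binom_expect p n F + b * binom_expect p n G.
Proof.
elim: n F G => [//|n IH] F G /=.
by rewrite (IH F G) (IH (F \o S) (G \o S)); ring.
Qed.

Lemma binom_expect_cst n c : binom_expect p n (fun=> c) = c.
Proof. by elim: n => [//|n /= IH]; rewrite /comp IH; ring. Qed.

(** Variance plus squared bias. The center [a] is kept free because conditioning on the first trial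
    replaces it by [a - 1]. *)
Lemma binom_expect_sqr n a :
  binom_expect p n (fun k => (k%:R - a) ^+ 2) =
  n%:R * p * (1 - p) + (n%:R * p - a) ^+ 2.
Proof.
elim: n a => [|n IH] a /=; first by ring.
rewrite IH (_ : _ \o _ = fun k => (k%:R - (a - 1)) ^+ 2); last first.
  by apply/funext => k /=; rewrite -natr1; ring.
by rewrite IH -natr1; ring.
Qed.

(** Averaging the pointwise bound against the binomial law turns its quadratic term into $C$ times
    the variance of $k/n$, which is $p(1-p)/n\le 1/n$. *)
Lemma bernstein_error n (e C c : R) (F : nat -> R) : (0 < n)%N -> 0 <= C ->
  (forall k, (k <= n)%N -> `|F k - c| <= e + C * (k%:R / n%:R - p) ^+ 2) ->
  `|binom_expect p n F - c| <= e + C / n%:R.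
Proof.
move=> n0 C0 H.
have nn : n%:R != 0 :> R by rewrite pnatr_eq0 -lt0n.
have E : binom_expect p n (fun k => e + C * (k%:R / n%:R - p) ^+ 2) <= e + C / n%:R.
  rewrite (_ : (fun k => _) = fun k => 1 * e + (C / n%:R ^+ 2) * (k%:R - n%:R * p) ^+ 2); last first.
    by apply/funext => k; field.
  rewrite (binom_expect_lin n 1 _ (fun=> e)) binom_expect_cst binom_expect_sqr mul1r lerD2l.
  rewrite subrr expr0n /= addr0.
  rewrite (_ : C / _ * _ = C / n%:R * (p * (1 - p))); last by field.
  rewrite ler_piMr ?divr_ge0//; have /andP[p0 p1] := p01; nra.
have up : binom_expect p n F - c <= e + C / n%:R.
  apply: le_trans E; rewrite lerBlDr -[in leRHS](binom_expect_cst n c).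
  rewrite -[X in X + _]mul1r -[X in _ + X]mul1r -binom_expect_lin.
  apply: binom_expect_le => k kn; rewrite !mul1r -lerBlDr.
  exact: (le_trans (ler_norm _) (H k kn)).
have lo : - (e + C / n%:R) <= binom_expect p n F - c.
  apply: (@le_trans _ _ (- binom_expect p n (fun k => e + C * (k%:R / n%:R - p) ^+ 2))).
    by rewrite lerN2.
  rewrite lerBrDr -[in leLHS](binom_expect_cst n c).
  rewrite -[X in _ + X]mul1r -mulN1r -binom_expect_lin.
  apply: binom_expect_le => k kn; rewrite mul1r mulN1r -lerBrDr.
  by rewrite lerNl; apply: (le_trans _ (H k kn)); rewrite -normrN ler_norm.
by rewrite ler_norml lo up.
Qed.

End binom_expect.

(** Each trial multiplies by an affine function of one cosine, so a Bernstein polynomial evaluated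
    at $(1+\cos)/2$ stays trigonometric. *)
Lemma trig_binom_expect u b n F :
  trig (fun y => binom_expect ((1 + cos (u * y + b)) / 2) n F).
Proof.
elim: n F => [|n IH] F /=; first exact: trig_cst.
have -> : (fun y => (1 - (1 + cos (u * y + b)) / 2) * binom_expect ((1 + cos (u * y + b)) / 2) n F +
    (1 + cos (u * y + b)) / 2 * binom_expect ((1 + cos (u * y + b)) / 2) n (F \o S)) =
  (fun y => (2^-1 * binom_expect ((1 + cos (u * y + b)) / 2) n F +
     2^-1 * binom_expect ((1 + cos (u * y + b)) / 2) n (F \o S)) +
    (2^-1 * (cos (u * y + b) * binom_expect ((1 + cos (u * y + b)) / 2) n (F \o S)) +
     (- 2^-1) * (cos (u * y + b) * binom_expect ((1 + cos (u * y + b)) / 2) n F))).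
  by apply/funext => y; field.
by do !apply: trig_add; apply: trig_scale => //; exact: trig_mul_cos.
Qed.

(** Uniform continuity on the segment, by compactness, handles nearby points. For points further
    apart than the modulus, the trivial bound $2B$ is absorbed by the quadratic term. This is the
    form that [bernstein_error] consumes. *)
Lemma uniform_quadratic_modulus g (B e a b : R) : continuous g -> (forall x, `|g x| <= B) ->
  0 < e -> exists2 C, 0 <= C &
    forall p q, a <= p <= b -> a <= q <= b -> `|g q - g p| <= e + C * (q - p) ^+ 2.
Proof.
move=> cg gB e0.
have B0 : 0 <= B by exact: le_trans (gB 0).
have K := (compact_near_coveringP _).1 (@segment_compact R a b).
pose Q (r p : R) := forall q, `|q - p| < r -> `|g q - g p| <= e.
have : \forall r \near (0 : R)^'+, `[a, b]%classic `<=` Q r.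
  apply: K => x xab.
  have /cvgrPdist_lt /(_ _ (divr_gt0 e0 (ltr0Sn _ 1))) := cg x.
  move=> /nbhs_ballP[/= r r0 Hr].
  have r2 : 0 < r / 2 by rewrite divr_gt0.
  near=> p r' => q qp.
  have px : ball x r p.
    near: p; exact: nbhsx_ballx.
  have px2 : `|x - p| < r / 2.
    by near: p; exact: (@nbhsx_ballx _ _ x).
  have rr : r' < r / 2 by near: r'; exact: nbhs_right_lt.
  have H1 := Hr p px.
  have H2 : `|g x - g q| < e / 2.
    apply: Hr; rewrite /ball /= (_ : x - q = (x - p) - (q - p)); last by ring.
    apply: (le_lt_trans (ler_normB _ _)); rewrite [ltRHS]splitr.
    by rewrite ltrD// (lt_trans qp).
  rewrite (_ : g q - g p = (g x - g p) - (g x - g q)); last by ring.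
  by apply: (le_trans (ler_normB _ _)); rewrite [leRHS]splitr; apply: lerD; apply: ltW.
move=> [r /= r0 Hr].
have r2 : 0 < r / 2 by rewrite divr_gt0.
have {}Hr : `[a, b]%classic `<=` Q (r / 2).
  apply: Hr => //=; rewrite sub0r normrN gtr0_norm//.
  by rewrite ltr_pdivrMr// ltr_pMr// ltr1n.
have D0 : 0 <= 2 * B / (r / 2) ^+ 2 := divr_ge0 (mulr_ge0 (ler0n R 2) B0) (sqr_ge0 (r / 2)).
exists (2 * B / (r / 2) ^+ 2) => //.
move=> p q pab _; have [h|h] := ltP `|q - p| (r / 2).
  apply: (le_trans (Hr p _ q h)); first by rewrite /= in_itv.
  by rewrite lerDl; apply: mulr_ge0 => //; exact: sqr_ge0.
apply: (@le_trans _ _ (2 * B)).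
  by apply: (le_trans (ler_normB _ _)); rewrite mulrDl mul1r lerD.
rewrite -[leLHS]add0r; apply: lerD; first exact: ltW.
have q0 : 0 < (r / 2) ^+ 2 by rewrite exprn_gt0.
rewrite -(mulrA (2 * B)) -[leLHS]mulr1; apply: ler_wpM2l; first by rewrite mulr_ge0.
rewrite mulrC ler_pdivlMr// mul1r -[leRHS]real_normK ?num_real//.
by rewrite ler_pXn2r// ?nnegrE ?(ltW r2).
Unshelve. all: by end_near. Qed.

(** Bernstein approximation after the change of variable $p=(1+\sin(y/2M))/2$, which is injective on
    $|y|\le M$. Since a Bernstein value is an average of values of [f], the bound [B] holds on the
    whole line, although the approximation is only claimed on $[-M,M]$; the tails can then be
    handled by probability alone. *)
Lemma trig_approximation f (B e M : R) : continuous f -> (forall x, `|f x| <= B) ->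
  0 < e -> 0 < M ->
  exists h, [/\ trig h, (forall x, `|h x| <= B) &
    forall x, `|x| <= M -> `|h x - f x| <= e].
Proof.
move=> cf fB e0 M0.
pose s1 : R := sin 2^-1.
have pi2 : (2^-1 : R) <= pi / 2.
  by apply: (le_trans _ (pihalf_ge1 R)); rewrite invf_le1// ler1n.
have half0 : 0 < (2^-1 : R) by rewrite invr_gt0.
have s1_lt : -1 < s1 < 1.
  have c0 : 0 < cos (2^-1 : R).
    apply: cos_gt0_pihalf; apply/andP; split.
      by rewrite ltrNl; apply: lt_le_trans pi2; rewrite (@lt_trans _ _ 0)// oppr_lt0.
    by apply: (lt_le_trans _ (pihalf_ge1 R)); rewrite invf_lt1// ltr1n.
  have := cos2Dsin2 (2^-1 : R); rewrite -/s1 => E.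
  by rewrite -ltr_norml -(@expr_lt1 _ 2)// real_normK ?num_real//; nra.
have /andP[s1N s11] := s1_lt.
(* Clamping to $[-\sin\frac12,\sin\frac12]$ keeps [asin] away from $\pm1$, so the pulled-back
   function is continuous on the whole line; the clamp is inactive when $|y|\le M$. *)
pose clamp (p : R) := Num.max (- s1) (Num.min s1 (2 * p - 1)).
have s10 : 0 <= s1.
  apply: sin_ge0_pi; rewrite (ltW half0)/=; apply: (le_trans pi2).
  by rewrite ler_pdivrMr// ler_peMr ?pi_ge0// ler1n.
have clampb p : -1 < clamp p < 1.
  apply/andP; split; first by rewrite lt_max ltrNl opprK s11.
  by rewrite gt_max gt_min s11 andbT/= ltrNl.
pose L : R := 2 * M.
have L0 : 0 < L by rewrite mulr_gt0.
pose g p := f (L * asin (clamp p)).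
have cg : continuous g.
  move=> p.
  apply: (@continuous_comp _ _ _ (fun p => L * asin (clamp p)) f); last exact: cf.
  apply: cvgM; first exact: cvg_cst.
  apply: (@continuous_comp _ _ _ clamp asin); last exact: continuous_asin.
  apply: (@continuous_max R R (cst (- s1)) (fun p => Num.min s1 (2 * p - 1))); first exact: cvg_cst.
  apply: (@continuous_min R R (cst s1) (fun p => 2 * p - 1)); first exact: cvg_cst.
  by apply: cvgB; [apply: cvgM; [exact: cvg_cst|exact: cvg_id]|exact: cvg_cst].
have gB p : `|g p| <= B by exact: fB.
have e2 : 0 < e / 2 by rewrite divr_gt0.
have [C C0 HC] := uniform_quadratic_modulus 0 1 cg gB e2.
have [n n0 Cn] : exists2 n, (0 < n)%N & C / n%:R <= e / 2.
  exists (Num.truncn (C / (e / 2))).+1 => //.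
  rewrite ler_pdivrMr// mulrC -ler_pdivrMr//.
  by rewrite ltW// truncnS_gt.
(* The shift by $\pi/2$ writes $(1+\sin(y/L))/2$ in the shape required by [trig_binom_expect]. *)
pose p (y : R) := (1 + cos (L^-1 * y + - (pi / 2))) / 2.
have p01 y : 0 <= p y <= 1.
  have := cos_geN1 (L^-1 * y + - (pi / 2)); have := cos_le1 (L^-1 * y + - (pi / 2)).
  rewrite /p; lra.
exists (fun y => binom_expect (p y) n (fun k => g (k%:R / n%:R))); split.
- exact: trig_binom_expect.
- move=> y; have [H1 H2] : binom_expect (p y) n (fun k => g (k%:R / n%:R)) <= B /\
     - B <= binom_expect (p y) n (fun k => g (k%:R / n%:R)).
    split.
      rewrite -[leRHS](binom_expect_cst (p y) n); apply: binom_expect_le => // k _.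
      exact: le_trans (ler_norm _) (gB _).
    rewrite -[leLHS](binom_expect_cst (p y) n); apply: binom_expect_le => // k _.
    by rewrite lerNl; apply: le_trans (gB (k%:R / n%:R)); rewrite -normrN ler_norm.
  by rewrite ler_norml H1 H2.
- move=> y yM.
  have gE : g (p y) = f y.
    have pE : 2 * p y - 1 = sin (L^-1 * y).
      by rewrite /p cosBpihalf; field.
    have : -(2^-1) <= L^-1 * y <= 2^-1.
      rewrite -ler_norml normrM gtr0_norm ?invr_gt0// mulrC ler_pdivrMr//.
      by rewrite /L mulrA mulVf// mul1r.
    move=> /andP[y1 y2].
    have yin : L^-1 * y \in `[ (- (pi/2)), pi/2].
      by rewrite in_itv/= (le_trans _ y1) ?(le_trans y2)// lerN2.
    have hin : (2^-1 : R) \in `[ (- (pi/2)), pi/2].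
      by rewrite in_itv/= pi2 (le_trans _ (ltW half0))// oppr_le0 divr_ge0// pi_ge0.
    have nin : (- 2^-1 : R) \in `[ (- (pi/2)), pi/2].
      by rewrite in_itv/= lerN2 pi2/= (le_trans _ pi2)// lerNl (le_trans _ (ltW half0))// oppr_le0 ltW.
    have sm x x' : x \in `[ (- (pi/2)), pi/2] -> x' \in `[ (- (pi/2)), pi/2] -> (sin x <= sin x') = (x <= x' :> R).
      by move=> hx hx'; rewrite !leNgt ltr_sin.
    have c1 : clamp (p y) = sin (L^-1 * y).
      rewrite /clamp pE (min_idPr _); last by rewrite /s1 sm.
      by apply/max_idPr; rewrite -sinN sm.
    by rewrite /g c1 sinK// mulrA mulfV ?gt_eqF// mul1r.
  rewrite [e]splitr; apply: (@le_trans _ _ (e / 2 + C / n%:R)); last by rewrite lerD2l.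
  apply: bernstein_error => // k kn; rewrite -gE; apply: HC => //.
  by rewrite divr_ge0//= ler_pdivrMr ?ltr0n// mul1r ler_nat.
Qed.

End TrigonometricApproximation.

(** * Convergence in law from cosines and tightness *)

Section Levy.
Context {R : realType}.

Lemma trig_continuous (h : R -> R) : trig h -> continuous h.
Proof.
elim=> [u b|f g _ cf _ cg|c f _ cf] y; first exact: continuous_cos_affine.
- by apply: cvgD; [exact: cf|exact: cg].
- by apply: cvgM; [exact: cvg_cst|exact: cf].
Qed.

Lemma trig_bounded (h : R -> R) : trig h -> exists B, forall y, `|h y| <= B.
Proof.
elim=> [u b|f g _ [B1 H1] _ [B2 H2]|c f _ [B H]].
- by exists 1 => y; rewrite ler_norml cos_geN1 cos_le1.
- by exists (B1 + B2) => y; rewrite (le_trans (ler_normD _ _))// lerD.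
- by exists (`|c| * B) => y; rewrite normrM ler_wpM2l.
Qed.

Context d {T : measurableType d} (Q : probability T R).

Lemma integrable_bounded (A : set T) (f : T -> R) (B : R) :
  measurable A -> measurable_fun A f -> (forall t, `|f t| <= B) ->
  Q.-integrable A (EFin \o f).
Proof.
move=> mA mf fB; apply: (@integrable_le _ _ _ Q A _ (cst B)) => //.
exact: finite_measure_integrable_cst.
Qed.

Lemma measurable_abs_gt (Y : T -> R) (M : R) : measurable_fun setT Y ->
  measurable [set t | M < `|Y t|].
Proof.
move=> mY.
have H : measurable_fun setT (fun t => M < `|Y t|).
  by apply: measurable_fun_ltr => //; exact: measurableT_comp.
rewrite (_ : [set t | _] = setT `&` (fun t => M < `|Y t|) @^-1` [set true]).
  exact: H.
by rewrite setTI; apply/seteqP; split => t.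
Qed.

Lemma tail_small (Y : T -> R) (e : R) : measurable_fun setT Y -> 0 < e ->
  exists2 M, 0 < M & fine (Q [set t | M < `|Y t|]) <= e.
Proof.
move=> mY e0.
pose F (n : nat) := [set t | n%:R < `|Y t|].
have : (Q \o F) n @[n --> \oo] --> Q (\bigcap_n F n).
  apply: nonincreasing_cvg_mu => //.
  - by rewrite (le_lt_trans (probability_le1 _ _)) ?ltry//; exact: measurable_abs_gt.
  - by move=> n; exact: measurable_abs_gt.
  - by apply: bigcap_measurable => // n _; exact: measurable_abs_gt.
  - move=> m n mn; apply/subsetPset => t /=; apply: le_lt_trans.
    by rewrite ler_nat.
have -> : \bigcap_n F n = set0.
  apply/seteqP; split => // t /(_ (Num.truncn `|Y t|).+1 I) /=.
  by rewrite /F /= ltNge ltW// truncnS_gt.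
rewrite measure0 => /fine_cvgP[_] /cvgrPdist_lt /(_ _ e0)[N _ H].
exists N.+1%:R => //.
have := H N.+1 (leqnSn _); rewrite /= sub0r normrN => /ltW; apply: le_trans.
exact: ler_norm.
Qed.

Lemma Rintegral_close (A : set T) (Y : T -> R) (f h : R -> R) (B e M : R) :
  measurable A -> measurable_fun setT Y -> continuous f -> continuous h ->
  (forall y, `|f y| <= B) -> (forall y, `|h y| <= B) -> 0 <= e ->
  (forall y, `|y| <= M -> `|h y - f y| <= e) ->
  `|\int[Q]_(t in A) f (Y t) - \int[Q]_(t in A) h (Y t)| <=
    e + 2 * B * fine (Q [set t | M < `|Y t|]).
Proof.
move=> mA mY cf ch fB hB e0 H.
have B0 : 0 <= B by exact: le_trans (fB 0).
have mf : measurable_fun setT (f \o Y).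
  by apply: measurableT_comp => //; exact: continuous_measurable_fun.
have mh : measurable_fun setT (h \o Y).
  by apply: measurableT_comp => //; exact: continuous_measurable_fun.
have iF : Q.-integrable A (EFin \o (f \o Y)).
  by apply: (@integrable_bounded _ _ B) => //; [exact: measurable_funTS|move=> t /=].
have iH : Q.-integrable A (EFin \o (h \o Y)).
  by apply: (@integrable_bounded _ _ B) => //; [exact: measurable_funTS|move=> t /=].
rewrite -RintegralB//.
have iD : Q.-integrable A (EFin \o (fun t => f (Y t) - h (Y t))).
  exact: (integrableB mA iF iH).
apply: (le_trans (le_normr_Rintegral mA iD)).
pose S := [set t | M < `|Y t|].
have mS : measurable S by exact: measurable_abs_gt.
have fm1 : Q S \is a fin_num by exact: fin_num_measure.
have E : fine (\int[Q]_t (e + 2 * B * \1_S t)%R%:E)%E = e + 2 * B * fine (Q S).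
  under eq_integral do rewrite EFinD EFinM.
  rewrite ge0_integralD//=; last 2 first.
    by move=> t _; rewrite lee_fin !mulr_ge0.
    by apply/measurable_EFinP; apply: measurable_funM => //; exact: measurable_indic.
  rewrite integral_cst// [X in (_ * X + _)%E](_ : _ = 1%E); last exact: probability_setT.
  rewrite mule1 ge0_integralZl//=; last 2 first.
    by apply/measurable_EFinP; exact: measurable_indic.
    by rewrite lee_fin mulr_ge0.
  rewrite [X in (_ * X)%E](_ : _ = (fine (Q S))%:E) -?EFinM -?EFinD//.
  by rewrite integral_indic// setIT fineK.
rewrite -E; apply: fine_le.
- by apply: integrable_fin_num => //; exact: (integrable_abse iD).
- apply: integrable_fin_num => //.
  apply: (@integrable_bounded _ _ (e + 2 * B)) => //.
    by apply: measurable_funD => //; apply: measurable_funM => //; exact: measurable_indic.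
  move=> t; rewrite indicE; case: (_ \in _); rewrite ?(mulr1, mulr0, addr0) ger0_norm//.
  - by rewrite addr_ge0// mulr_ge0.
  - by rewrite lerDl mulr_ge0.
apply: (@le_trans _ _ (\int[Q]_(t in A) (e + 2 * B * \1_S t)%R%:E)%E).
  apply: ge0_le_integral => //.
  - apply/measurable_EFinP/measurable_funTS; apply: measurableT_comp => //.
    exact: measurable_funB.
  - apply/measurable_EFinP/measurable_funTS; apply: measurable_funD => //; apply: measurable_funM => //; exact: measurable_indic.
  - move=> t _; rewrite lee_fin; have [h1|h1] := leP `|Y t| M.
      rewrite distrC (le_trans (H _ h1))// lerDl !mulr_ge0//.
    rewrite indicE mem_set//= mulr1 -[leLHS]add0r lerD//.
    by rewrite (le_trans (ler_normB _ _))// mulrDl mul1r lerD.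
apply: ge0_subset_integral => //.
  apply/measurable_EFinP; apply: measurable_funD => //; apply: measurable_funM => //; exact: measurable_indic.
by move=> t _; rewrite lee_fin addr_ge0// !mulr_ge0.
Qed.

End Levy.

Section LevyCriterion.
Context {R : realType}.

Lemma gauss_expect_fin (v : R) (f : R -> R) B : continuous f ->
  (forall y, `|f y| <= B) -> gauss_expect v f \is a fin_num.
Proof.
move=> cf fB; rewrite /gauss_expect; case: ifPn => // _.
apply: integrable_fin_num => //; apply: (@integrable_bounded _ _ _ _ _ _ B) => //.
exact: continuous_measurable_fun.
Qed.

(** The threshold [M] depends on [v] and [e] only and is fixed before [f] and [h], because the
    approximant [h] will itself be chosen in terms of [M]. *)
Lemma gauss_expect_close (v : R) (e : R) : 0 < e -> exists2 M, 0 < M &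
  forall (f h : R -> R) (B e1 : R), continuous f -> continuous h ->
  (forall y, `|f y| <= B) -> (forall y, `|h y| <= B) -> 0 <= e1 ->
  (forall y, `|y| <= M -> `|h y - f y| <= e1) ->
  `|fine (gauss_expect v f) - fine (gauss_expect v h)| <= e1 + 2 * B * e.
Proof.
move=> e0.
have mid : measurable_fun setT (@id R : measurableTypeR R -> R) by exact: measurable_id.
have [M M0 HM] := tail_small (normal_prob 0 (Num.sqrt v)) mid e0.
exists M => // f h B e1 cf ch fB hB e10 H.
have B0 : 0 <= B by exact: le_trans (fB 0).
rewrite /gauss_expect; case: ifPn => _ /=.
  rewrite distrC (le_trans (H 0 _)) ?normr0 ?(ltW M0)// lerDl.
  by rewrite !mulr_ge0// ltW.
have := Rintegral_close (normal_prob 0 (Num.sqrt v)) measurableT mid cf ch fB hB e10 H.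
move=> /le_trans; apply; rewrite lerD2l ler_wpM2l//.
by rewrite mulr_ge0.
Qed.

Context d {T : measurableType d} (P : probability T R).

(** A bounded continuous test function is replaced by a trigonometric polynomial on a large
    interval, at a cost controlled by the tails of [Z n] and of the limit; trigonometric polynomials
    are covered by linearity. Tightness is a hypothesis because it is obtained directly from moment
    bounds on the martingale. The set [A] allows laws restricted to an event. *)
Theorem levy_criterion (A : set T) (Z : nat -> T -> R) (v : R) :
  measurable A -> (forall n, measurable_fun setT (Z n)) -> 0 <= v ->
  (forall u b, \int[P]_(t in A) cos (u * Z n t + b) @[n --> \oo] -->
     fine (P A) * (expR (- (u ^+ 2 * v / 2)) * cos b)) ->
  (forall e : R, 0 < e -> exists M : R, \forall n \near \oo, fine (P [set t | M < `|Z n t|]) <= e) ->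
  cvg_law_on P A Z v.
Proof.
move=> mA mZ v0 Hcos tight f cf [B fB].
have B0 : 0 <= B by exact: le_trans (fB 0).
have fPA : P A \is a fin_num by exact: fin_num_measure.
have mg (g : R -> R) n : continuous g -> measurable_fun A (g \o Z n).
  move=> cg; apply: measurable_funTS; apply: measurableT_comp => //.
  exact: continuous_measurable_fun.
have ig (g : R -> R) C n : continuous g -> (forall y, `|g y| <= C) ->
    P.-integrable A (EFin \o (g \o Z n)).
  by move=> cg gC; apply: (@integrable_bounded _ _ _ _ _ _ C) => //; [exact: mg|move=> t /=].
rewrite -(fineK (gauss_expect_fin v cf fB)) -(fineK fPA) -EFinM.
apply/fine_cvgP; split.
  by apply: nearW => n; apply: integrable_fin_num => //; exact: ig fB.
rewrite (_ : _ \o _ = fun n => \int[P]_(t in A) f (Z n t)); last by [].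
have trig_cvg h : trig h -> \int[P]_(t in A) h (Z n t) @[n --> \oo] -->
    fine (P A) * fine (gauss_expect v h).
  elim=> [u b|g1 g2 t1 c1 t2 c2|c g tg cg].
  - by rewrite gauss_expect_cos//; exact: Hcos.
  - have [B1 H1] := trig_bounded t1; have [B2 H2] := trig_bounded t2.
    have ct1 := trig_continuous t1; have ct2 := trig_continuous t2.
    have -> : gauss_expect v (fun y => g1 y + g2 y) = (gauss_expect v g1 + gauss_expect v g2)%E.
      rewrite /gauss_expect; case: ifPn => _; first by rewrite EFinD.
      under eq_integral do rewrite EFinD.
      rewrite integralD//.
        by apply: (@integrable_bounded _ _ _ _ _ _ B1) => //; exact: continuous_measurable_fun.
      by apply: (@integrable_bounded _ _ _ _ _ _ B2) => //; exact: continuous_measurable_fun.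
    rewrite fineD ?(gauss_expect_fin _ ct1 H1) ?(gauss_expect_fin _ ct2 H2)// mulrDr.
    rewrite (_ : (fun n => _) = (fun n => \int[P]_(t in A) g1 (Z n t) + \int[P]_(t in A) g2 (Z n t))).
      exact: cvgD.
    by apply/funext => n; rewrite RintegralD//; [exact: ig H1|exact: ig H2].
  - have [B1 H1] := trig_bounded tg; have ct := trig_continuous tg.
    have -> : gauss_expect v (fun y => c * g y) = (c%:E * gauss_expect v g)%E.
      rewrite /gauss_expect; case: ifPn => _; first by rewrite EFinM.
      under eq_integral do rewrite EFinM.
      rewrite integralZl//.
      by apply: (@integrable_bounded _ _ _ _ _ _ B1) => //; exact: continuous_measurable_fun.
    rewrite fineM ?(gauss_expect_fin _ ct H1)//= mulrCA.
    rewrite (_ : (fun n => _) = (fun n => c * \int[P]_(t in A) g (Z n t))).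
      by apply: cvgM => //; exact: cvg_cst.
    by apply/funext => n; rewrite RintegralZl//; exact: ig H1.
apply/cvgrPdist_le => e e0.
pose e1 := e / (5 * (1 + 2 * B)).
have b0 : 0 < 1 + 2 * B by rewrite ltr_wpDr// mulr_ge0.
have e10 : 0 < e1 by rewrite divr_gt0// mulr_gt0.
have [M1 M10 HM1] := gauss_expect_close v e10.
have [M2 HM2] := tight _ e10.
pose M := Num.max M1 (Num.max M2 1).
have M0 : 0 < M by rewrite !lt_max M10.
have [h [th hB hf]] := trig_approximation cf fB e10 M0.
have ch := trig_continuous th.
have /cvgrPdist_le/(_ _ e10) Hh := trig_cvg h th.
have G : `|fine (gauss_expect v f) - fine (gauss_expect v h)| <= e1 + 2 * B * e1.
  by apply: HM1 => //; [exact: ltW|move=> y yM; apply: hf; rewrite !le_max yM].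
near=> n.
have n1 : `|fine (P A) * fine (gauss_expect v h) - \int[P]_(t in A) h (Z n t)| <= e1.
  by near: n; exact: Hh.
have n2 : fine (P [set t | M2 < `|Z n t|]) <= e1 by near: n; exact: HM2.
have n3 : `|\int[P]_(t in A) f (Z n t) - \int[P]_(t in A) h (Z n t)| <= e1 + 2 * B * e1.
  apply: (le_trans (@Rintegral_close _ _ _ P A (Z n) f h B e1 M2 mA (mZ n) cf ch fB hB (ltW e10) _)).
    by move=> y yM; apply: hf; rewrite !le_max yM orbT.
  by rewrite lerD2l ler_wpM2l// mulr_ge0.
have PA : 0 <= fine (P A) <= 1.
  by rewrite fine_ge0//= -lee_fin fineK// probability_le1.
have -> : fine (P A) * fine (gauss_expect v f) - \int[P]_(t in A) f (Z n t) =
  fine (P A) * (fine (gauss_expect v f) - fine (gauss_expect v h)) +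
  (fine (P A) * fine (gauss_expect v h) - \int[P]_(t in A) h (Z n t)) -
  (\int[P]_(t in A) f (Z n t) - \int[P]_(t in A) h (Z n t)) by ring.
apply: (le_trans (ler_normB _ _)).
have : e = (2 + 1 + 2) * (e1 * (1 + 2 * B)) by rewrite /e1; field; rewrite gt_eqF.
have k1 : `|fine (P A) * (fine (gauss_expect v f) - fine (gauss_expect v h))| <= e1 + 2 * B * e1.
  rewrite normrM ger0_norm ?(andP PA).1//; apply: le_trans G.
  by rewrite ler_piMl// (andP PA).2.
have k2 := ler_normD (fine (P A) * (fine (gauss_expect v f) - fine (gauss_expect v h)))
  (fine (P A) * fine (gauss_expect v h) - \int[P]_(t in A) h (Z n t)).
move=> ->; have : 0 <= e1 * B by rewrite mulr_ge0// ltW.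
lra.
Unshelve. all: by end_near. Qed.

End LevyCriterion.

(** * Transition probabilities and the Markov property *)

Section TransitionProbability.
Context {R : realType}.
Variables (alpha : R) (q : nat -> R).

(** The law of a binomial thinning of [x] plus an innovation, by recursion on one individual that
    either dies or survives. This form suits inductions on the starting point, on which all moment
    computations rest. *)
Fixpoint tprob (x j : nat) : R :=
  if x is x'.+1 then
    (1 - alpha) * tprob x' j + alpha * (if j is j'.+1 then tprob x' j' else 0)
  else q j.

Lemma tprob_ge0 x j : 0 <= alpha <= 1 -> (forall m, 0 <= q m) -> 0 <= tprob x j.
Proof.
move=> /andP[a0 a1] q0; elim: x j => [|x IH] j //=.
by rewrite addr_ge0// mulr_ge0 ?subr_ge0//; case: j.
Qed.

(** Pascal's rule for the binomial coefficients reproduces the recursion. *)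
Lemma tprob_trans_prob x j : tprob x j = trans_prob alpha q x j.
Proof.
(* The range is extended from $\min(i,j)$ to $j$; the added terms have a vanishing binomial
   coefficient. *)
pose tr i j := \sum_(l < j.+1) ('C(i, l)%:R * alpha ^+ l * (1 - alpha) ^+ (i - l) * q (j - l)%N).
have trE i j' : trans_prob alpha q i j' = tr i j'.
  rewrite /trans_prob /tr.
  rewrite (big_ord_widen _ (fun l : nat => 'C(i, l)%:R * alpha ^+ l * (1 - alpha) ^+ (i - l) * q (j' - l)%N) (_ : (minn i j').+1 <= j'.+1)%N); last by rewrite ltnS geq_minr.
  rewrite [RHS](bigID (fun l : 'I__ => (l < (minn i j').+1)%N)) /= [X in _ = _ + X]big1 ?addr0//.
  move=> l; rewrite ltnS leq_min negb_and => /orP[|]; last by rewrite -ltnS ltn_ord.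
  by rewrite -ltnNge => il; rewrite bin_small// !mul0r.
rewrite trE; elim: x j => [|x IH] j /=.
  rewrite /tr big_ord_recl big1 ?addr0 /=; last by move=> l _; rewrite bin0n !mul0r.
  by rewrite bin0 !mul1r subn0.
rewrite IH; have -> : (if j is j'.+1 then tprob x j' else 0) = if j is j'.+1 then tr x j' else 0.
  by case: j => //.
have pow l : 'C(x, l)%:R * (1 - alpha) ^+ (x.+1 - l) = 'C(x, l)%:R * ((1 - alpha) * (1 - alpha) ^+ (x - l)) :> R.
  have [xl|lx] := ltnP x l; first by rewrite bin_small// !mul0r.
  by rewrite subSn// exprS.
rewrite /tr [RHS]big_ord_recl /= bin0.
under [X in _ = _ + X]eq_bigr => l _.
  rewrite /bump /= add1n binS natrD !mulrDl -!mulrA.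
  rewrite (mulrCA _ (alpha ^+ _)) (mulrA 'C(x, l.+1)%:R) pow subSS.
  over.
rewrite big_split /= [X in _ = X + _](_ : _ = (1 - alpha) * ('C(x, 0)%:R * alpha ^+ 0 * (1 - alpha) ^+ (x - 0) * q (j - 0)%N)); last first.
  by rewrite bin0 !subn0 exprS; ring.
rewrite addrA; congr (_ + _).
  rewrite big_distrr /= big_ord_recl; congr (_ + _); apply: eq_bigr => l _.
  by rewrite lift0; ring.
case: j => [|j]; first by rewrite big_ord0 mulr0.
rewrite big_distrr; apply: eq_bigr => l _ /=.
by rewrite exprS; ring.
Qed.

End TransitionProbability.

Section Chain.
Context {R : realType} {d : measure_display} {T : measurableType d}.
Variables (P : probability T R) (alpha : R) (X0 : T -> nat) (eps : nat -> T -> nat)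
  (xi : nat -> nat -> T -> bool).
Hypothesis model : inar_model P alpha X0 eps xi.

Local Notation Z := (inar_family X0 eps xi).
Local Notation X := (inar_X X0 eps xi).
Local Notation pr A := (fine (P A)).
Let q m : R := pr [set t | eps 1 t = m].

Definition idx_time (i : inar_idx) : nat :=
  match i with None => 0%N | Some (inl k) => k | Some (inr (k, _)) => k end.

Let cyl (J : seq inar_idx) (m : inar_idx -> nat) : set T :=
  \bigcap_(i in [set` J]) [set t | Z i t = m i].

Let upd (m : inar_idx -> nat) i v := fun j => if j == i then v else m j.

Let measurable_Z i m : valid_idx i -> measurable [set t | Z i t = m].
Proof. by case: model => + _ _ _; exact. Qed.

Let measurable_cyl J m : all valid_idx J -> measurable (cyl J m).
Proof.
move=> /allP vJ; apply: fin_bigcap_measurable => [|i /= iJ]; first exact: finite_seq.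
by apply: measurable_Z; exact: vJ.
Qed.

Let cyl_cons i v J m : i \notin J ->
  cyl (i :: J) (upd m i v) = [set t | Z i t = v] `&` cyl J m.
Proof.
move=> iJ; apply/seteqP; split => t.
- move=> H; split; first by have := H i (mem_head _ _); rewrite /upd /= eqxx.
  move=> j /= jJ; have /= := H j; rewrite inE jJ orbT => /(_ isT); rewrite /upd.
  by case: eqVneq => // ji; rewrite -ji jJ in iJ.
- move=> [h1 h2] j /=; rewrite inE /upd; case: eqVneq => [-> _ //|_ /= jJ].
  exact: h2.
Qed.

(** Plays the role of an event of the past at time [k]: independence from all later primitive
    variables, tested on finite cylinders, which is what [mutually_independent] provides. *)
Definition indep_after (k : nat) (B : set T) := measurable B /\
  forall J m, uniq J -> all valid_idx J -> all (fun i => k < idx_time i)%N J ->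
    pr (B `&` cyl J m) = pr B * \prod_(i <- J) pr [set t | Z i t = m i].

Let prD A B : measurable A -> measurable B -> A `&` B = set0 ->
  pr (A `|` B) = pr A + pr B.
Proof.
move=> mA mB AB; rewrite measureU// fineD//; exact: fin_num_measure.
Qed.

Let prod_upd i v J m : i \notin J ->
  \prod_(j <- i :: J) pr [set t | Z j t = upd m i v j] =
  pr [set t | Z i t = v] * \prod_(j <- J) pr [set t | Z j t = m j].
Proof.
move=> iJ; rewrite big_cons /upd eqxx; congr (_ * _).
apply: eq_big_seq => j jJ; case: eqVneq => // ji.
by rewrite -ji jJ in iJ.
Qed.

Let pr_eps k m : (0 < k)%N -> pr [set t | eps k t = m] = q m.
Proof. by move=> k0; case: model => _ -> . Qed.

Let pr_xi1 k j : (0 < k)%N -> (0 < j)%N -> pr [set t | nat_of_bool (xi k j t) = 1%N] = alpha.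
Proof.
move=> k0 j0; case: model => _ _ /(_ k j k0 j0) H _.
rewrite (_ : [set t | _] = [set t | xi k j t]) ?H//.
by apply/seteqP; split => t /=; case: (xi k j t).
Qed.

Let pr_xi0 k j : (0 < k)%N -> (0 < j)%N -> pr [set t | nat_of_bool (xi k j t) = 0%N] = 1 - alpha.
Proof.
move=> k0 j0; rewrite -(pr_xi1 k0 j0).
have vk : valid_idx (Some (inr (k, j))) by rewrite /= k0.
have m0 := measurable_Z 0%N vk; have m1 := measurable_Z 1%N vk.
apply/eqP; rewrite eq_sym subr_eq -prD//.
- rewrite (_ : _ `|` _ = setT) ?probability_setT//.
  by apply/seteqP; split => t //= _; case: (xi k j t); [right|left].
- by apply/seteqP; split => t //= []; case: (xi k j t).
Qed.

Local Notation tprob := (tprob alpha q).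

Let Ssum k x t : nat := (\sum_(j < x) nat_of_bool (xi k j.+1 t) + eps k t)%N.

(** The cylinder over the additional indices [J] is what closes the induction on [x]: the last
    thinning variable is moved into [J] and split according to its value, which is the recursion of
    [tprob]. *)
Let indep_sum k B x y J m : indep_after k B ->
  uniq J -> all valid_idx J -> all (fun i => k < idx_time i)%N J ->
  Some (inl k.+1) \notin J -> (forall j, (j < x)%N -> Some (inr (k.+1, j.+1)) \notin J) ->
  measurable [set t | Ssum k.+1 x t = y] /\
  pr (B `&` [set t | Ssum k.+1 x t = y] `&` cyl J m) =
  pr B * tprob x y * \prod_(i <- J) pr [set t | Z i t = m i].
Proof.
move=> [mB iB].
elim: x y J m => [|x IH] y J m uJ vJ tJ eJ xJ.
  have E : [set t | Ssum k.+1 0 t = y] = [set t | Z (Some (inl k.+1)) t = y].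
    by apply/seteqP; split => t /=; rewrite /Ssum big_ord0 add0n.
  split; first by rewrite E; exact: measurable_Z.
  rewrite E -setIA -cyl_cons// iB /= ?eJ ?leqnn//.
  by rewrite prod_upd//= pr_eps// mulrA.
pose i := Some (inr (k.+1, x.+1)) : inar_idx.
have iJ : i \notin J by exact: xJ.
have vi : valid_idx i by [].
have ui : uniq (i :: J) by rewrite /= iJ.
have vJ' : all valid_idx (i :: J) by rewrite /= vJ.
have tJ' : all (fun i => k < idx_time i)%N (i :: J) by rewrite /= leqnn.
have eJ' : Some (inl k.+1) \notin i :: J by rewrite inE negb_or eJ.
have xJ' j : (j < x)%N -> Some (inr (k.+1, j.+1)) \notin i :: J.
  move=> jx; rewrite inE negb_or xJ ?andbT; last exact: ltnW.
  by apply/eqP => -[] jx'; rewrite jx' ltnn in jx.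
have IH' v y' m' := IH y' (i :: J) (upd m' i v) ui vJ' tJ' eJ' xJ'.
have E : [set t | Ssum k.+1 x.+1 t = y] =
   ([set t | Z i t = 0%N] `&` [set t | Ssum k.+1 x t = y]) `|`
   ([set t | Z i t = 1%N] `&` (if y is y'.+1 then [set t | Ssum k.+1 x t = y'] else set0)).
  apply/seteqP; split => t /=; rewrite /Ssum big_ord_recr /=.
    case: (xi k.+1 x.+1 t); last by rewrite addn0; left.
    by rewrite addn1 addSn; case: y => // y [<-]; right.
  move=> [[h1 h2]|[h1]]; rewrite h1 ?addn0//.
  by case: y => //= y <-; rewrite addn1 addSn.
have mS y' : measurable [set t | Ssum k.+1 x t = y'] by have [] := IH' 0%N y' m.
have mS' : measurable (if y is y'.+1 then [set t | Ssum k.+1 x t = y'] else set0) by case: y E.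
have mi v : measurable [set t | Z i t = v] by exact: measurable_Z.
split; first by rewrite E; apply: measurableU; exact: measurableI.
pose A0 := B `&` [set t | Ssum k.+1 x t = y] `&` cyl (i :: J) (upd m i 0%N).
pose A1 := B `&` (if y is y'.+1 then [set t | Ssum k.+1 x t = y'] else set0) `&` cyl (i :: J) (upd m i 1%N).
rewrite (_ : _ `&` cyl J m = A0 `|` A1); last first.
  rewrite E /A0 /A1 !cyl_cons//.
  apply/seteqP; split => t.
    by move=> [[h1 [[h2 h3]|[h2 h3]]] h4]; [left|right].
  by move=> [[[h1 h2] [h3 h4]]|[[h1 h2] [h3 h4]]]; split => //; split => //; [left|right].
rewrite prD; last 3 first.
- by apply: measurableI; [exact: measurableI|exact: measurable_cyl].
- by apply: measurableI; [exact: measurableI|exact: measurable_cyl].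
- rewrite /A0 /A1 !cyl_cons//; apply/seteqP; split => // t /= [[_ [+ _]] [_ [+ _]]].
  by move=> ->.
have -> : pr A0 = pr B * tprob x y * ((1 - alpha) * \prod_(i <- J) pr [set t | Z i t = m i]).
  by rewrite /A0 (IH' _ _ _).2 prod_upd//= pr_xi0.
have -> : pr A1 = pr B * (if y is y'.+1 then tprob x y' else 0) * (alpha * \prod_(i <- J) pr [set t | Z i t = m i]).
  rewrite /A1; case: (y) => [|y']; first by rewrite setI0 set0I measure0 mulr0 !mul0r.
  by rewrite (IH' _ _ _).2 prod_upd//= pr_xi1.
rewrite [tprob x.+1 y]/=; move: (\prod_(_ <- _) _) (fine (P B)) => Q b.
by case: (y) => [|y']; ring.
Qed.

Let indep_step k B x y : indep_after k B ->
  indep_after k.+1 (B `&` [set t | Ssum k.+1 x t = y]) /\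
  pr (B `&` [set t | Ssum k.+1 x t = y]) = pr B * tprob x y.
Proof.
move=> iB.
have H J m : uniq J -> all valid_idx J -> all (fun i => k.+1 < idx_time i)%N J ->
    measurable [set t | Ssum k.+1 x t = y] /\
    pr (B `&` [set t | Ssum k.+1 x t = y] `&` cyl J m) =
    pr B * tprob x y * \prod_(i <- J) pr [set t | Z i t = m i].
  move=> uJ vJ tJ; apply: indep_sum => //.
  - by apply: sub_all tJ => i; exact: ltnW.
  - by apply/negP => /(allP tJ) /=; rewrite ltnn.
  - by move=> j _; apply/negP => /(allP tJ) /=; rewrite ltnn.
have E : pr (B `&` [set t | Ssum k.+1 x t = y]) = pr B * tprob x y.
  have [_] := H [::] (fun=> 0%N) isT isT isT.
  rewrite big_nil mulr1 (_ : cyl [::] _ = setT) ?setIT//.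
  by apply/seteqP; split.
split=> //; split.
  by apply: measurableI; [case: iB|have [] := H [::] (fun=> 0%N) isT isT isT].
by move=> J m uJ vJ tJ; rewrite (H _ _ uJ vJ tJ).2 E.
Qed.

(** The past as a list, most recent state first. It takes countably many values, so conditioning on
    the past reduces to events [hist k t = h] and no filtration has to be introduced. *)
Fixpoint hist (k : nat) (t : T) : seq nat :=
  if k is k'.+1 then X k t :: hist k' t else [:: X 0 t].

Lemma head_hist k t : head 0%N (hist k t) = X k t.
Proof. by case: k. Qed.

Let histE k y h : [set t | hist k.+1 t = y :: h] =
  [set t | hist k t = h] `&` [set t | Ssum k.+1 (head 0%N h) t = y].
Proof.
apply/seteqP; split => t /=.
  by move=> [<- <-]; rewrite head_hist.
by move=> [<- <-]; rewrite head_hist.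
Qed.

Let indep_hist k h : indep_after k [set t | hist k t = h].
Proof.
have ind0 k' : indep_after k' set0.
  by split => // J m _ _ _; rewrite set0I measure0 mul0r.
elim: k h => [|k IH] [|y h].
- by rewrite (_ : [set t | _] = set0)//; apply/seteqP; split => t.
- case: h => [|z h]; last first.
    by rewrite (_ : [set t | _] = set0)//; apply/seteqP; split => t.
  have E : [set t | hist 0 t = [:: y]] = [set t | Z None t = y].
    by apply/seteqP; split => t /= => [[]|->].
  rewrite E; split; first exact: measurable_Z.
  move=> J m uJ vJ tJ.
  have nJ : None \notin J by apply/negP => /(allP tJ).
  rewrite -cyl_cons//.
  have [_ _ _ ind] := model.
  by rewrite [LHS]ind ?prod_upd//= ?vJ ?nJ.
- by rewrite (_ : [set t | _] = set0)//; apply/seteqP; split => t.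
- by rewrite histE; have [] := indep_step (head 0%N h) y (IH h).
Qed.

Lemma measurable_hist1 k h : measurable [set t | hist k t = h].
Proof. by have [] := indep_hist k h. Qed.

(** Lists of natural numbers are countable, so any set of histories is a countable union of
    elementary events, enumerated here by [pickle]. *)
Lemma measurable_hist k (S : set (seq nat)) : measurable [set t | S (hist k t)].
Proof.
pose G (o : option (seq nat)) := if o is Some h then
  (if `[< S h >] then [set t | hist k t = h] else set0) else set0.
rewrite (_ : [set t | _] = \bigcup_n G (unpickle n)).
  apply: bigcupT_measurable => n; case: (unpickle n) => [h|] //=.
  by case: ifP => // _; exact: measurable_hist1.
apply/seteqP; split => t.
  by move=> Sh; exists (pickle (hist k t)) => //; rewrite pickleK /=; case: asboolP.
by move=> [n _]; case: (unpickle n) => [h|] //=; case: asboolP => // Sh /= ->.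
Qed.

Lemma measurable_fun_hist k d' (U : measurableType d') (F : seq nat -> U) :
  measurable_fun setT (fun t => F (hist k t)).
Proof.
move=> _ Y mY; rewrite setTI; exact: (measurable_hist k (F @^-1` Y)).
Qed.

(** Stated as a product rather than as a conditional probability, so that histories of probability
    zero need no separate treatment. *)
Lemma markov_property k h j :
  P ([set t | hist k t = h] `&` [set t | X k.+1 t = j]) =
  (P [set t | hist k t = h] * (tprob (head 0%N h) j)%:E)%E.
Proof.
have -> : [set t | hist k t = h] `&` [set t | X k.+1 t = j] =
   [set t | hist k.+1 t = j :: h].
  by apply/seteqP; split => t /= => [[<- <-]|[<- <-]].
rewrite histE; have [[m1 _] E] := indep_step (head 0%N h) j (indep_hist k h).
rewrite -[LHS]fineK ?fin_num_measure// E EFinM fineK// fin_num_measure//.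
exact: measurable_hist1.
Qed.

End Chain.

(** * The transition operator, its iterates and its action on polynomials *)

Section TransitionKernel.
Context {R : realType}.
Variables (alpha : R) (q : nat -> R).
Hypothesis alpha01 : 0 <= alpha <= 1.
Hypothesis q_ge0 : forall m, 0 <= q m.
Local Open Scope ereal_scope.
Implicit Types f g : nat -> \bar R.

(** The operator $f\mapsto\mathbb E[f(X_1)\mid X_0=x]$. Extended real values let it act on
    nonnegative functions without integrability conditions. *)
Definition transop f x : \bar R := \sum_(j <oo) f j * (tprob alpha q x j)%:E.

Local Notation kernel := transop.

Let tp_ge0 x j : 0 <= (tprob alpha q x j)%:E.
Proof. by rewrite lee_fin tprob_ge0. Qed.

Lemma kernel_ge0 f x : (forall j, 0 <= f j) -> 0 <= kernel f x.
Proof. by move=> f0; apply: nneseries_ge0 => j _ _; rewrite mule_ge0. Qed.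

Lemma le_kernel f g x : (forall j, 0 <= f j) -> (forall j, f j <= g j) ->
  kernel f x <= kernel g x.
Proof.
move=> f0 fg; apply: lee_nneseries => j _; first by rewrite mule_ge0.
by rewrite lee_wpmul2r.
Qed.

Lemma kernelD f g x : (forall j, 0 <= f j) -> (forall j, 0 <= g j) ->
  kernel (fun j => f j + g j) x = kernel f x + kernel g x.
Proof.
move=> f0 g0; rewrite -nneseriesD; last 2 first.
- by move=> j _ _; rewrite mule_ge0.
- by move=> j _ _; rewrite mule_ge0.
by apply: eq_eseriesr => j _; rewrite ge0_muleDl.
Qed.

Lemma kernelZ (c : R) f x : (forall j, 0 <= f j) ->
  kernel (fun j => c%:E * f j) x = c%:E * kernel f x.
Proof.
move=> f0; rewrite -nneseriesZl; last by move=> j _; rewrite mule_ge0.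
by apply: eq_eseriesr => j _; rewrite muleA.
Qed.

Lemma kernelS f x : (forall j, 0 <= f j) ->
  kernel f x.+1 = (1 - alpha)%:E * kernel f x + alpha%:E * kernel (f \o S) x.
Proof.
move=> f0; have /andP[a0 a1] := alpha01.
rewrite -nneseriesZl; last by move=> j _; rewrite mule_ge0.
rewrite -nneseriesZl; last by move=> j _; rewrite mule_ge0//=.
pose h (j : nat) : \bar R := if j is j'.+1 then alpha%:E * ((f \o S) j' * (tprob alpha q x j')%:E) else 0.
have h0 j : 0 <= h j.
  by case: j => //= j; rewrite mule_ge0 ?lee_fin// mule_ge0.
have -> : \sum_(i <oo) alpha%:E * ((f \o S) i * (tprob alpha q x i)%:E) = \sum_(i <oo) h i.
  rewrite [RHS]nneseries_recl// add0e -nneseries_addn//.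
  by apply: eq_eseriesr => j _; rewrite addn1.
rewrite -nneseriesD//; last first.
  by move=> j _ _; rewrite mule_ge0 ?lee_fin ?subr_ge0// mule_ge0.
apply: eq_eseriesr => j _ /=.
have a1' : (0 <= 1 - alpha)%R by rewrite subr_ge0.
rewrite EFinD ge0_muleDr ?lee_fin ?mulr_ge0 ?tprob_ge0//; last first.
  by case: j => // j; rewrite tprob_ge0.
rewrite EFinM muleCA; congr (_ + _).
by case: j => [|j] /=; rewrite ?mulr0 ?mule0// EFinM muleCA.
Qed.

(** One more individual at the start adds an independent Bernoulli($\alpha$) survivor, so discrete
    derivatives are damped by $\alpha$. Iterating this is the whole ergodic theory of the chain. *)
Lemma kernel_increment f g x : (forall j, 0 <= f j) -> (forall j, 0 <= g j) ->
  (forall j, f j.+1 = f j + g j) ->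
  kernel f x.+1 = kernel f x + alpha%:E * kernel g x.
Proof.
move=> f0 g0 fg; have /andP[a0 a1] := alpha01.
rewrite kernelS// (_ : f \o S = fun j => f j + g j); last by apply/funext.
have k0 := @kernel_ge0 f x f0; have kg0 := @kernel_ge0 g x g0.
rewrite kernelD// ge0_muleDr// addeA -ge0_muleDl ?lee_fin ?subr_ge0//.
by rewrite -EFinD subrK mul1e.
Qed.

Lemma iter_kernel_ge0 n f x : (forall j, 0 <= f j) -> 0 <= iter n kernel f x.
Proof. by move=> f0; elim: n x => [//|n IH] x /=; apply: kernel_ge0. Qed.

Lemma le_iter_kernel n f g x : (forall j, 0 <= f j) -> (forall j, f j <= g j) ->
  iter n kernel f x <= iter n kernel g x.
Proof.
move=> f0 fg; elim: n x => [//|n IH] x /=; apply: le_kernel => // j.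
exact: iter_kernel_ge0.
Qed.

Lemma iter_kernelD n f g x : (forall j, 0 <= f j) -> (forall j, 0 <= g j) ->
  iter n kernel (fun j => f j + g j) x = iter n kernel f x + iter n kernel g x.
Proof.
move=> f0 g0; elim: n x => [//|n IH] x /=.
rewrite (_ : iter n kernel (fun j => f j + g j) = fun j => iter n kernel f j + iter n kernel g j).
  by rewrite kernelD// => j; exact: iter_kernel_ge0.
exact/funext.
Qed.

Lemma iter_kernelZ n (c : R) f x : (0 <= c)%R -> (forall j, 0 <= f j) ->
  iter n kernel (fun j => c%:E * f j) x = c%:E * iter n kernel f x.
Proof.
move=> c0 f0; elim: n x => [//|n IH] x /=.
rewrite (_ : iter n kernel _ = fun j => c%:E * iter n kernel f j).
  by rewrite kernelZ// => j; exact: iter_kernel_ge0.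
exact/funext.
Qed.

Lemma iter_kernel_increment n f g x : (forall j, 0 <= f j) -> (forall j, 0 <= g j) ->
  (forall j, f j.+1 = f j + g j) ->
  iter n kernel f x.+1 = iter n kernel f x + (alpha ^+ n)%:E * iter n kernel g x.
Proof.
have /andP[a0 a1] := alpha01.
elim: n f g => [|n IH] f g f0 g0 fg; first by rewrite expr0 mul1e /= fg.
rewrite 2!iterSr (IH _ (fun j => alpha%:E * kernel g j)).
- rewrite iter_kernelZ//; last by move=> j; exact: kernel_ge0.
  by rewrite muleA -EFinM -exprSr.
- by move=> j; exact: kernel_ge0.
- by move=> j; rewrite mule_ge0 ?lee_fin//; exact: kernel_ge0.
- by move=> j; exact: kernel_increment.
Qed.

(* Each unit of the starting point survives [n] steps with probability
   [alpha ^+ n], so the initial value is forgotten geometrically fast. *)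
Lemma iter_kernel_forget n f g x (c : nat -> R) :
  (forall j, 0 <= f j) -> (forall j, 0 <= g j) ->
  (forall j, f j.+1 = f j + g j) ->
  (forall j, iter n kernel g j <= (c j)%:E) ->
  iter n kernel f x <= iter n kernel f 0%N + (alpha ^+ n * \sum_(y < x) c y)%:E.
Proof.
have /andP[a0 a1] := alpha01.
move=> f0 g0 fg gc; elim: x => [|x IH].
  by rewrite big_ord0 mulr0 adde0.
rewrite (iter_kernel_increment _ _ f0 g0 fg) big_ord_recr /= mulrDr EFinD addeA.
by rewrite leeD// EFinM lee_wpmul2l// lee_fin exprn_ge0.
Qed.

Lemma iter_kernel_mono n f g x : (forall j, 0 <= f j) -> (forall j, 0 <= g j) ->
  (forall j, f j.+1 = f j + g j) -> iter n kernel f 0%N <= iter n kernel f x.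
Proof.
have /andP[a0 a1] := alpha01.
move=> f0 g0 fg; elim: x => [//|x IH]; apply: (le_trans IH).
rewrite (iter_kernel_increment _ _ f0 g0 fg) leeDl// mule_ge0//.
  by rewrite lee_fin exprn_ge0.
exact: iter_kernel_ge0.
Qed.

End TransitionKernel.

Section KernelMoments.
Context {R : realType}.
Variables (alpha : R) (q : nat -> R) (e1 e2 e3 : R).
Hypothesis alpha01 : 0 < alpha < 1.
Hypothesis q_ge0 : forall m, 0 <= q m.
Hypothesis q_moment0 : (\sum_(j <oo) (q j)%:E = 1)%E.
Hypothesis q_moment1 : (\sum_(j <oo) (j%:R * q j)%:E = e1%:E)%E.
Hypothesis q_moment2 : (\sum_(j <oo) (j%:R ^+ 2 * q j)%:E = e2%:E)%E.
Hypothesis q_moment3 : (\sum_(j <oo) (j%:R ^+ 3 * q j)%:E = e3%:E)%E.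
Local Notation kernel := (transop alpha q).
Let a01 : 0 <= alpha <= 1.
Proof. by have /andP[h1 h2] := alpha01; rewrite !ltW. Qed.

Lemma kernel_cst (c : R) x : (0 <= c)%R -> kernel (fun=> c%:E) x = c%:E.
Proof.
move=> c0; elim: x => [|x IH].
  rewrite /transop nneseriesZl; last by move=> j _; rewrite lee_fin.
  by rewrite q_moment0 mule1.
rewrite kernelS//= /comp IH -!EFinM -EFinD; congr EFin; ring.
Qed.

Lemma iter_kernel_cst n (c : R) x : (0 <= c)%R -> iter n kernel (fun=> c%:E) x = c%:E.
Proof.
move=> c0; elim: n x => [//|n IH] x /=.
by rewrite (_ : iter n kernel _ = fun=> c%:E); [exact: kernel_cst|exact/funext].
Qed.

(** The lower coefficients, in the starting point $x$, of the conditional second moment (linear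
    term) and third moment (quadratic and linear terms) of the next state. *)
Definition moment2_lin := alpha * (1 - alpha) + 2 * alpha * e1.
Definition moment3_quad := 3 * alpha ^+ 2 * (1 - alpha + e1).
Definition moment3_lin := alpha * (1 - alpha) * (1 - 2 * alpha) + 3 * alpha * (1 - alpha) * e1 + 3 * alpha * e2.

(** This and the two lemmas after it expand powers of $j+1$ in an induction on the start. Together
    they say that the operator is triangular on polynomials of degree at most three, with diagonal
    entries $\alpha^i$; hence the moment equations and the Poisson equation are solvable. *)
Lemma kernel_moment1 x : kernel (fun j => j%:R%:E) x = (alpha * x%:R + e1)%:E.
Proof.
elim: x => [|x IH].
  by rewrite mulr0 add0r -q_moment1; apply: eq_eseriesr.
rewrite (kernelS a01 q_ge0); last by move=> j; rewrite lee_fin ?exprn_ge0.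
rewrite (_ : _ \o S = fun j => (1%:E + j%:R%:E)%E); last first.
  by apply/funext => j /=; rewrite -natr1 EFinD addeC.
rewrite (kernelD a01 q_ge0)// IH ?kernel_cst//.
change (((1 - alpha) * (alpha * x%:R + e1) + alpha * (1 + (alpha * x%:R + e1)))%:E = (alpha * x.+1%:R + e1)%:E).
by congr EFin; rewrite -natr1; ring.
Qed.

Lemma kernel_moment2 x :
  kernel (fun j => (j%:R ^+ 2)%:E) x = (alpha ^+ 2 * x%:R ^+ 2 + moment2_lin * x%:R + e2)%:E.
Proof.
elim: x => [|x IH].
  by rewrite expr0n /= !mulr0 !add0r -q_moment2; apply: eq_eseriesr.
rewrite (kernelS a01 q_ge0); last by move=> j; rewrite lee_fin ?exprn_ge0.
rewrite (_ : _ \o S = fun j => ((j%:R ^+ 2)%:E + (1%:E + 2%:E * j%:R%:E))%E); last first.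
  apply/funext => j /=; rewrite -EFinM -!EFinD -natr1; congr EFin; ring.
rewrite (kernelD a01 q_ge0); last 2 first.
- by move=> j; rewrite lee_fin exprn_ge0.
- by move=> j; rewrite -EFinM -EFinD lee_fin ?addr_ge0 ?mulr_ge0.
rewrite (kernelD a01 q_ge0); last 2 first.
- by move=> j; rewrite lee_fin.
- by move=> j; rewrite -EFinM lee_fin ?mulr_ge0.
rewrite (kernelZ a01 q_ge0); last by move=> j; rewrite lee_fin.
rewrite IH kernel_moment1 kernel_cst//.
change (((1 - alpha) * (alpha ^+ 2 * x%:R ^+ 2 + moment2_lin * x%:R + e2) +
  alpha * (alpha ^+ 2 * x%:R ^+ 2 + moment2_lin * x%:R + e2 + (1 + 2 * (alpha * x%:R + e1))))%:E =
  (alpha ^+ 2 * x.+1%:R ^+ 2 + moment2_lin * x.+1%:R + e2)%:E).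
by congr EFin; rewrite -natr1 /moment2_lin; ring.
Qed.

Lemma kernel_moment3 x :
  kernel (fun j => (j%:R ^+ 3)%:E) x =
  (alpha ^+ 3 * x%:R ^+ 3 + moment3_quad * x%:R ^+ 2 + moment3_lin * x%:R + e3)%:E.
Proof.
elim: x => [|x IH].
  by rewrite !expr0n /= !mulr0 !add0r -q_moment3; apply: eq_eseriesr.
rewrite (kernelS a01 q_ge0); last by move=> j; rewrite lee_fin ?exprn_ge0.
rewrite (_ : _ \o S = fun j => ((j%:R ^+ 3)%:E + (1%:E + (3%:E * j%:R%:E + 3%:E * (j%:R ^+ 2)%:E)))%E); last first.
  apply/funext => j /=; rewrite -!EFinM -!EFinD -natr1; congr EFin; ring.
rewrite (kernelD a01 q_ge0); last 2 first.
- by move=> j; rewrite lee_fin exprn_ge0.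
- by move=> j; rewrite -!EFinM -!EFinD lee_fin ?addr_ge0 ?mulr_ge0 ?exprn_ge0.
rewrite (kernelD a01 q_ge0); last 2 first.
- by move=> j; rewrite lee_fin.
- by move=> j; rewrite -!EFinM -!EFinD lee_fin ?addr_ge0 ?mulr_ge0 ?exprn_ge0.
rewrite (kernelD a01 q_ge0); last 2 first.
- by move=> j; rewrite -!EFinM lee_fin ?mulr_ge0 ?exprn_ge0.
- by move=> j; rewrite -!EFinM lee_fin ?mulr_ge0 ?exprn_ge0.
rewrite !(kernelZ a01 q_ge0); last 2 first.
- by move=> j; rewrite lee_fin ?exprn_ge0.
- by move=> j; rewrite lee_fin ?exprn_ge0.
rewrite IH kernel_moment1 kernel_moment2 kernel_cst//.
change (((1 - alpha) * (alpha ^+ 3 * x%:R ^+ 3 + moment3_quad * x%:R ^+ 2 + moment3_lin * x%:R + e3) +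
  alpha * (alpha ^+ 3 * x%:R ^+ 3 + moment3_quad * x%:R ^+ 2 + moment3_lin * x%:R + e3 +
    (1 + (3 * (alpha * x%:R + e1) + 3 * (alpha ^+ 2 * x%:R ^+ 2 + moment2_lin * x%:R + e2)))))%:E =
  (alpha ^+ 3 * x.+1%:R ^+ 3 + moment3_quad * x.+1%:R ^+ 2 + moment3_lin * x.+1%:R + e3)%:E).
by congr EFin; rewrite -natr1 /moment2_lin /moment3_lin /moment3_quad; ring.
Qed.

End KernelMoments.

(** * Uniform moment bounds and moments of the stationary distribution *)

Section StationaryMoments.
Context {R : realType}.
Variables (alpha : R) (q : nat -> R) (e1 e2 e3 : R).
Hypothesis alpha01 : 0 < alpha < 1.
Hypothesis q_ge0 : forall m, 0 <= q m.
Hypothesis q_moment0 : (\sum_(j <oo) (q j)%:E = 1)%E.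
Hypothesis q_moment1 : (\sum_(j <oo) (j%:R * q j)%:E = e1%:E)%E.
Hypothesis q_moment2 : (\sum_(j <oo) (j%:R ^+ 2 * q j)%:E = e2%:E)%E.
Hypothesis q_moment3 : (\sum_(j <oo) (j%:R ^+ 3 * q j)%:E = e3%:E)%E.
Local Notation kernel := (transop alpha q).
Local Notation q1 := (moment2_lin alpha e1).
Local Notation p2 := (moment3_quad alpha e1).
Local Notation p1 := (moment3_lin alpha e1 e2).
Let a01 : 0 <= alpha <= 1.
Proof. by have /andP[h1 h2] := alpha01; rewrite !ltW. Qed.
Let e1_ge0 : 0 <= e1.
Proof. by rewrite -lee_fin -q_moment1 nneseries_ge0// => j _ _; rewrite lee_fin mulr_ge0. Qed.
Let e2_ge0 : 0 <= e2.
Proof. by rewrite -lee_fin -q_moment2 nneseries_ge0// => j _ _; rewrite lee_fin mulr_ge0 ?exprn_ge0. Qed.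
Let e3_ge0 : 0 <= e3.
Proof. by rewrite -lee_fin -q_moment3 nneseries_ge0// => j _ _; rewrite lee_fin mulr_ge0 ?exprn_ge0. Qed.
Let q1_ge0 : 0 <= q1.
Proof.
have /andP[h1 h2] := a01.
by rewrite /moment2_lin addr_ge0 ?mulr_ge0 ?subr_ge0.
Qed.
Let p2_ge0 : 0 <= p2.
Proof.
have /andP[h1 h2] := a01.
by rewrite /moment3_quad !mulr_ge0 ?exprn_ge0// addr_ge0 ?subr_ge0.
Qed.

Let ge0E (f : nat -> R) : (forall j, 0 <= f j) -> forall j, (0 <= (f j)%:E)%E.
Proof. by move=> f0 j; rewrite lee_fin. Qed.

(** A Foster-Lyapunov argument: $D/(1-r)$ is the fixed point of $z\mapsto rz+D$, so the bound
    reproduces itself at each iteration. *)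
Lemma iter_kernel_drift (f g : nat -> R) (r D : R) x :
  (forall j, 0 <= f j) -> (forall j, 0 <= g j) -> 0 <= r < 1 -> 0 <= D ->
  (forall j, (kernel (EFin \o f) j <= (r * f j + g j)%:E)%E) ->
  (forall n, (iter n kernel (EFin \o g) x <= D%:E)%E) ->
  forall n, (iter n kernel (EFin \o f) x <= (f x + D / (1 - r))%:E)%E.
Proof.
move=> f0 g0 /andP[r0 r1] D0 kf kg; elim=> [|n IH].
  by rewrite lee_fin lerDl divr_ge0// subr_ge0 ltW.
rewrite iterSr.
apply: (@le_trans _ _ (iter n kernel (fun j => r%:E * (EFin \o f) j + (EFin \o g) j)%E x)).
  by apply: le_iter_kernel => // j; exact: kernel_ge0.
rewrite (iter_kernelD a01 q_ge0)//; last by move=> j /=; rewrite -EFinM lee_fin mulr_ge0.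
rewrite (iter_kernelZ a01 q_ge0)//.
apply: (@le_trans _ _ (r%:E * (f x + D / (1 - r))%:E + D%:E)%E).
  by rewrite leeD// lee_wpmul2l// lee_fin.
rewrite -EFinM -EFinD lee_fin.
have r1' : 1 - r != 0 by rewrite subr_eq0 gt_eqF.
rewrite (_ : r * (f x + D / (1 - r)) + D = r * f x + D / (1 - r)); last by field.
by rewrite lerD2r ler_piMl// ltW.
Qed.

Lemma iter_kernel_moment1_bound : exists2 C, 0 <= C &
  forall n x, (iter n kernel (fun j => j%:R%:E) x <= (C * (1 + x%:R))%:E)%E.
Proof.
have /andP[h0 h1] := alpha01.
exists (1 + e1 / (1 - alpha)); first by rewrite addr_ge0// divr_ge0// subr_ge0 ltW.
move=> n x.
have := @iter_kernel_drift (fun j => j%:R) (fun=> e1) alpha e1 x.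
move=> /(_ (fun j => ler0n _ j) (fun=> e1_ge0)).
rewrite (ltW h0) h1 => /(_ isT e1_ge0) H.
apply: (le_trans (H _ _ n)).
- by move=> j; rewrite (kernel_moment1 alpha01 q_ge0 q_moment0 q_moment1).
- by move=> m; rewrite (iter_kernel_cst alpha01 q_ge0 q_moment0).
rewrite lee_fin; have : 0 <= e1 / (1 - alpha) by rewrite divr_ge0// subr_ge0 ltW.
have : 0 <= x%:R :> R by [].
nra.
Qed.

Lemma iter_kernel_moment2_bound : exists2 C, 0 <= C &
  forall n x, (iter n kernel (fun j => (j%:R ^+ 2)%:E) x <= (C * (1 + x%:R) ^+ 2)%:E)%E.
Proof.
have /andP[h0 h1] := alpha01.
have [C1 C10 HC1] := iter_kernel_moment1_bound.
pose K := (q1 * C1 + e2) / (1 - alpha ^+ 2).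
have a2 : 0 <= alpha ^+ 2 < 1 by rewrite exprn_ge0 ?(ltW h0)//= exprn_ilt1// ltW.
have /andP[a20 a21] := a2.
have N0 : 0 <= q1 * C1 + e2 by rewrite addr_ge0// mulr_ge0.
have K0 : 0 <= K by rewrite divr_ge0// subr_ge0 ltW.
exists (1 + K); first by rewrite addr_ge0.
move=> n x.
have := @iter_kernel_drift (fun j => j%:R ^+ 2) (fun j => q1 * j%:R + e2) (alpha ^+ 2) ((q1 * C1 + e2) * (1 + x%:R)) x.
move=> /(_ (fun j => exprn_ge0 2 (ler0n _ j))) H.
apply: (le_trans (H _ _ _ _ _ n)) => //.
- by move=> j; rewrite addr_ge0// mulr_ge0.
- by rewrite mulr_ge0.
- by move=> j; rewrite (kernel_moment2 alpha01 q_ge0 q_moment0 q_moment1 q_moment2) addrA.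
- move=> m.
  rewrite (_ : EFin \o _ = fun j => (q1%:E * j%:R%:E + e2%:E)%E) //.
  rewrite (iter_kernelD a01 q_ge0)//; last by move=> j; rewrite -EFinM lee_fin mulr_ge0.
  rewrite (iter_kernelZ a01 q_ge0)// (iter_kernel_cst alpha01 q_ge0 q_moment0)//.
  apply: (@le_trans _ _ (q1%:E * (C1 * (1 + x%:R))%:E + e2%:E)%E).
    by rewrite leeD// lee_wpmul2l ?lee_fin.
  change ((q1 * (C1 * (1 + x%:R)) + e2)%:E <= ((q1 * C1 + e2) * (1 + x%:R))%:E)%E.
  by rewrite lee_fin (mulrDl (q1 * C1)) (mulrA q1) lerD2l ler_peMr// lerDl.
rewrite lee_fin mulrAC -/K; have : 0 <= x%:R :> R by [].
by move=> ?; nra.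
Qed.

(** Drift with rate $\alpha^3$, the bounds of order one and two controlling the forcing term. The
    absolute value of [moment3_lin] is used because that coefficient can be negative when
    $\alpha>1/2$. *)
Lemma iter_kernel_moment3_bound : exists2 C, 0 <= C &
  forall n x, (iter n kernel (fun j => (j%:R ^+ 3)%:E) x <= (C * (1 + x%:R) ^+ 3)%:E)%E.
Proof.
have /andP[h0 h1] := alpha01.
have [C1 C10 HC1] := iter_kernel_moment1_bound.
have [C2 C20 HC2] := iter_kernel_moment2_bound.
pose K := (p2 * C2 + `|p1| * C1 + e3) / (1 - alpha ^+ 3).
have a2 : 0 <= alpha ^+ 3 < 1 by rewrite exprn_ge0 ?(ltW h0)//= exprn_ilt1// ltW.
have /andP[a20 a21] := a2.
have N0 : 0 <= p2 * C2 + `|p1| * C1 + e3 by rewrite !addr_ge0// mulr_ge0.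
have K0 : 0 <= K by rewrite divr_ge0// subr_ge0 ltW.
exists (1 + K); first by rewrite addr_ge0.
move=> n x.
have := @iter_kernel_drift (fun j => j%:R ^+ 3) (fun j => p2 * j%:R ^+ 2 + (`|p1| * j%:R + e3)) (alpha ^+ 3) ((p2 * C2 + `|p1| * C1 + e3) * (1 + x%:R) ^+ 2) x.
move=> /(_ (fun j => exprn_ge0 3 (ler0n _ j))) H.
have x1 : 1 <= 1 + x%:R :> R by rewrite lerDl.
have x0 : 0 <= 1 + x%:R :> R by rewrite addr_ge0.
apply: (le_trans (H _ _ _ _ _ n)) => //.
- by move=> j; rewrite !addr_ge0// mulr_ge0 ?exprn_ge0.
- by rewrite mulr_ge0 ?exprn_ge0.
- move=> j; rewrite (kernel_moment3 alpha01 q_ge0 q_moment0 q_moment1 q_moment2 q_moment3) lee_fin.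
  by rewrite -!addrA !lerD2l lerD2r ler_wpM2r// ler_norm.
- move=> m.
  rewrite (_ : EFin \o _ = fun j => (p2%:E * (j%:R ^+ 2)%:E + (`|p1|%:E * j%:R%:E + e3%:E))%E) //.
  rewrite (iter_kernelD a01 q_ge0)//; last 2 first.
    by move=> j; rewrite -EFinM lee_fin mulr_ge0 ?exprn_ge0.
    by move=> j; rewrite -EFinM -EFinD lee_fin addr_ge0 ?mulr_ge0 ?exprn_ge0.
  rewrite (iter_kernelD a01 q_ge0)//.
  rewrite !(iter_kernelZ a01 q_ge0)//.
  rewrite (iter_kernel_cst alpha01 q_ge0 q_moment0)//.
  apply: (@le_trans _ _ (p2%:E * (C2 * (1 + x%:R) ^+ 2)%:E + (`|p1|%:E * (C1 * (1 + x%:R))%:E + e3%:E))%E).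
    by rewrite leeD// ?lee_wpmul2l ?lee_fin// leeD// lee_wpmul2l ?lee_fin.
  change ((p2 * (C2 * (1 + x%:R) ^+ 2) + (`|p1| * (C1 * (1 + x%:R)) + e3))%:E <=
    ((p2 * C2 + `|p1| * C1 + e3) * (1 + x%:R) ^+ 2)%:E)%E.
  rewrite lee_fin (mulrDl (p2 * C2 + `|p1| * C1) e3) (mulrDl (p2 * C2)) (mulrA p2) -[leRHS]addrA lerD2l; apply: lerD.
    by rewrite mulrA ler_wpM2l ?mulr_ge0// expr2 ler_peMl.
  by rewrite ler_peMr// exprn_ege1.
rewrite lee_fin mulrAC -/K.
have xx : 0 <= x%:R :> R by [].
have : (1 + x%:R) ^+ 3 = (1 + x%:R) ^+ 2 + x%:R * (1 + x%:R) ^+ 2 :> R by ring.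
have : x%:R ^+ 3 <= (1 + x%:R) ^+ 3 :> R by rewrite ler_pXn2r// ?nnegrE ?lerDr.
have : 0 <= K * (x%:R * (1 + x%:R) ^+ 2).
  by apply: mulr_ge0 => //; apply: mulr_ge0 => //; exact: exprn_ge0.
nra.
Qed.

Variable pi : nat -> R.
Hypothesis pi_stat : is_stationary alpha q pi.

Let pi_ge0 j : 0 <= pi j. Proof. by case: pi_stat. Qed.
Let pi_sum1 : (\sum_(j <oo) (pi j)%:E = 1)%E. Proof. by case: pi_stat. Qed.

Lemma ge0_nneseriesZl (k : \bar R) (f : nat -> \bar R) : (0 <= k)%E ->
  (forall i, 0 <= f i)%E -> (\sum_(i <oo) (k * f i) = k * \sum_(i <oo) f i)%E.
Proof.
move=> k0 f0; rewrite -!ge0_integral_count//; last by move=> i; rewrite mule_ge0.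
by rewrite ge0_integralZl.
Qed.

Lemma stationary_kernel (f : nat -> \bar R) : (forall j, 0 <= f j)%E ->
  (\sum_(i <oo) (pi i)%:E * kernel f i = \sum_(j <oo) (pi j)%:E * f j)%E.
Proof.
move=> f0.
have tp0 i j : (0 <= (tprob alpha q i j)%:E)%E by rewrite lee_fin tprob_ge0.
transitivity (\sum_(i <oo) \sum_(j <oo) (f j * (pi i * tprob alpha q i j)%:E))%E.
  apply: eq_eseriesr => i _; rewrite -nneseriesZl; last by move=> j _; rewrite mule_ge0.
  by apply: eq_eseriesr => j _; rewrite EFinM muleCA.
rewrite nneseries_interchange; last by move=> i j; rewrite mule_ge0// lee_fin mulr_ge0// tprob_ge0.
apply: eq_eseriesr => j _.
rewrite ge0_nneseriesZl//; last by move=> i; rewrite lee_fin mulr_ge0// tprob_ge0.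
have [_ _ ->] := pi_stat; rewrite muleC; congr (_ * _)%E.
by apply: eq_eseriesr => i _; rewrite tprob_trans_prob.
Qed.

Lemma stationary_iter_kernel n (f : nat -> \bar R) : (forall j, 0 <= f j)%E ->
  (\sum_(i <oo) (pi i)%:E * iter n kernel f i = \sum_(j <oo) (pi j)%:E * f j)%E.
Proof.
move=> f0; elim: n => [//|n IH] /=; rewrite stationary_kernel//.
by move=> j; exact: iter_kernel_ge0.
Qed.

Let cap (a j : nat) : R := (minn j a)%:R ^+ 3.

(** No moment of [pi] is assumed, so a bound uniform in the truncation level is derived from
    invariance: [pi] integrates the truncated cube and its $n$-th iterate to the same value. For
    starts below some $N$ the iterate is within $\alpha^nNM^3$ of its value at $0$, which is at most
    $C$; starts above $N$ contribute at most $M^3$ times a small tail of [pi]. *)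
Lemma stationary_cap_bound : exists2 C, 0 <= C &
  forall M, (\sum_(j <oo) (pi j)%:E * (cap M j)%:E <= C%:E)%E.
Proof.
have /andP[h0 h1] := alpha01.
have [C C0 HC] := iter_kernel_moment3_bound.
exists C => // M.
have cap0 j : 0 <= cap M j by rewrite exprn_ge0.
pose g j := cap M j.+1 - cap M j.
have capS j : cap M j <= cap M j.+1.
  by rewrite ler_pXn2r ?nnegrE// ler_nat; lia.
have g0 j : 0 <= g j by rewrite subr_ge0.
have capM j : cap M j <= M%:R ^+ 3 by rewrite ler_pXn2r ?nnegrE// ler_nat geq_minr.
have gM j : g j <= M%:R ^+ 3.
  by apply: (@le_trans _ _ (cap M j.+1)) => //; rewrite gerDl oppr_le0.
have M0 : 0 <= M%:R ^+ 3 :> R by rewrite exprn_ge0.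
have itM (f : nat -> R) n x : (forall j, 0 <= f j) -> (forall j, f j <= M%:R ^+ 3) ->
    (iter n kernel (EFin \o f) x <= (M%:R ^+ 3)%:E)%E.
  move=> f0 fM; rewrite -(iter_kernel_cst alpha01 q_ge0 q_moment0 n x M0).
  by apply: le_iter_kernel => // j; rewrite lee_fin.
have it n x : (iter n kernel (EFin \o cap M) x <= (C + alpha ^+ n * (x%:R * M%:R ^+ 3))%:E)%E.
  apply: (le_trans (@iter_kernel_forget _ _ _ a01 q_ge0 n _ (EFin \o g) x (fun=> M%:R ^+ 3) _ _ _ _)).
  - by move=> j; rewrite lee_fin.
  - by move=> j; rewrite lee_fin.
  - by move=> j /=; rewrite -EFinD; congr EFin; rewrite /g; ring.
  - by move=> j; apply: itM.
  rewrite EFinD leeD//; last by rewrite lee_fin sumr_const card_ord mulr_natl.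
  have := HC n 0%N; rewrite addr0 expr1n mulr1; apply: le_trans.
  apply: (le_iter_kernel a01 q_ge0) => j; rewrite lee_fin //.
  by rewrite ler_pXn2r ?nnegrE// ler_nat geq_minl.
apply/lee_addgt0Pr => e e_gt0.
have tail : (\big[+%E/0%R]_(N <= k <oo) (pi k)%:E)%E @[N --> \oo] --> (0:R)%:E.
  apply: nneseries_tail_cvg; last by move=> k _; rewrite lee_fin.
  by rewrite pi_sum1 ltry.
pose e' := e / 2 / (1 + M%:R ^+ 3).
have M1 : 0 < 1 + M%:R ^+ 3 :> R by rewrite ltr_pwDl.
have e'0 : 0 < e' by rewrite !divr_gt0.
have [N HN] : exists N : nat, (\big[+%E/0%R]_(N <= k <oo) (pi k)%:E <= e'%:E)%E.
  move/fine_cvgP : tail => [[N1 _ H1] /cvgrPdist_le /(_ _ e'0) [N2 _ H2]].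
  exists (N1 + N2)%N; rewrite -(@fineK _ (\big[+%E/0%R]_(_ <= k <oo) (pi k)%:E)%E).
    rewrite lee_fin; have := H2 (N1 + N2)%N (leq_addl _ _); rewrite /= sub0r normrN.
    by apply: le_trans; rewrite ler_norm.
  by apply: H1 => /=; rewrite leq_addr.
(* The number of iterations is chosen after $N$, so that the memory of every start below $N$ has
   faded. *)
have [n Hn] : exists n, alpha ^+ n * (N%:R * M%:R ^+ 3) <= e / 2.
  have := @cvg_expr R alpha; rewrite gtr0_norm// => /(_ h1) /cvgrPdist_le.
  have NM : 0 < 1 + N%:R * M%:R ^+ 3 :> R by rewrite ltr_pwDl// mulr_ge0.
  move=> /(_ (e / 2 / (1 + N%:R * M%:R ^+ 3))) H.
  have [|n _ Hn] := H; first by rewrite !divr_gt0.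
  exists n; have := Hn n (leqnn _); rewrite /= sub0r normrN ger0_norm ?exprn_ge0 ?(ltW h0)//.
  rewrite ler_pdivlMr//; apply: le_trans; rewrite ler_wpM2l ?exprn_ge0 ?(ltW h0)//.
  by rewrite lerDr.
rewrite -(stationary_iter_kernel n)//.
have it0 x : (0 <= iter n kernel (EFin \o cap M) x)%E.
  by apply: iter_kernel_ge0 => // j; rewrite lee_fin.
rewrite (nneseries_split 0 N); last by move=> k _; rewrite mule_ge0 ?lee_fin.
rewrite add0n.
apply: (@le_trans _ _ ((C + e / 2)%:E + (e' * M%:R ^+ 3)%:E)%E).
  apply: leeD.
    apply: (@le_trans _ _ (\sum_(0 <= k < N) (C + e / 2)%:E * (pi k)%:E)%E).
      rewrite !big_nat; apply: lee_sum => k /andP[_ kN].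
      rewrite muleC lee_wpmul2r ?lee_fin//; apply: (le_trans (it _ _)).
      rewrite lee_fin lerD2l; apply: le_trans Hn.
      by rewrite ler_wpM2l ?exprn_ge0 ?(ltW h0)// ler_wpM2r// ler_nat ltnW.
    rewrite -ge0_sume_distrr; last by move=> k _; rewrite lee_fin.
    rewrite -[leRHS]mule1 lee_wpmul2l ?lee_fin ?addr_ge0 ?divr_ge0 ?(ltW e_gt0)//.
    by rewrite -pi_sum1; apply: nneseries_lim_ge => k _ _; rewrite lee_fin.
  apply: (@le_trans _ _ (\big[+%E/0%R]_(N <= k <oo) ((M%:R ^+ 3)%:E * (pi k)%:E))%E).
    apply: lee_nneseries => k _; first by rewrite mule_ge0 ?lee_fin.
    by rewrite muleC lee_wpmul2r ?lee_fin//; exact: itM.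
  rewrite nneseriesZl; last by move=> k _; rewrite lee_fin.
  by rewrite (mulrC e') (EFinM (_ ^+ 3) e'); apply: lee_wpmul2l => //; rewrite lee_fin.
rewrite -!EFinD lee_fin -addrA lerD2l [leRHS]splitr lerD2l.
rewrite /e' -mulrA ler_piMr ?divr_ge0 ?(ltW e_gt0)//.
by rewrite mulrC ler_pdivrMr// mul1r lerDr.
Qed.

End StationaryMoments.

Section StationaryThirdMoment.
Context {R : realType}.
Variables (alpha : R) (q : nat -> R) (e1 e2 e3 : R).
Hypothesis alpha01 : 0 < alpha < 1.
Hypothesis q_ge0 : forall m, 0 <= q m.
Hypothesis q_moment0 : (\sum_(j <oo) (q j)%:E = 1)%E.
Hypothesis q_moment1 : (\sum_(j <oo) (j%:R * q j)%:E = e1%:E)%E.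
Hypothesis q_moment2 : (\sum_(j <oo) (j%:R ^+ 2 * q j)%:E = e2%:E)%E.
Hypothesis q_moment3 : (\sum_(j <oo) (j%:R ^+ 3 * q j)%:E = e3%:E)%E.
Local Notation kernel := (transop alpha q).
Local Notation q1 := (moment2_lin alpha e1).
Local Notation p2 := (moment3_quad alpha e1).
Local Notation p1 := (moment3_lin alpha e1 e2).
Let a01 : 0 <= alpha <= 1.
Proof. by have /andP[h1 h2] := alpha01; rewrite !ltW. Qed.
Let e1_ge0 : 0 <= e1.
Proof. by rewrite -lee_fin -q_moment1 nneseries_ge0// => j _ _; rewrite lee_fin mulr_ge0. Qed.
Let e2_ge0 : 0 <= e2.
Proof. by rewrite -lee_fin -q_moment2 nneseries_ge0// => j _ _; rewrite lee_fin mulr_ge0 ?exprn_ge0. Qed.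
Let e3_ge0 : 0 <= e3.
Proof. by rewrite -lee_fin -q_moment3 nneseries_ge0// => j _ _; rewrite lee_fin mulr_ge0 ?exprn_ge0. Qed.
Let q1_ge0 : 0 <= q1.
Proof.
have /andP[h1 h2] := a01.
by rewrite /moment2_lin addr_ge0 ?mulr_ge0 ?subr_ge0.
Qed.
Let p2_ge0 : 0 <= p2.
Proof.
have /andP[h1 h2] := a01.
by rewrite /moment3_quad !mulr_ge0 ?exprn_ge0// addr_ge0 ?subr_ge0.
Qed.

Variable pi : nat -> R.
Hypothesis pi_stat : is_stationary alpha q pi.
Let pi_ge0 j : 0 <= pi j. Proof. by case: pi_stat. Qed.
Let pi_sum1 : (\sum_(j <oo) (pi j)%:E = 1)%E. Proof. by case: pi_stat. Qed.

Lemma stationary_moment3_lty : (\sum_(j <oo) (j%:R ^+ 3 * pi j)%:E < +oo)%E.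
Proof.
have [C C0 HC] := stationary_cap_bound alpha01 q_ge0 q_moment0 q_moment1 q_moment2 q_moment3 pi_stat.
apply: (@le_lt_trans _ _ C%:E); last exact: ltry.
apply: lime_le.
  by apply: is_cvg_nneseries => j _ _; rewrite lee_fin mulr_ge0 ?exprn_ge0.
apply: nearW => n; apply: le_trans (HC n).
apply: (@le_trans _ _ (\sum_(0 <= j < n) (pi j)%:E * ((minn j n)%:R ^+ 3)%:E)%E).
  rewrite !big_nat; apply: lee_sum => j /andP[_ jn].
  by rewrite (minn_idPl (ltnW jn)) -EFinM mulrC.
by apply: nneseries_lim_ge => j _ _; rewrite mule_ge0 ?lee_fin ?exprn_ge0.
Qed.

Lemma stationary_momentE k : (k <= 3)%N ->
  (\sum_(j <oo) (j%:R ^+ k * pi j)%:E = (pmf_moment pi k)%:E)%E.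
Proof.
move=> k3; rewrite /pmf_moment fineK// ge0_fin_numE; last first.
  by apply: nneseries_ge0 => j _ _; rewrite lee_fin mulr_ge0 ?exprn_ge0.
apply: (@le_lt_trans _ _ (\sum_(j <oo) ((pi j)%:E + (j%:R ^+ 3 * pi j)%:E))%E).
  apply: lee_nneseries => j _; first by rewrite lee_fin mulr_ge0 ?exprn_ge0.
  rewrite -EFinD lee_fin -[X in X + _]mul1r -mulrDl ler_wpM2r//.
  case: j => [|j]; first by rewrite !expr0n /=; case: (k == 0)%N; rewrite ?addr0.
  by rewrite -[leLHS]add0r lerD// ler_weXn2l// ler1n.
rewrite nneseriesD; last 2 first.
- by move=> j _ _; rewrite lee_fin.
- by move=> j _ _; rewrite lee_fin mulr_ge0 ?exprn_ge0.
by rewrite lte_add_pinfty//; [rewrite pi_sum1 ltry|exact: stationary_moment3_lty].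
Qed.

(** The coefficients are taken nonnegative because the sums are split in the extended reals. *)
Lemma stationary_lin (a b c e : R) : 0 <= a -> 0 <= b -> 0 <= c -> 0 <= e ->
  (\sum_(i <oo) (pi i)%:E * (a * i%:R ^+ 3 + b * i%:R ^+ 2 + c * i%:R + e)%:E =
  (a * pmf_moment pi 3 + b * pmf_moment pi 2 + c * pmf_moment pi 1 + e)%:E)%E.
Proof.
move=> a0 b0 c0 e0.
have h k (z : R) : 0 <= z -> forall i : nat, (0 <= z%:E * (i%:R ^+ k * pi i)%:E)%E.
  by move=> z0 i; rewrite -EFinM lee_fin; apply: mulr_ge0 => //; rewrite mulr_ge0 ?exprn_ge0.
have S k z : (k <= 3)%N -> 0 <= z -> (\sum_(i <oo) z%:E * (i%:R ^+ k * pi i)%:E = (z * pmf_moment pi k)%:E)%E.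
  move=> k3 z0; rewrite nneseriesZl; last by move=> i _; rewrite lee_fin mulr_ge0 ?exprn_ge0.
  by rewrite stationary_momentE// -EFinM.
have m0 : pmf_moment pi 0 = 1.
  rewrite /pmf_moment; under eq_eseriesr do rewrite expr0 mul1r.
  by rewrite pi_sum1.
transitivity (\sum_(i <oo) (a%:E * (i%:R ^+ 3 * pi i)%:E + (b%:E * (i%:R ^+ 2 * pi i)%:E +
   (c%:E * (i%:R ^+ 1 * pi i)%:E + e%:E * (i%:R ^+ 0 * pi i)%:E))))%E.
  apply: eq_eseriesr => i _; rewrite -!EFinM -!EFinD; congr EFin; rewrite expr1 expr0; ring.
rewrite nneseriesD; last 2 first.
- by move=> i _ _; exact: h.
- by move=> i _ _; rewrite !adde_ge0//; exact: h.
rewrite nneseriesD; last 2 first.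
- by move=> i _ _; exact: h.
- by move=> i _ _; rewrite !adde_ge0//; exact: h.
rewrite nneseriesD; last 2 first.
- by move=> i _ _; exact: h.
- by move=> i _ _; exact: h.
by rewrite !S// m0 -!EFinD; congr EFin; ring.
Qed.

(** Integrates the three formulas for the operator on monomials against the invariant [pi].
    Finiteness of the third moment allows the identities to be read in the reals. *)
Lemma stationary_moment_eqs :
  [/\ pmf_moment pi 1 = alpha * pmf_moment pi 1 + e1,
      pmf_moment pi 2 = alpha ^+ 2 * pmf_moment pi 2 + q1 * pmf_moment pi 1 + e2 &
      pmf_moment pi 3 = alpha ^+ 3 * pmf_moment pi 3 + p2 * pmf_moment pi 2 +
        p1 * pmf_moment pi 1 + e3].
Proof.
have /andP[al0 al1] := a01.
have sk := stationary_kernel alpha01 q_ge0 pi_stat.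
split.
- have := sk (fun j => j%:R%:E).
  under eq_eseriesr do rewrite (kernel_moment1 alpha01 q_ge0 q_moment0 q_moment1).
  move=> H.
  have := stationary_lin (lexx 0) (lexx 0) al0 e1_ge0.
  under eq_eseriesr do rewrite !mul0r !add0r.
  rewrite !mul0r !add0r => E; have := stationary_lin (lexx 0) (lexx 0) ler01 (lexx 0).
  under eq_eseriesr do rewrite !mul0r !add0r mul1r addr0.
  rewrite !mul0r !add0r mul1r addr0 => E1.
  by apply: EFin_inj; rewrite -E1 -E H// => j; rewrite lee_fin.
- have := sk (fun j => (j%:R ^+ 2)%:E).
  under eq_eseriesr do rewrite (kernel_moment2 alpha01 q_ge0 q_moment0 q_moment1 q_moment2).
  move=> H.
  have := stationary_lin (lexx 0) (exprn_ge0 2 al0) q1_ge0 e2_ge0.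
  under eq_eseriesr do rewrite !mul0r !add0r.
  rewrite !mul0r !add0r => E; have := stationary_lin (lexx 0) ler01 (lexx 0) (lexx 0).
  under eq_eseriesr do rewrite !mul0r !add0r mul1r !addr0.
  rewrite !mul0r !add0r mul1r !addr0 => E1.
  by apply: EFin_inj; rewrite -E1 -E H// => j; rewrite lee_fin exprn_ge0.
- (* [moment3_lin] may be negative, hence the correction by its absolute value *)
  have f0 j : (0 <= (j%:R ^+ 3)%:E + `|p1|%:E * (j%:R)%:E)%E.
    by rewrite -EFinM -EFinD lee_fin addr_ge0 ?mulr_ge0 ?exprn_ge0.
  have k0 i : (0 <= (pi i)%:E * kernel (fun j => (j%:R ^+ 3)%:E) i)%E.
    by rewrite mule_ge0 ?lee_fin//; apply: kernel_ge0 => // j; rewrite lee_fin exprn_ge0.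
  have H := sk (fun j => (j%:R ^+ 3)%:E).
  have E1 := stationary_lin (exprn_ge0 3 al0) p2_ge0 (_ : 0 <= p1 + `|p1|) e3_ge0.
  have E2 := stationary_lin ler01 (lexx 0) (normr_ge0 p1) (lexx 0).
  have p1n : 0 <= p1 + `|p1| by rewrite addrC -lerBlDr sub0r -normrN ler_norm.
  apply: (addIr (`|p1| * pmf_moment pi 1)).
  apply: EFin_inj.
  transitivity (1 * pmf_moment pi 3 + 0 * pmf_moment pi 2 + `|p1| * pmf_moment pi 1 + 0)%:E.
    by congr EFin; ring.
  rewrite -E2.
  transitivity ((alpha ^+ 3 * pmf_moment pi 3 + p2 * pmf_moment pi 2 + (p1 + `|p1|) * pmf_moment pi 1 + e3)%:E); last first.
    by congr EFin; ring.
  rewrite -E1//.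
  transitivity (\sum_(i <oo) ((pi i)%:E * (i%:R ^+ 3)%:E + (pi i)%:E * (`|p1| * i%:R)%:E))%E.
    apply: eq_eseriesr => i _; rewrite -!EFinM -EFinD; congr EFin; ring.
  rewrite nneseriesD; last 2 first.
  + by move=> i _ _; rewrite mule_ge0 ?lee_fin ?exprn_ge0.
  + by move=> i _ _; rewrite mule_ge0 ?lee_fin ?mulr_ge0.
  rewrite -H; last by move=> j; rewrite lee_fin exprn_ge0.
  rewrite -nneseriesD//; last by move=> i _ _; rewrite mule_ge0 ?lee_fin ?mulr_ge0.
  apply: eq_eseriesr => i _.
  rewrite (kernel_moment3 alpha01 q_ge0 q_moment0 q_moment1 q_moment2 q_moment3).
  by rewrite -!EFinM -EFinD; congr EFin; ring.
Qed.

(** The excess $f_a(j)=j^3-\min(j,a)^3$ is nondecreasing, so its iterate at $0$ is at most the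
    [pi]-average of the iterate, which by invariance is the [pi]-average of $f_a$ and is small for
    large [a]. Moving from $0$ to $x$ costs $\alpha^n$ times a sum of iterated increments; these
    increments are quadratic in $j$ uniformly in [a], whence a cubic constant. *)
Lemma iter_kernel_uniform_integrability : exists2 K, 0 <= K & forall e, 0 < e ->
  exists a : nat, forall n x,
    (iter n kernel (fun j => (j%:R ^+ 3 - (minn j a)%:R ^+ 3)%:E) x <=
      (e + alpha ^+ n * (K * (1 + x%:R) ^+ 3))%:E)%E.
Proof.
have /andP[al0 al1] := a01.
have [C C0 HC] := iter_kernel_moment2_bound alpha01 q_ge0 q_moment0 q_moment1 q_moment2.
exists (6 * (C + 1)); first by rewrite mulr_ge0// addr_ge0.
move=> e e0.
pose tail a j : R := j%:R ^+ 3 - (minn j a)%:R ^+ 3.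
have tail0 a j : 0 <= tail a j.
  by rewrite subr_ge0 ler_pXn2r ?nnegrE// ler_nat geq_minl.
have tailS a j : tail a j <= tail a j.+1.
  rewrite /tail; have [ja|] := boolP (j.+1 <= a)%N.
    by rewrite (minn_idPl ja) (minn_idPl (ltnW ja)) !subrr.
  rewrite -ltnNge ltnS => aj; rewrite (minn_idPr aj) (minn_idPr (leqW aj)) lerD2r.
  by rewrite ler_pXn2r ?nnegrE// ler_nat.
have tail_le a j : tail a j.+1 - tail a j <= 6 * (1 + j%:R ^+ 2).
  apply: (@le_trans _ _ (j.+1%:R ^+ 3 - j%:R ^+ 3)).
    have : (minn j a)%:R ^+ 3 <= (minn j.+1 a)%:R ^+ 3 :> R.
      by rewrite ler_pXn2r ?nnegrE// ler_nat; lia.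
    rewrite /tail; lra.
  rewrite -natr1; have : 0 <= j%:R :> R by []; have := sqr_ge0 (j%:R - 1 : R); nra.
have fin : (\sum_(j <oo) (j%:R ^+ 3 * pi j)%:E < +oo)%E := stationary_moment3_lty.
have [a Ha] : exists a : nat, (\big[+%E/0%R]_(a <= k <oo) (k%:R ^+ 3 * pi k)%:E <= e%:E)%E.
  have tl : (\big[+%E/0%R]_(N <= k <oo) (k%:R ^+ 3 * pi k)%:E)%E @[N --> \oo] --> (0:R)%:E.
    by apply: nneseries_tail_cvg => // k _; rewrite lee_fin mulr_ge0 ?exprn_ge0.
  move/fine_cvgP : tl => [[N1 _ H1] /cvgrPdist_le /(_ _ e0) [N2 _ H2]].
  exists (N1 + N2)%N; rewrite -(@fineK _ (\big[+%E/0%R]_(_ <= k <oo) _)%E).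
    rewrite lee_fin; have := H2 (N1 + N2)%N (leq_addl _ _); rewrite /= sub0r normrN.
    by apply: le_trans; rewrite ler_norm.
  by apply: H1 => /=; rewrite leq_addr.
exists a => n x; rewrite -/(tail a _).
have sumt : (\sum_(j <oo) (pi j)%:E * (tail a j)%:E <= e%:E)%E.
  apply: le_trans Ha; rewrite (nneseries_split 0 a); last first.
    by move=> k _; rewrite mule_ge0 ?lee_fin.
  rewrite add0n big_nat big1 ?add0e; last first.
    move=> j /andP[_ ja]; rewrite /tail (minn_idPl (ltnW ja)) subrr mule0//.
  apply: lee_nneseries => k _; first by rewrite mule_ge0 ?lee_fin.
  by rewrite -EFinM lee_fin mulrC ler_wpM2r// gerDl oppr_le0 exprn_ge0.
pose g j := tail a j.+1 - tail a j.
have g0 j : 0 <= g j by rewrite subr_ge0.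
have fE j : ((EFin \o tail a) j.+1 = (EFin \o tail a) j + (EFin \o g) j)%E.
  by rewrite /= -EFinD; congr EFin; rewrite /g; ring.
have t0 j : (0 <= (EFin \o tail a) j)%E by rewrite lee_fin.
have gg0 j : (0 <= (EFin \o g) j)%E by rewrite lee_fin.
apply: (le_trans (@iter_kernel_forget _ _ _ a01 q_ge0 n _ (EFin \o g) x
  (fun j => 6 * (C + 1) * (1 + j%:R) ^+ 2) t0 gg0 fE _)).
  move=> j; apply: (@le_trans _ _ (iter n kernel (fun j => 6%:E + 6%:E * (j%:R ^+ 2)%:E)%E j)).
    apply: (le_iter_kernel a01 q_ge0) => // i.
    by rewrite -EFinM -EFinD lee_fin; have := tail_le a i; rewrite mulrDr mulr1.
  rewrite (iter_kernelD a01 q_ge0)//.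
  rewrite (iter_kernelZ a01 q_ge0)//.
  rewrite (iter_kernel_cst alpha01 q_ge0 q_moment0)//.
  apply: (@le_trans _ _ (6%:E + 6%:E * (C * (1 + j%:R) ^+ 2)%:E)%E).
    by rewrite leeD// lee_wpmul2l ?lee_fin.
  change ((6 + 6 * (C * (1 + j%:R) ^+ 2))%:E <= (6 * (C + 1) * (1 + j%:R) ^+ 2)%:E)%E.
  rewrite lee_fin; have : 1 <= (1 + j%:R) ^+ 2 :> R by rewrite exprn_ege1// lerDl.
  nra.
rewrite EFinD; apply: leeD.
  apply: le_trans sumt; rewrite -(stationary_iter_kernel alpha01 q_ge0 pi_stat n t0).
  rewrite -[leLHS]mule1 -pi_sum1 -ge0_nneseriesZl//; last exact: (iter_kernel_ge0 a01 q_ge0).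
  apply: lee_nneseries => i _; first by rewrite mule_ge0 ?lee_fin//; exact: (iter_kernel_ge0 a01 q_ge0).
  rewrite muleC lee_wpmul2l ?lee_fin//.
  exact: (iter_kernel_mono a01 q_ge0 n i t0 gg0 fE).
rewrite lee_fin ler_wpM2l ?exprn_ge0//.
apply: (@le_trans _ _ (\sum_(y < x) (6 * (C + 1) * (1 + x%:R) ^+ 2))).
  apply: ler_sum => y _; rewrite ler_wpM2l ?mulr_ge0 ?addr_ge0//.
  by rewrite ler_pXn2r ?nnegrE ?addr_ge0// lerD2l ler_nat ltnW.
rewrite sumr_const card_ord -[leLHS]mulr_natl (mulrCA x%:R); apply: ler_wpM2l.
  by apply: mulr_ge0 => //; apply: addr_ge0.
by rewrite exprS; apply: ler_wpM2r; rewrite ?lerDr// sqr_ge0.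
Qed.

End StationaryThirdMoment.

(** * Expectations along the chain *)

Section ChainIntegrals.
Context {R : realType} {d : measure_display} {T : measurableType d}.
Variables (P : probability T R) (alpha : R) (X0 : T -> nat) (eps : nat -> T -> nat)
  (xi : nat -> nat -> T -> bool).
Hypothesis model : inar_model P alpha X0 eps xi.
Hypothesis alpha01 : 0 < alpha < 1.

Local Notation X := (inar_X X0 eps xi).
Local Notation hist := (hist X0 eps xi).
Local Notation q := (fun m => fine (P [set t | eps 1%N t = m])).
Local Notation kernel := (transop alpha q).
Let a01 : 0 <= alpha <= 1.
Proof. by have /andP[h1 h2] := alpha01; rewrite !ltW. Qed.
Let q_ge0 m : 0 <= q m. Proof. by rewrite fine_ge0. Qed.

Let integral_fibers (D : set T) (Z : T -> nat) (F : T -> \bar R) :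
  measurable D -> (forall m, measurable [set t | Z t = m]) -> measurable_fun setT F ->
  (forall t, 0 <= F t)%E ->
  (\int[P]_(t in D) F t = \sum_(m <oo) \int[P]_(t in D `&` [set t | Z t = m]) F t)%E.
Proof.
move=> mD mZ mF F0.
have E : D = \bigcup_m (D `&` [set t | Z t = m]).
  by apply/seteqP; split => t; [move=> Dt; exists (Z t)|move=> [m _ []]].
rewrite {1}E ge0_integral_bigcup//.
- by move=> k; exact: measurableI.
- by rewrite -E; exact: measurable_funTS.
- by apply/trivIsetP => i j _ _ ij; apply/seteqP; split => // t [[_ /= zi] [_ /= zj]]; rewrite -zi -zj eqxx in ij.
Qed.

Lemma integral_nat_valued (Z : T -> nat) (f : nat -> \bar R) :
  (forall m, measurable [set t | Z t = m]) -> (forall j, 0 <= f j)%E ->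
  (\int[P]_t f (Z t) = \sum_(j <oo) f j * P [set t | Z t = j])%E.
Proof.
move=> mZ f0; have mf : measurable_fun setT (f \o Z).
  move=> _ Y mY; rewrite setTI.
  rewrite (_ : _ @^-1` Y = \bigcup_m (if `[< Y (f m) >] then [set t | Z t = m] else set0)).
    by apply: bigcupT_measurable => m; case: asboolP.
  apply/seteqP; split => t /=.
    by move=> Yt; exists (Z t) => //; case: asboolP.
  by move=> [m _]; case: asboolP => // Ym /= ->.
rewrite (integral_fibers measurableT mZ mf); last by move=> t /=.
apply: eq_eseriesr => j _; rewrite setTI.
transitivity (\int[P]_(t in [set t | Z t = j]) (cst (f j) t))%E; last by rewrite integral_cst.
by apply: eq_integral => t; rewrite inE /= => ->.
Qed.

Let measurable_pickle k m : measurable [set t | pickle (hist k t) = m].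
Proof. exact: (measurable_hist model k (fun h => pickle h = m)). Qed.

Let eq_integral_hist k (F G : T -> \bar R) :
  measurable_fun setT F -> measurable_fun setT G -> (forall t, 0 <= F t)%E ->
  (forall t, 0 <= G t)%E ->
  (forall h, \int[P]_(t in [set t | hist k t = h]) F t = \int[P]_(t in [set t | hist k t = h]) G t)%E ->
  (\int[P]_t F t = \int[P]_t G t)%E.
Proof.
move=> mF mG F0 G0 FG.
rewrite (integral_fibers measurableT (measurable_pickle k) mF F0).
rewrite (integral_fibers measurableT (measurable_pickle k) mG G0).
apply: eq_eseriesr => m _; rewrite setTI.
have [[h hm]|nh] := pselect (exists h : seq nat, pickle h = m).
  rewrite (_ : [set t | _] = [set t | hist k t = h])//.
  apply/seteqP; split => t /=; last by move=> ->.
  by rewrite -hm => /(pcan_inj (@pickleK _)).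
rewrite (_ : [set t | _] = set0); first by rewrite !integral_set0.
by apply/seteqP; split => // t /= ht; apply: nh; exists (hist k t).
Qed.

Let measurable_fun_histS k (F : seq nat -> nat -> \bar R) :
  measurable_fun setT (fun t => F (hist k t) (X k.+1 t)).
Proof.
exact: (measurable_fun_hist model k.+1 (fun h => F (behead h) (head 0%N h))).
Qed.

Let measurable_X k m : measurable [set t | X k t = m].
Proof.
have := measurable_hist model k (fun h => head 0%N h = m).
by rewrite (_ : [set t | _] = [set t | X k t = m])//; apply/seteqP; split => t /=; rewrite head_hist.
Qed.

(** The tower property: both sides are split over the countably many histories, and on each of them
    [markov_property] applies. *)
Lemma integral_step k (f : seq nat -> nat -> \bar R) :
  (forall h j, 0 <= f h j)%E ->
  (\int[P]_t f (hist k t) (X k.+1 t) = \int[P]_t kernel (f (hist k t)) (X k t))%E.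
Proof.
move=> f0.
have K0 h x : (0 <= kernel (f h) x)%E by apply: kernel_ge0.
apply: (@eq_integral_hist k).
- exact: measurable_fun_histS.
- have := measurable_fun_hist model k (fun h => kernel (f h) (head 0%N h))%E.
  by under eq_fun do rewrite head_hist.
- by [].
- by [].
move=> h; set A := [set t | hist k t = h].
have mA : measurable A by exact: (measurable_hist1 model).
transitivity (kernel (f h) (head 0%N h) * P A)%E; last first.
  rewrite -integral_cst//; apply: eq_integral => t; rewrite inE /A /= => <-.
  by rewrite head_hist.
rewrite (integral_fibers mA (measurable_X k.+1)); last 2 first.
- exact: measurable_fun_histS.
- by [].
transitivity (\sum_(j <oo) P A * (f h j * (tprob alpha q (head 0%N h) j)%:E))%E.
  apply: eq_eseriesr => j _.
  transitivity (f h j * P (A `&` [set t | X k.+1 t = j]))%E.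
    rewrite -integral_cst//; last exact: measurableI.
    by apply: eq_integral => t; rewrite inE /A /= => -[<- <-].
  by rewrite (markov_property model) muleCA.
rewrite ge0_nneseriesZl//; last first.
  by move=> j; rewrite mule_ge0// lee_fin tprob_ge0.
by rewrite /transop muleC.
Qed.

Lemma integral_kernel k (f : nat -> \bar R) : (forall j, 0 <= f j)%E ->
  (\int[P]_t f (X k t) = \int[P]_t iter k kernel f (X0 t))%E.
Proof.
elim: k f => [//|k IH] f f0.
rewrite (@integral_step k (fun=> f))//.
by rewrite IH ?iterSr// => j; exact: kernel_ge0.
Qed.

(** Version of [integral_step] with a signed weight [c] known at time [k]. As the operator acts on
    nonnegative functions, the weight is split into positive and negative parts, while [f] stays
    nonnegative. *)
Lemma expect_step k (c g : seq nat -> R) (f : seq nat -> nat -> R) :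
  (forall h j, 0 <= f h j) ->
  (forall h, kernel (EFin \o f h) (head 0%N h) = (g h)%:E) ->
  P.-integrable setT (EFin \o (fun t => c (hist k t) * g (hist k t))) ->
  P.-integrable setT (EFin \o (fun t => c (hist k t) * f (hist k t) (X k.+1 t))) /\
  \int[P]_t (c (hist k t) * f (hist k t) (X k.+1 t)) =
  \int[P]_t (c (hist k t) * g (hist k t)).
Proof.
move=> f0 fg intg.
have ff0 h j : (0 <= (EFin \o f h) j)%E by rewrite lee_fin.
have g0 h : 0 <= g h by rewrite -lee_fin -fg kernel_ge0.
have mg (c' : seq nat -> R) : measurable_fun setT (EFin \o (fun t => c' (hist k t) * g (hist k t))).
  exact: (measurable_fun_hist model k (fun h => (c' h * g h)%:E)).
have mf (c' : seq nat -> R) : measurable_fun setT (EFin \o (fun t => c' (hist k t) * f (hist k t) (X k.+1 t))).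
  exact: (measurable_fun_histS k (fun h j => (c' h * f h j)%:E)).
have pos (c' : seq nat -> R) : (forall h, 0 <= c' h) -> (forall h, c' h <= `|c h|) ->
    [/\ P.-integrable setT (EFin \o (fun t => c' (hist k t) * f (hist k t) (X k.+1 t))),
     P.-integrable setT (EFin \o (fun t => c' (hist k t) * g (hist k t))) &
     (\int[P]_t (c' (hist k t) * f (hist k t) (X k.+1 t))%:E = \int[P]_t (c' (hist k t) * g (hist k t))%:E)%E].
  move=> c0 cc.
  have E : (\int[P]_t (c' (hist k t) * f (hist k t) (X k.+1 t))%:E = \int[P]_t (c' (hist k t) * g (hist k t))%:E)%E.
    rewrite (@integral_step k (fun h j => (c' h * f h j)%:E)); last first.
      by move=> h j; rewrite lee_fin mulr_ge0.
    apply: eq_integral => t _.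
    under [X in kernel X]eq_fun do rewrite EFinM.
    rewrite (kernelZ a01 q_ge0); last by move=> j; rewrite lee_fin.
    by rewrite EFinM -(fg (hist k t)) head_hist.
  have I1 : P.-integrable setT (EFin \o (fun t => c' (hist k t) * g (hist k t))).
    apply: (le_integrable measurableT (mg c') _ intg) => t _ /=.
    rewrite lee_fin !normrM ler_wpM2r// ger0_norm//; exact: cc.
  split=> //; apply/integrableP; split; first exact: mf.
  have := I1 => /integrableP[_].
  under eq_integral do rewrite /= ger0_norm ?mulr_ge0//.
  rewrite -E => H; under eq_integral do rewrite /= ger0_norm ?mulr_ge0//.
  exact: H.
pose cp h := Num.max (c h) 0; pose cn h := Num.max (- c h) 0.
have cE h : c h = cp h - cn h.
  rewrite /cp /cn; have [h0|] := boolP (0 <= c h).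
    by rewrite max_l// max_r ?oppr_le0// subr0.
  by rewrite -ltNge => h0; rewrite max_r ?(ltW h0)// max_l ?oppr_ge0 ?(ltW h0)// sub0r opprK.
have [||i1 i2 e1] := pos cp.
- by move=> h; rewrite /cp le_max lexx orbT.
- by move=> h; rewrite /cp ge_max ler_norm normr_ge0.
have [||j1 j2 e2] := pos cn.
- by move=> h; rewrite /cn le_max lexx orbT.
- by move=> h; rewrite /cn ge_max normr_ge0 -normrN ler_norm.
have fE : (fun t => c (hist k t) * f (hist k t) (X k.+1 t)) =
   (fun t => cp (hist k t) * f (hist k t) (X k.+1 t) - cn (hist k t) * f (hist k t) (X k.+1 t)).
  by apply/funext => t; rewrite cE mulrBl.
have gE : (fun t => c (hist k t) * g (hist k t)) =
   (fun t => cp (hist k t) * g (hist k t) - cn (hist k t) * g (hist k t)).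
  by apply/funext => t; rewrite cE mulrBl.
split; first by rewrite fE; exact: (integrableB measurableT i1 j1).
rewrite fE gE !RintegralB//.
by rewrite /Rintegral e1 e2.
Qed.

End ChainIntegrals.

Section ChainMoments.
Context {R : realType} {d : measure_display} {T : measurableType d}.
Variables (P : probability T R) (alpha : R) (X0 : T -> nat) (eps : nat -> T -> nat)
  (xi : nat -> nat -> T -> bool) (pi : nat -> R).
Hypothesis model : inar_model P alpha X0 eps xi.
Hypothesis alpha01 : 0 < alpha < 1.
Hypothesis X0_cube : (expect_pow P X0 3 < +oo)%E.
Hypothesis eps_cube : (expect_pow P (eps 1%N) 3 < +oo)%E.

Local Notation X := (inar_X X0 eps xi).
Local Notation hist := (hist X0 eps xi).
Local Notation q := (fun m => fine (P [set t | eps 1%N t = m])).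
Local Notation kernel := (transop alpha q).
Local Notation e k := (fine (expect_pow P (eps 1%N) k)).
Local Notation mu := (e 1).
Local Notation s2 := (e 2 - mu ^+ 2).

Hypothesis pi_stat : is_stationary alpha q pi.

Let a01 : 0 <= alpha <= 1.
Proof. by have /andP[h1 h2] := alpha01; rewrite !ltW. Qed.
Let q_ge0 m : 0 <= q m. Proof. by rewrite fine_ge0. Qed.

Lemma integral_probability_cst (r : R) : (\int[P]_t r%:E = r%:E)%E.
Proof.
rewrite (integral_cst P measurableT) [X in (_ * X)%E](_ : _ = 1%E) ?mule1//.
exact: probability_setT.
Qed.

Lemma eps_moment k : (k <= 3)%N -> (\sum_(j <oo) (j%:R ^+ k * q j)%:E = (e k)%:E)%E.
Proof.
have me m : measurable [set t | eps 1%N t = m].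
  by case: model => /(_ (Some (inl 1%N)) m isT).
have S i : (\int[P]_t ((eps 1%N t)%:R ^+ i)%:E = \sum_(j <oo) (j%:R ^+ i * q j)%:E)%E.
  rewrite (@integral_nat_valued _ _ _ P (eps 1%N) (fun j => (j%:R ^+ i)%:E))//.
  by apply: eq_eseriesr => j _; rewrite EFinM fineK// fin_num_measure.
move=> k3; rewrite /expect_pow S fineK// ge0_fin_numE; last first.
  by apply: nneseries_ge0 => j _ _; rewrite lee_fin mulr_ge0 ?exprn_ge0.
apply: (@le_lt_trans _ _ (\sum_(j <oo) ((j%:R ^+ 0 * q j)%:E + (j%:R ^+ 3 * q j)%:E))%E).
  apply: lee_nneseries => j _; first by rewrite lee_fin mulr_ge0 ?exprn_ge0.
  rewrite -EFinD lee_fin -mulrDl ler_wpM2r//.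
  case: j => [|j]; first by rewrite !expr0n /=; case: (k == 0)%N; rewrite ?addr0.
  by rewrite -[leLHS]add0r lerD// ler_weXn2l// ler1n.
rewrite nneseriesD; last 2 first.
- by move=> j _ _; rewrite lee_fin mulr_ge0.
- by move=> j _ _; rewrite lee_fin mulr_ge0 ?exprn_ge0.
rewrite -!S lte_add_pinfty//.
under eq_integral do rewrite expr0.
by rewrite integral_probability_cst ltry.
Qed.

Lemma eps_moment0 : (\sum_(j <oo) (q j)%:E = 1)%E.
Proof.
have := eps_moment (leq0n 3).
under eq_eseriesr do rewrite expr0 mul1r.
move=> ->; congr EFin; rewrite /expect_pow.
under eq_integral do rewrite expr0.
by rewrite integral_probability_cst.
Qed.

Lemma eps_moment1 : (\sum_(j <oo) (j%:R * q j)%:E = mu%:E)%E.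
Proof. by rewrite -(@eps_moment 1)//; apply: eq_eseriesr => j _; rewrite expr1. Qed.

Lemma eps_moment2 : (\sum_(j <oo) (j%:R ^+ 2 * q j)%:E = (e 2)%:E)%E.
Proof. exact: eps_moment. Qed.

Lemma eps_moment3 : (\sum_(j <oo) (j%:R ^+ 3 * q j)%:E = (e 3)%:E)%E.
Proof. exact: eps_moment. Qed.

Let mu_ge0 : 0 <= mu.
Proof. by rewrite fine_ge0// integral_ge0// => t _; rewrite lee_fin. Qed.

(** Adaptedness expressed as being a function of the history; since histories are countable,
    measurability is automatic. *)
Definition adapted k (f : T -> R) := exists F : seq nat -> R, forall t, f t = F (hist k t).

Lemma adapted_measurable k f : adapted k f -> measurable_fun setT f.
Proof. by move=> [F /funext ->]; exact: (measurable_fun_hist model). Qed.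

Lemma adaptedS k f : adapted k f -> adapted k.+1 f.
Proof. by move=> [F FE]; exists (F \o behead). Qed.

Lemma adapted_cst k c : adapted k (fun=> c).
Proof. by exists (fun=> c). Qed.

Lemma adapted_X k : adapted k (fun t => (X k t)%:R).
Proof. by exists (fun h => (head 0%N h)%:R) => t; rewrite head_hist. Qed.

Lemma adapted_comp k (g : R -> R) f : adapted k f -> adapted k (g \o f).
Proof. by move=> [F FE]; exists (g \o F) => t /=; rewrite FE. Qed.

Lemma adapted_op2 (op : R -> R -> R) k f g : adapted k f -> adapted k g ->
  adapted k (fun t => op (f t) (g t)).
Proof. by move=> [F FE] [G GE]; exists (fun h => op (F h) (G h)) => t; rewrite FE GE. Qed.

Lemma cube_le (x : R) : 0 <= x -> (1 + x) ^+ 3 <= 4 * (1 + x ^+ 3).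
Proof. by move=> x0; have := sqr_ge0 (x - 1); nra. Qed.

Let intX (k : nat) (c : R) : 0 <= c -> forall f : nat -> R, (forall j, 0 <= f j) ->
  (\int[P]_t (c * f (X k t))%:E = c%:E * \int[P]_t (f (X k t))%:E)%E.
Proof.
move=> c0 f f0; under eq_integral do rewrite EFinM; rewrite ge0_integralZl//; last by move=> t _; rewrite lee_fin.
apply/measurable_EFinP; apply: (@adapted_measurable k).
by exists (fun h => f (head 0%N h)) => t; rewrite head_hist.
Qed.

(** Integrates the cubic bound on the iterates over the law of [X0]. This is the integrability
    budget for everything that follows: cubic growth in one state is admissible, higher growth is
    not. *)
Lemma chain_cube_bound : exists2 C, 0 < C &
  forall k, (\int[P]_t ((1 + (X k t)%:R) ^+ 3)%:E <= C%:E)%E.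
Proof.
have [C C0 HC] := iter_kernel_moment3_bound alpha01 q_ge0 eps_moment0 eps_moment1 eps_moment2 eps_moment3.
have F0 : (\int[P]_t ((X0 t)%:R ^+ 3)%:E)%E \is a fin_num.
  by rewrite ge0_fin_numE ?integral_ge0// => t _; rewrite lee_fin exprn_ge0.
have B k : (\int[P]_t ((1 + (X k t)%:R) ^+ 3)%:E <= 4%:E * (1 + \int[P]_t ((X k t)%:R ^+ 3)%:E))%E.
  apply: (@le_trans _ _ (\int[P]_t (4 * (1 + (X k t)%:R ^+ 3))%:E)%E).
    apply: ge0_le_integral => //.
    - apply/measurable_EFinP; apply: (@adapted_measurable k).
      by apply: (adapted_comp (fun x => (1 + x) ^+ 3)); exact: adapted_X.
    - apply/measurable_EFinP; apply: (@adapted_measurable k).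
      by apply: (adapted_comp (fun x => 4 * (1 + x ^+ 3))); exact: adapted_X.
    - by move=> t _; rewrite lee_fin cube_le.
  rewrite (@intX k 4 _ (fun j => 1 + j%:R ^+ 3))//.
  rewrite lee_wpmul2l ?lee_fin//; under eq_integral do rewrite EFinD.
  rewrite ge0_integralD ?integral_probability_cst//.
  apply/measurable_EFinP; apply: (@adapted_measurable k).
  by apply: (adapted_comp (fun x => x ^+ 3)); exact: adapted_X.
set m := fine (\int[P]_t ((X0 t)%:R ^+ 3)%:E)%E.
have m0 : 0 <= m by rewrite fine_ge0// integral_ge0// => t _; rewrite lee_fin exprn_ge0.
exists (4 * (1 + C * (4 * (1 + m)))) => [|k].
  by rewrite mulr_gt0// ltr_pwDl// !mulr_ge0// addr_ge0.
apply: (le_trans (B k)); rewrite EFinM lee_wpmul2l ?lee_fin// EFinD leeD//.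
rewrite (@integral_kernel _ _ _ P alpha X0 eps xi model alpha01 k (fun j => (j%:R ^+ 3)%:E))//.
apply: (@le_trans _ _ (\int[P]_t (C * (1 + (X 0 t)%:R) ^+ 3)%:E)%E).
  apply: ge0_le_integral => //.
  - by move=> t _; apply: (iter_kernel_ge0 a01 q_ge0) => j; rewrite lee_fin exprn_ge0.
  - have := measurable_fun_hist model 0 (fun h => iter k kernel (fun j => (j%:R ^+ 3)%:E) (head 0%N h)).
    exact.
  - apply/measurable_EFinP; apply: (@adapted_measurable 0).
    by apply: (adapted_comp (fun x => C * (1 + x) ^+ 3)); exact: adapted_X.
rewrite (@intX 0 C C0 (fun j => (1 + j%:R) ^+ 3))//.
rewrite EFinM lee_wpmul2l ?lee_fin//; apply: (le_trans (B 0%N)).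
by rewrite EFinM lee_wpmul2l ?lee_fin// EFinD leeD// /m fineK.
Qed.

Lemma chain_integrable k f C : adapted k f ->
  (forall t, `|f t| <= C * (1 + (X k t)%:R) ^+ 3) -> P.-integrable setT (EFin \o f).
Proof.
move=> af fC; have [B B0 HB] := chain_cube_bound.
apply: (@integrable_le _ _ _ P setT f (fun t => `|C| * (1 + (X k t)%:R) ^+ 3)) => //.
- exact: adapted_measurable af.
- apply/integrableP; split.
    apply/measurable_EFinP; apply: (@adapted_measurable k).
    by apply: (adapted_comp (fun x => `|C| * (1 + x) ^+ 3)); exact: adapted_X.
  under eq_integral do rewrite /= ger0_norm ?mulr_ge0 ?exprn_ge0 ?addr_ge0//.
  rewrite (@intX k `|C| _ (fun j => (1 + j%:R) ^+ 3))//.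
  apply: (@le_lt_trans _ _ (`|C|%:E * B%:E)%E); last by rewrite -EFinM ltry.
  by rewrite lee_wpmul2l ?lee_fin.
- by move=> t _; apply: (le_trans (fC t)); rewrite ler_wpM2r ?ler_norm//.
Qed.

Lemma chain_expect_bound : exists2 B, 0 < B & forall k f C, adapted k f ->
  (forall t, `|f t| <= C * (1 + (X k t)%:R) ^+ 3) -> 0 <= C ->
  `|\int[P]_t (f t)| <= C * B.
Proof.
have [B B0 HB] := chain_cube_bound; exists B => // k f C af fC C0.
have if_ := chain_integrable af fC.
apply: (le_trans (le_normr_Rintegral measurableT if_)).
have ac : adapted k (fun t => C * (1 + (X k t)%:R) ^+ 3).
  by apply: (adapted_comp (fun x => C * (1 + x) ^+ 3)); exact: adapted_X.
apply: (@le_trans _ _ (\int[P]_t (C * (1 + (X k t)%:R) ^+ 3))).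
  apply: le_Rintegral => //.
  - exact: (integrable_abse if_).
  - apply: (@chain_integrable k _ C) => // t.
    by rewrite ger0_norm// mulr_ge0// exprn_ge0// addr_ge0.
rewrite /Rintegral (@intX k C C0 (fun j => (1 + j%:R) ^+ 3))//.
have H := HB k.
have fi : (\int[P]_t ((1 + (X k t)%:R) ^+ 3)%:E)%E \is a fin_num.
  rewrite ge0_fin_numE; first exact: le_lt_trans H (ltry _).
  by apply: integral_ge0 => t _; rewrite lee_fin exprn_ge0// addr_ge0.
by rewrite fineM//= ler_wpM2l// -lee_fin fineK.
Qed.

(** Supplies the Lindeberg condition. The term with $\alpha^k$ is the memory of the initial law;
    being summable in [k], it disappears after averaging over $n$ steps. *)
Lemma chain_uniform_integrability tau : 0 < tau -> exists (a : nat) (K : R), 0 <= K /\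
  forall k, \int[P]_t ((1 + (X k t)%:R) ^+ 3 * (a < X k t)%N%:R) <= tau + alpha ^+ k * K.
Proof.
move=> tau0.
have [C C0 HC] := iter_kernel_uniform_integrability alpha01 q_ge0 eps_moment0 eps_moment1 eps_moment2 eps_moment3 pi_stat.
have [B B0 HB] := chain_cube_bound.
have [a Ha] := HC (tau / 10) (divr_gt0 tau0 (ltr0n _ 10)).
exists (2 * a + 1)%N, (10 * (C * B)); split; first by rewrite !mulr_ge0// ltW.
move=> k.
pose tail j : R := j%:R ^+ 3 - (minn j a)%:R ^+ 3.
have tail0 j : 0 <= tail j by rewrite subr_ge0 ler_pXn2r ?nnegrE// ler_nat geq_minl.
have E1 : (\int[P]_t (tail (X k t))%:E <= (tau / 10 + alpha ^+ k * (C * B))%:E)%E.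
  rewrite (@integral_kernel _ _ _ P alpha X0 eps xi model alpha01 k (EFin \o tail)); last first.
    by move=> j; rewrite lee_fin.
  have al0 : 0 <= alpha ^+ k by rewrite exprn_ge0// (andP a01).1.
  apply: (@le_trans _ _ (\int[P]_t (tau / 10 + (alpha ^+ k * C) * (1 + (X 0 t)%:R) ^+ 3)%:E)%E).
    apply: ge0_le_integral => //.
    - by move=> t _; apply: (iter_kernel_ge0 a01 q_ge0) => j; rewrite lee_fin.
    - have := measurable_fun_hist model 0 (fun h => iter k kernel (EFin \o tail) (head 0%N h)).
      exact.
    - apply/measurable_EFinP; apply: (@adapted_measurable 0).
      by apply: (adapted_comp (fun x => tau / 10 + (alpha ^+ k * C) * (1 + x) ^+ 3)); exact: adapted_X.
    - by move=> t _; rewrite -mulrA; exact: Ha.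
  under eq_integral do rewrite EFinD.
  rewrite ge0_integralD//; last 3 first.
  - by move=> t _; rewrite lee_fin divr_ge0// ltW.
  - by move=> t _; rewrite lee_fin mulr_ge0 ?exprn_ge0 ?addr_ge0// mulr_ge0.
  - apply/measurable_EFinP; apply: (@adapted_measurable 0).
    by apply: (adapted_comp (fun x => (alpha ^+ k * C) * (1 + x) ^+ 3)); exact: adapted_X.
  rewrite integral_probability_cst EFinD leeD2l//.
  rewrite (@intX 0 _ _ (fun j => (1 + j%:R) ^+ 3)); last 2 first.
  - exact: mulr_ge0.
  - by move=> j; rewrite exprn_ge0// addr_ge0.
  rewrite (mulrA (alpha ^+ k)) (EFinM (alpha ^+ k * C)).
  by apply: lee_wpmul2l; rewrite ?lee_fin ?mulr_ge0.
(* Beyond $2a+1$ one has $a\le j/2$ and $j\ge2$, so the excess is at least $\frac78j^3$, whereas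
   $(1+j)^3\le\frac{27}8j^3$; the factor $10$ leaves room. *)
have pw (j : nat) : (1 + j%:R) ^+ 3 * (2 * a + 1 < j)%N%:R <= 10 * tail j.
  case: ltnP => [h|_]; last by rewrite mulr0 mulr_ge0.
  rewrite mulr1 /tail (minn_idPr _); last by lia.
  have h1 : 2 * a%:R + 1 <= j%:R :> R by rewrite -natrM natr1 ler_nat; lia.
  have h2 : 2 <= j%:R :> R by rewrite ler_nat; lia.
  have aj : a%:R ^+ 3 <= (j%:R / 2) ^+ 3 :> R.
    rewrite ler_pXn2r ?nnegrE ?divr_ge0// ler_pdivlMr//; lra.
  have jj : (1 + j%:R) ^+ 3 <= (3 / 2 * j%:R) ^+ 3 :> R.
    by rewrite ler_pXn2r ?nnegrE ?addr_ge0 ?mulr_ge0//; lra.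
  have j3 : 0 <= j%:R ^+ 3 :> R by rewrite exprn_ge0.
  move: aj jj; rewrite !exprMn => aj jj; lra.
have at_ : adapted k (fun t => tail (X k t)).
  by exists (fun h => tail (head 0%N h)) => t; rewrite head_hist.
have tail_le j : tail j <= (1 + j%:R) ^+ 3.
  apply: (@le_trans _ _ (j%:R ^+ 3)); first by rewrite gerDl oppr_le0 exprn_ge0.
  by rewrite ler_pXn2r ?nnegrE ?addr_ge0// lerDr.
have it : P.-integrable setT (EFin \o (fun t => 10 * tail (X k t))).
  apply: (@chain_integrable k _ 10).
    exact: (adapted_comp (fun x => 10 * x) at_).
  by move=> t; rewrite ger0_norm ?mulr_ge0// ler_wpM2l.
apply: (@le_trans _ _ (\int[P]_t (10 * tail (X k t)))).
  apply: le_Rintegral => //.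
  apply: (@chain_integrable k _ 1).
    by exists (fun h => (1 + (head 0%N h)%:R) ^+ 3 * (2 * a + 1 < head 0%N h)%N%:R) => t; rewrite head_hist.
  move=> t; rewrite ger0_norm ?mulr_ge0 ?exprn_ge0 ?addr_ge0// mul1r ler_piMr ?exprn_ge0 ?addr_ge0//.
  by case: (_ < _)%N.
have ft : (\int[P]_t (tail (X k t))%:E)%E \is a fin_num.
  rewrite ge0_fin_numE; first exact: le_lt_trans E1 (ltry _).
  by apply: integral_ge0 => t _; rewrite lee_fin.
rewrite /Rintegral (@intX k 10 _ tail)// fineM//=.
have : fine (\int[P]_t (tail (X k t))%:E)%E <= tau / 10 + alpha ^+ k * (C * B).
  by rewrite -lee_fin fineK.
by move=> h; lra.
Qed.

End ChainMoments.

(** * Conditional moments of the innovations and the Poisson equation *)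

Section ConditionalMoments.
Context {R : realType} {d : measure_display} {T : measurableType d}.
Variables (P : probability T R) (alpha : R) (X0 : T -> nat) (eps : nat -> T -> nat)
  (xi : nat -> nat -> T -> bool) (pi : nat -> R).
Hypothesis model : inar_model P alpha X0 eps xi.
Hypothesis alpha01 : 0 < alpha < 1.
Hypothesis X0_cube : (expect_pow P X0 3 < +oo)%E.
Hypothesis eps_cube : (expect_pow P (eps 1%N) 3 < +oo)%E.

Local Notation X := (inar_X X0 eps xi).
Local Notation hist := (hist X0 eps xi).
Local Notation q := (fun m => fine (P [set t | eps 1%N t = m])).
Local Notation kernel := (transop alpha q).
Local Notation e k := (fine (expect_pow P (eps 1%N) k)).
Local Notation mu := (e 1).
Local Notation s2 := (e 2 - mu ^+ 2).
Local Notation adapted := (adapted X0 eps xi).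
Hypothesis pi_stat : is_stationary alpha q pi.
Local Notation q1 := (moment2_lin alpha mu).
Local Notation p2 := (moment3_quad alpha mu).
Local Notation p1 := (moment3_lin alpha mu (e 2)).
Local Notation innov k t := ((X k.+1 t)%:R - alpha * (X k t)%:R - mu).

Let a01 : 0 <= alpha <= 1.
Proof. by have /andP[h1 h2] := alpha01; rewrite !ltW. Qed.
Let q_ge0 m : 0 <= q m. Proof. by rewrite fine_ge0. Qed.
Let e_ge0 k : 0 <= e k.
Proof. by rewrite fine_ge0// integral_ge0// => t _; rewrite lee_fin exprn_ge0. Qed.
Let qm0 := eps_moment0 model eps_cube.
Let qm1 := eps_moment1 model eps_cube.
Let qm2 := eps_moment2 model eps_cube.
Let qm3 := eps_moment3 model eps_cube.
Let kernel1 := kernel_moment1 alpha01 q_ge0 qm0 qm1.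
Let kernel2 := kernel_moment2 alpha01 q_ge0 qm0 qm1 qm2.
Let kernel3 := kernel_moment3 alpha01 q_ge0 qm0 qm1 qm2 qm3.

(** The conditional variance: binomial variance $\alpha(1-\alpha)x$ plus the variance of the
    innovation. The cross term of the square is moved to the other side so that the operator only
    meets nonnegative functions. *)
Lemma kernel_centered_square x :
  kernel (fun j => ((j%:R - (alpha * x%:R + mu)) ^+ 2)%:E) x =
  (alpha * (1 - alpha) * x%:R + s2)%:E.
Proof.
set c := alpha * x%:R + mu.
have c0 : 0 <= c by rewrite addr_ge0// mulr_ge0// (andP a01).1.
have h0 j : (0 <= ((j%:R - c) ^+ 2)%:E)%E by rewrite lee_fin sqr_ge0.
have c2 : 0 <= 2 * c by rewrite mulr_ge0.
have k0 := kernel_ge0 a01 q_ge0 x h0.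
have E1 : (kernel (fun j => ((j%:R - c) ^+ 2)%:E) x + (2 * c)%:E * kernel (fun j => j%:R%:E) x =
   kernel (fun j => (j%:R ^+ 2)%:E) x + (c ^+ 2)%:E)%E.
  rewrite -(kernelZ a01 q_ge0)// -(kernelD a01 q_ge0)//; last first.
    by move=> j; rewrite -EFinM lee_fin mulr_ge0.
  rewrite -(kernel_cst alpha01 q_ge0 qm0 x (sqr_ge0 c)) -(kernelD a01 q_ge0)//; last first.
    by move=> j; rewrite lee_fin sqr_ge0.
  congr (transop _ _ _ _); apply/funext => j; rewrite -EFinM -!EFinD; congr EFin; ring.
move: E1; rewrite kernel1 kernel2 -/c.
case: (kernel _ x) k0 => [r| |]//= _.
change ((r + 2 * c * c)%:E = (alpha ^+ 2 * x%:R ^+ 2 + q1 * x%:R + e 2 + c ^+ 2)%:E -> r%:E = (alpha * (1 - alpha) * x%:R + s2)%:E).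
move=> [E1]; congr EFin.
have -> : r = alpha ^+ 2 * x%:R ^+ 2 + q1 * x%:R + e 2 - c ^+ 2 by rewrite -[r](addrK (2 * c * c)) E1; ring.
by rewrite /moment2_lin /c; ring.
Qed.

(** The martingale property. The weight may grow quadratically: together with one power from the
    innovation this exhausts the three moments available. In [step_square] the same weight is
    admissible because the conditional variance is only linear in the state. *)
Lemma step_mean k c B : adapted k c ->
  (forall t, `|c t| <= B * (1 + (X k t)%:R) ^+ 2) ->
  P.-integrable setT (EFin \o (fun t => c t * innov k t)) /\
  \int[P]_t (c t * innov k t) = 0.
Proof.
move=> [C CE] cB.
pose g (h : seq nat) : R := alpha * (head 0%N h)%:R + mu.
have g0 h : 0 <= g h by rewrite addr_ge0// mulr_ge0// (andP a01).1.
have ig : P.-integrable setT (EFin \o (fun t => C (hist k t) * g (hist k t))).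
  apply: (chain_integrable model alpha01 X0_cube eps_cube (k := k) (C := B * (1 + mu))).
    by exists (fun h => C h * g h).
  move=> t; rewrite normrM -CE (ger0_norm (g0 _)) /g head_hist.
  apply: (le_trans (ler_wpM2r _ (cB t))); first by have := g0 (hist k t); rewrite /g head_hist.
  have B0 : 0 <= B * (1 + (X k t)%:R) ^+ 2 by exact: le_trans (cB t).
  rewrite (_ : B * (1 + mu) * _ = B * (1 + (X k t)%:R) ^+ 2 * ((1 + mu) * (1 + (X k t)%:R))); last by ring.
  rewrite ler_wpM2l//.
  have := ler0n R (X k t); have := e_ge0 1; have /andP[h1 h2] := a01; nra.
have [i1 E1] := @expect_step _ _ _ P alpha X0 eps xi model alpha01 k C g (fun _ j => j%:R)
  (fun _ j => ler0n _ j) (fun h => kernel1 (head 0%N h)) ig.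
have -> : (fun t => c t * innov k t) = (fun t => C (hist k t) * (X k.+1 t)%:R - C (hist k t) * g (hist k t)).
  by apply/funext => t; rewrite CE /g head_hist; ring.
split; first exact: (integrableB measurableT i1 ig).
by rewrite RintegralB// E1 subrr.
Qed.

Lemma step_square k c B : adapted k c ->
  (forall t, `|c t| <= B * (1 + (X k t)%:R) ^+ 2) ->
  P.-integrable setT (EFin \o (fun t => c t * innov k t ^+ 2)) /\
  \int[P]_t (c t * innov k t ^+ 2) = \int[P]_t (c t * (alpha * (1 - alpha) * (X k t)%:R + s2)).
Proof.
move=> [C CE] cB.
pose g (h : seq nat) : R := alpha * (1 - alpha) * (head 0%N h)%:R + s2.
pose f (h : seq nat) (j : nat) : R := (j%:R - (alpha * (head 0%N h)%:R + mu)) ^+ 2.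
have f0 h j : 0 <= f h j by exact: sqr_ge0.
have kg h : kernel (EFin \o f h) (head 0%N h) = (g h)%:E by exact: kernel_centered_square.
have g0 h : 0 <= g h.
  by rewrite -lee_fin -kg; apply: kernel_ge0 => // j; rewrite lee_fin.
have s20 : 0 <= s2 by have := g0 [::]; rewrite /g /= mulr0 add0r.
have ig : P.-integrable setT (EFin \o (fun t => C (hist k t) * g (hist k t))).
  apply: (chain_integrable model alpha01 X0_cube eps_cube (k := k) (C := B * (1 + s2))).
    by exists (fun h => C h * g h).
  move=> t; rewrite normrM -CE (ger0_norm (g0 _)) /g head_hist.
  apply: (le_trans (ler_wpM2r _ (cB t))); first by have := g0 (hist k t); rewrite /g head_hist.
  have B0 : 0 <= B * (1 + (X k t)%:R) ^+ 2 by exact: le_trans (cB t).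
  rewrite (_ : B * (1 + s2) * _ = B * (1 + (X k t)%:R) ^+ 2 * ((1 + s2) * (1 + (X k t)%:R))); last by ring.
  rewrite ler_wpM2l//.
  have x0 := ler0n R (X k t); have /andP[h1 h2] := a01.
  have aa : alpha * (1 - alpha) <= 1 by nra.
  have := mulr_ge0 s20 x0; have := ler_wpM2r x0 aa; rewrite mul1r; nra.
have [i1 E1] := @expect_step _ _ _ P alpha X0 eps xi model alpha01 k C g f f0 kg ig.
have fE : (fun t => c t * innov k t ^+ 2) = (fun t => C (hist k t) * f (hist k t) (X k.+1 t)).
  by apply/funext => t; rewrite CE /f head_hist opprD addrA.
have gE : (fun t => c t * (alpha * (1 - alpha) * (X k t)%:R + s2)) = (fun t => C (hist k t) * g (hist k t)).
  by apply/funext => t; rewrite CE /g head_hist.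
by rewrite fE gE.
Qed.

Let step_moment k c B i (g : nat -> R) : adapted k c -> (forall t, `|c t| <= B) ->
  (i <= 3)%N -> (forall x, kernel (fun j => (j%:R ^+ i)%:E) x = (g x)%:E) ->
  (exists C, forall x, `|g x| <= C * (1 + x%:R) ^+ 3) ->
  [/\ P.-integrable setT (EFin \o (fun t => c t * (X k.+1 t)%:R ^+ i)),
   P.-integrable setT (EFin \o (fun t => c t * g (X k t))) &
  \int[P]_t (c t * (X k.+1 t)%:R ^+ i) = \int[P]_t (c t * g (X k t))].
Proof.
move=> [C CE] cB i3 kg [G gG].
have ig : P.-integrable setT (EFin \o (fun t => C (hist k t) * g (head 0%N (hist k t)))).
  apply: (chain_integrable model alpha01 X0_cube eps_cube (k := k) (C := B * G)).
    by exists (fun h => C h * g (head 0%N h)).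
  move=> t; rewrite normrM -CE head_hist -mulrA ler_pM//.
have [i1 E1] := @expect_step _ _ _ P alpha X0 eps xi model alpha01 k C (fun h => g (head 0%N h)) (fun _ j => j%:R ^+ i)
  (fun _ j => exprn_ge0 _ (ler0n _ j)) (fun h => kg (head 0%N h)) ig.
have fE : (fun t => c t * (X k.+1 t)%:R ^+ i) = (fun t => C (hist k t) * (X k.+1 t)%:R ^+ i).
  by apply/funext => t; rewrite CE.
have gE : (fun t => c t * g (X k t)) = (fun t => C (hist k t) * g (head 0%N (hist k t))).
  by apply/funext => t; rewrite CE head_hist.
by rewrite fE gE; split.
Qed.

(** By triangularity the coefficients are found from the highest degree down, dividing by
    $1-\alpha^i\ne0$. The constant terms balance precisely because of the stationary moment
    equations. When $b_3=0$ the solution is quadratic, which the law of large numbers relies on. *)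
Lemma poisson_solution (b3 b2 : R) : exists g : R * R * R, (b3 = 0 -> g.1.1 = 0) /\ forall x : R,
  (g.1.1 * x ^+ 3 + g.1.2 * x ^+ 2 + g.2 * x) -
  (g.1.1 * (alpha ^+ 3 * x ^+ 3 + p2 * x ^+ 2 + p1 * x + e 3) +
   g.1.2 * (alpha ^+ 2 * x ^+ 2 + q1 * x + e 2) + g.2 * (alpha * x + mu)) =
  b3 * x ^+ 3 + b2 * x ^+ 2 - (b3 * pmf_moment pi 3 + b2 * pmf_moment pi 2).
Proof.
have /andP[al0 al1] := alpha01.
have n1 : 1 - alpha != 0 by rewrite subr_eq0 gt_eqF.
have n2 : 1 - alpha ^+ 2 != 0.
  by rewrite subr_eq0 gt_eqF// exprn_ilt1// ltW.
have n3 : 1 - alpha ^+ 3 != 0.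
  by rewrite subr_eq0 gt_eqF// exprn_ilt1// ltW.
have [m1 m2 m3] := stationary_moment_eqs alpha01 q_ge0 qm0 qm1 qm2 qm3 pi_stat.
move: (pmf_moment pi 1) (pmf_moment pi 2) (pmf_moment pi 3) m1 m2 m3 => M1 M2 M3.
move: (e 3) (e 2) mu q1 p2 p1 => E3 E2 E1 Q1 P2 P1 m1 m2 m3.
pose g3 := b3 / (1 - alpha ^+ 3).
pose g2 := (b2 + g3 * P2) / (1 - alpha ^+ 2).
pose g1 := (g2 * Q1 + g3 * P1) / (1 - alpha).
exists (g3, g2, g1); split => [/= b30|x /=]; first by rewrite /g3 b30 mul0r.
have h3 : g3 * (1 - alpha ^+ 3) = b3 by rewrite /g3 mulfVK.
have h2 : g2 * (1 - alpha ^+ 2) = b2 + g3 * P2 by rewrite /g2 mulfVK.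
have h1 : g1 * (1 - alpha) = g2 * Q1 + g3 * P1 by rewrite /g1 mulfVK.
move: g3 g2 g1 h3 h2 h1 => g3 g2 g1 h3 h2 h1.
have k1 : E1 = (1 - alpha) * M1 by apply: (addrI (alpha * M1)); rewrite -m1; ring.
have k2 : E2 = (1 - alpha ^+ 2) * M2 - Q1 * M1 by apply: (addrI (alpha ^+ 2 * M2 + Q1 * M1)); rewrite -m2; ring.
have k3 : E3 = (1 - alpha ^+ 3) * M3 - P2 * M2 - P1 * M1 by apply: (addrI (alpha ^+ 3 * M3 + P2 * M2 + P1 * M1)); rewrite -m3; ring.
have k0 : b2 = g2 * (1 - alpha ^+ 2) - g3 * P2 by rewrite h2; ring.
transitivity (g3 * (1 - alpha ^+ 3) * (x ^+ 3 - M3) + (g2 * (1 - alpha ^+ 2) - g3 * P2) * (x ^+ 2 - M2) +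
   (g1 * (1 - alpha) - (g2 * Q1 + g3 * P1)) * (x - M1)).
  by rewrite k1 k2 k3; ring.
by rewrite h1 h3 -k0; ring.
Qed.

(* Telescoping form of the centered functional along the chain. *)
Lemma step_poisson (b3 b2 : R) : exists G : R -> R, [/\
  exists2 C, 0 <= C & forall x, 0 <= x -> `|G x| <= C * (1 + x) ^+ 3,
  b3 = 0 -> exists2 C, 0 <= C & forall x, 0 <= x -> `|G x| <= C * (1 + x) ^+ 2 &
  forall k c B, adapted k c -> (forall t, `|c t| <= B) ->
  \int[P]_t (c t * (b3 * (X k t)%:R ^+ 3 + b2 * (X k t)%:R ^+ 2 - (b3 * pmf_moment pi 3 + b2 * pmf_moment pi 2))) =
  \int[P]_t (c t * G (X k t)%:R) - \int[P]_t (c t * G (X k.+1 t)%:R)].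
Proof.
have [[[g3 g2] g1] /= [g30 gE]] := poisson_solution b3 b2.
exists (fun x => g3 * x ^+ 3 + g2 * x ^+ 2 + g1 * x).
have poly_bound (a3 a2 a1 a0 x : R) : 0 <= x -> `|a3 * x ^+ 3 + a2 * x ^+ 2 + a1 * x + a0| <=
    (`|a3| + `|a2| + `|a1| + `|a0|) * (1 + x) ^+ 3.
  move=> x0.
  have x1 : 1 <= 1 + x by rewrite lerDl.
  have pw i : (i <= 3)%N -> x ^+ i <= (1 + x) ^+ 3.
    move=> i3; apply: (@le_trans _ _ ((1 + x) ^+ i)); last by rewrite ler_weXn2l.
    by rewrite lerXn2r ?nnegrE ?addr_ge0// lerDr.
  have tm a i : (i <= 3)%N -> `|a * x ^+ i| <= `|a| * (1 + x) ^+ 3.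
    by move=> i3; rewrite normrM ler_wpM2l// ger0_norm ?exprn_ge0// pw.
  rewrite !mulrDl; apply: (le_trans (ler_normD _ _)); apply: lerD; last first.
    by have := tm a0 0%N isT; rewrite expr0 mulr1.
  apply: (le_trans (ler_normD _ _)); apply: lerD; last first.
    by have := tm a1 1%N isT; rewrite expr1.
  by apply: (le_trans (ler_normD _ _)); apply: lerD; exact: tm.
split.
  exists (`|g3| + `|g2| + `|g1| + `|(0 : R)|) => [|x x0]; first by rewrite !addr_ge0.
  by have := poly_bound g3 g2 g1 0 x x0; rewrite addr0.
  move=> /g30 ->; exists (`|g2| + `|g1|) => [|x x0]; first exact: addr_ge0.
  rewrite mul0r add0r (le_trans (ler_normD _ _))// (normrM g2) (normrM g1) (ger0_norm x0) (ger0_norm (exprn_ge0 2 x0)).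
  rewrite (mulrDl `|g2|); apply: lerD; apply: ler_wpM2l => //; nra.
move=> k c B ac cB.
have pb (a3 a2 a1 a0 : R) : exists C, forall x : nat, `|a3 * x%:R ^+ 3 + a2 * x%:R ^+ 2 + a1 * x%:R + a0| <= C * (1 + x%:R) ^+ 3.
  by exists (`|a3| + `|a2| + `|a1| + `|a0|) => x; exact: (poly_bound _ _ _ _ x%:R (ler0n _ _)).
have [i3 j3 E3] := step_moment ac cB (isT : (3 <= 3)%N) kernel3 (pb _ _ _ _).
have b2' : exists C, forall x : nat, `|alpha ^+ 2 * x%:R ^+ 2 + q1 * x%:R + e 2| <= C * (1 + x%:R) ^+ 3.
  by have [C HC] := pb 0 (alpha ^+ 2) q1 (e 2); exists C => x; have := HC x; rewrite mul0r add0r.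
have [i2 j2 E2] := step_moment ac cB (isT : (2 <= 3)%N) kernel2 b2'.
have b1' : exists C, forall x : nat, `|alpha * x%:R + mu| <= C * (1 + x%:R) ^+ 3.
  by have [C HC] := pb 0 0 alpha mu; exists C => x; have := HC x; rewrite !mul0r !add0r.
have kernel1' x : kernel (fun j => (j%:R ^+ 1)%:E) x = (alpha * x%:R + mu)%:E.
  by under [X in transop _ _ X]eq_fun do rewrite expr1; exact: kernel1.
have [i1 j1 E1] := step_moment ac cB (isT : (1 <= 3)%N) kernel1' b1'.
have lin (u3 u2 u1 : T -> R) : P.-integrable setT (EFin \o u3) -> P.-integrable setT (EFin \o u2) ->
    P.-integrable setT (EFin \o u1) ->
    P.-integrable setT (EFin \o (fun t => g3 * u3 t + g2 * u2 t + g1 * u1 t)) /\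
    \int[P]_t (g3 * u3 t + g2 * u2 t + g1 * u1 t) = g3 * \int[P]_t u3 t + g2 * \int[P]_t u2 t + g1 * \int[P]_t u1 t.
  move=> h3 h2 h1.
  have z3 : P.-integrable setT (EFin \o (fun t => g3 * u3 t)) := integrableZl measurableT g3 h3.
  have z2 : P.-integrable setT (EFin \o (fun t => g2 * u2 t)) := integrableZl measurableT g2 h2.
  have z1 : P.-integrable setT (EFin \o (fun t => g1 * u1 t)) := integrableZl measurableT g1 h1.
  have z32 : P.-integrable setT (EFin \o (fun t => g3 * u3 t + g2 * u2 t)) := integrableD measurableT z3 z2.
  split; first exact: (integrableD measurableT z32 z1).
  by rewrite !RintegralD// !RintegralZl.
have [L1 M1] := lin _ _ _ i3 i2 i1.
have [L2 M2] := lin _ _ _ j3 j2 j1.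
have -> : \int[P]_t (c t * (g3 * (X k.+1 t)%:R ^+ 3 + g2 * (X k.+1 t)%:R ^+ 2 + g1 * (X k.+1 t)%:R)) =
  \int[P]_t (g3 * (c t * (alpha ^+ 3 * (X k t)%:R ^+ 3 + p2 * (X k t)%:R ^+ 2 + p1 * (X k t)%:R + e 3)) +
   g2 * (c t * (alpha ^+ 2 * (X k t)%:R ^+ 2 + q1 * (X k t)%:R + e 2)) + g1 * (c t * (alpha * (X k t)%:R + mu))).
  rewrite M2 -E3 -E2 -E1 -M1; apply: eq_Rintegral => t _; rewrite expr1; ring.
rewrite -RintegralB//.
  by apply: eq_Rintegral => t _; rewrite -gE; ring.
have [G HG] := pb g3 g2 g1 0.
apply: (chain_integrable model alpha01 X0_cube eps_cube (k := k) (C := B * G)).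
  by apply: adapted_op2 => //; apply: (adapted_comp (fun x => g3 * x ^+ 3 + g2 * x ^+ 2 + g1 * x)); exact: adapted_X.
move=> t; rewrite normrM -mulrA ler_pM//.
by have := HG (X k t); rewrite addr0.
Qed.

End ConditionalMoments.

(** * Taylor bounds for cosine, sine and the exponential *)

Section TaylorBounds.
Context {R : realType}.
Implicit Types x : R.

Lemma derive_bound (f f' : R -> R) (x K : R) :
  (forall y : R, is_derive y 1 f (f' y)) -> f 0 = 0 ->
  (forall y, `|y| <= `|x| -> `|f' y| <= K) -> `|f x| <= K * `|x|.
Proof.
move=> df f0 H.
have cf : continuous f.
  by move=> y; apply/differentiable_continuous/derivable1_diffP; case: (df y).
have [x0|x0] := leP 0 x.
  have [c cx E] := @MVT_segment R f f' 0 x x0 (fun y _ => df y) (continuous_subspaceT cf).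
  move: E; rewrite f0 !subr0 => ->; rewrite normrM ler_wpM2r//; apply: H.
  by move: cx; rewrite in_itv /= => /andP[c0 cx]; rewrite !ger0_norm.
have [c cx E] := @MVT_segment R f f' x 0 (ltW x0) (fun y _ => df y) (continuous_subspaceT cf).
move: E; rewrite f0 !sub0r mulrN => /oppr_inj ->; rewrite normrM ler_wpM2r//; apply: H.
by move: cx; rewrite in_itv /= => /andP[c0 cx]; rewrite !ler0_norm ?lerN2// ltW.
Qed.

Lemma sin_le x : `|sin x| <= `|x|.
Proof.
rewrite -[leRHS]mul1r; apply: (derive_bound (fun y => is_derive_sin y)); first exact: sin0.
by move=> y _; rewrite ler_norml cos_geN1 cos_le1.
Qed.

Lemma norm_sin_le1 x : `|sin x| <= 1.
Proof. by rewrite ler_norml sin_geN1 sin_le1. Qed.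

Lemma norm_cos_le1 x : `|cos x| <= 1.
Proof. by rewrite ler_norml cos_geN1 cos_le1. Qed.

Let dcos1 (y : R) : is_derive y 1 (fun y => cos y - 1 : R) (- sin y).
Proof. by apply: is_derive_eq; rewrite /GRing.scale /= ?subr0 ?mulr1. Qed.

Lemma cos_sub1_le x : `|cos x - 1| <= `|x|.
Proof.
rewrite -[leRHS]mul1r; apply: (derive_bound dcos1); first by rewrite cos0 subrr.
by move=> y _; rewrite normrN norm_sin_le1.
Qed.

Lemma cos_sub1_le_sqr x : `|cos x - 1| <= `|x| ^+ 2.
Proof.
rewrite expr2; apply: (derive_bound dcos1); first by rewrite cos0 subrr.
by move=> y yx; rewrite normrN (le_trans (sin_le y)).
Qed.

Let dsin1 (y : R) : is_derive y 1 (fun y => sin y - y : R) (cos y - 1).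
Proof. by apply: is_derive_eq. Qed.

Lemma sin_sub_le_sqr x : `|sin x - x| <= `|x| ^+ 2.
Proof.
rewrite expr2; apply: (derive_bound dsin1); first by rewrite sin0 subrr.
by move=> y yx; rewrite (le_trans (cos_sub1_le y)).
Qed.

Lemma sin_sub_le_cube x : `|sin x - x| <= `|x| ^+ 3.
Proof.
rewrite exprSr; apply: (derive_bound dsin1); first by rewrite sin0 subrr.
by move=> y yx; rewrite (le_trans (cos_sub1_le_sqr y))// ler_pXn2r ?nnegrE.
Qed.

Let dcos2 (y : R) : is_derive y 1 (fun y => cos y - 1 + y ^+ 2 / 2 : R) (y - sin y).
Proof. by apply: is_derive_eq; rewrite /GRing.scale /=; field. Qed.

Lemma cos_taylor2_le_sqr x : `|cos x - 1 + x ^+ 2 / 2| <= 2 * `|x| ^+ 2.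
Proof.
rewrite [`|x| ^+ 2]expr2 mulrA; apply: (derive_bound dcos2).
  by rewrite cos0 subrr expr0n mul0r addr0.
move=> y yx; apply: (le_trans (ler_normB _ _)).
by have := sin_le y; lra.
Qed.

Lemma cos_taylor2_le_cube x : `|cos x - 1 + x ^+ 2 / 2| <= `|x| ^+ 3.
Proof.
rewrite [`|x| ^+ 3]exprSr; apply: (derive_bound dcos2).
  by rewrite cos0 subrr expr0n mul0r addr0.
move=> y yx; rewrite distrC (le_trans (sin_sub_le_sqr y))//.
by rewrite ler_pXn2r ?nnegrE.
Qed.

Lemma cos_add_expansion (v z : R) :
  cos (v + z) - cos v + z * sin v + z ^+ 2 / 2 * cos v =
  cos v * (cos z - 1 + z ^+ 2 / 2) - sin v * (sin z - z).
Proof. by rewrite cosD; ring. Qed.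

(** With its cubic companion [cos_add_taylor_cube], this is the pair of remainder bounds of
    Lindeberg's method: the square serves where the state is large, the cube where it is bounded. *)
Lemma cos_add_taylor_sqr (v z : R) :
  `|cos (v + z) - cos v + z * sin v + z ^+ 2 / 2 * cos v| <= 3 * `|z| ^+ 2.
Proof.
rewrite cos_add_expansion (le_trans (ler_normB _ _))// !normrM.
have h1 := ler_pM (normr_ge0 _) (normr_ge0 _) (norm_cos_le1 v) (cos_taylor2_le_sqr z).
have h2 := ler_pM (normr_ge0 _) (normr_ge0 _) (norm_sin_le1 v) (sin_sub_le_sqr z).
by rewrite !mul1r in h1 h2; lra.
Qed.

Lemma cos_add_taylor_cube (v z : R) :
  `|cos (v + z) - cos v + z * sin v + z ^+ 2 / 2 * cos v| <= 3 * `|z| ^+ 3.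
Proof.
rewrite cos_add_expansion (le_trans (ler_normB _ _))// !normrM.
have h1 := ler_pM (normr_ge0 _) (normr_ge0 _) (norm_cos_le1 v) (cos_taylor2_le_cube z).
have h2 := ler_pM (normr_ge0 _) (normr_ge0 _) (norm_sin_le1 v) (sin_sub_le_cube z).
rewrite !mul1r in h1 h2; have : 0 <= `|z| ^+ 3 by rewrite exprn_ge0.
by move=> ?; lra.
Qed.

Lemma cos_lipschitz (v z : R) : `|cos (v + z) - cos v| <= `|z|.
Proof.
have d (y : R) : is_derive y 1 (fun y => cos (v + y) - cos v : R) (- sin (v + y)).
  by apply: is_derive_eq; rewrite /GRing.scale /=; ring.
rewrite -[leRHS]mul1r; apply: (derive_bound d); first by rewrite addr0 subrr.
by move=> y _; rewrite normrN norm_sin_le1.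
Qed.

Lemma cos_dist_le2 (v z : R) : `|cos v - cos z| <= 2.
Proof.
rewrite (le_trans (ler_normB _ _))//.
by have := norm_cos_le1 v; have := norm_cos_le1 z; lra.
Qed.

Lemma expRN_taylor x : 0 <= x -> `|expR (- x) - (1 - x)| <= x ^+ 2.
Proof.
move=> x0; have h1 := expR_ge1Dx (- x).
rewrite ger0_norm ?subr_ge0//.
have x1 : 0 < 1 + x by rewrite ltr_pwDl.
have : expR (- x) <= (1 + x)^-1.
  by rewrite expRN lef_pV2 ?posrE ?expR_gt0// expR_ge1Dx.
have : (1 + x)^-1 <= 1 - x + x ^+ 2.
  rewrite -[leLHS]mul1r ler_pdivrMr//.
  have : 0 <= x ^+ 3 by rewrite exprn_ge0.
  by move=> ?; rewrite (_ : (1 - x + x ^+ 2) * (1 + x) = 1 + x ^+ 3); [rewrite lerDl|ring].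
lra.
Qed.

End TaylorBounds.

(** * Central limit theorem for the martingale, by characteristic functions *)

Section MartingaleCLT.
Context {R : realType} {d : measure_display} {T : measurableType d}.
Variables (P : probability T R) (alpha : R) (X0 : T -> nat) (eps : nat -> T -> nat)
  (xi : nat -> nat -> T -> bool) (pi : nat -> R).
Hypothesis model : inar_model P alpha X0 eps xi.
Hypothesis alpha01 : 0 < alpha < 1.
Hypothesis X0_cube : (expect_pow P X0 3 < +oo)%E.
Hypothesis eps_cube : (expect_pow P (eps 1%N) 3 < +oo)%E.

Local Notation X := (inar_X X0 eps xi).
Local Notation hist := (hist X0 eps xi).
Local Notation q := (fun m => fine (P [set t | eps 1%N t = m])).
Local Notation kernel := (transop alpha q).
Local Notation e k := (fine (expect_pow P (eps 1%N) k)).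
Local Notation mu := (e 1).
Local Notation s2 := (e 2 - mu ^+ 2).
Local Notation adapted := (adapted X0 eps xi).
Hypothesis pi_stat : is_stationary alpha q pi.
Local Notation innov k t := ((X k.+1 t)%:R - alpha * (X k t)%:R - mu).
Local Notation V := (alpha * (1 - alpha) * pmf_moment pi 3 + s2 * pmf_moment pi 2).
Local Notation integ f := (P.-integrable setT (EFin \o f)).

Let al0 : 0 <= alpha. Proof. by have /andP[/ltW h1 h2] := alpha01. Qed.
Let al1 : alpha <= 1. Proof. by have /andP[h1 /ltW h2] := alpha01. Qed.
Let mu0 : 0 <= mu.
Proof. by rewrite fine_ge0// integral_ge0// => t _; rewrite lee_fin exprn_ge0. Qed.
Let cint := chain_integrable model alpha01 X0_cube eps_cube.

Lemma Rintegral_comb4 (f1 f2 f3 f4 : T -> R) (a1 a2 a3 a4 : R) :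
  integ f1 -> integ f2 -> integ f3 -> integ f4 ->
  integ (fun t => a1 * f1 t + a2 * f2 t + a3 * f3 t + a4 * f4 t) /\
  \int[P]_t (a1 * f1 t + a2 * f2 t + a3 * f3 t + a4 * f4 t) =
  a1 * \int[P]_t f1 t + a2 * \int[P]_t f2 t + a3 * \int[P]_t f3 t + a4 * \int[P]_t f4 t.
Proof.
move=> h1 h2 h3 h4.
have z1 : integ (fun t => a1 * f1 t) := integrableZl measurableT a1 h1.
have z2 : integ (fun t => a2 * f2 t) := integrableZl measurableT a2 h2.
have z3 : integ (fun t => a3 * f3 t) := integrableZl measurableT a3 h3.
have z4 : integ (fun t => a4 * f4 t) := integrableZl measurableT a4 h4.
have z12 : integ (fun t => a1 * f1 t + a2 * f2 t) := integrableD measurableT z1 z2.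
have z123 : integ (fun t => a1 * f1 t + a2 * f2 t + a3 * f3 t) := integrableD measurableT z12 z3.
split; first exact: (integrableD measurableT z123 z4).
by rewrite !RintegralD// !RintegralZl.
Qed.

Lemma le_norm_Rintegral (f g : T -> R) : integ f -> integ g ->
  (forall t, `|f t| <= g t) -> `|\int[P]_t f t| <= \int[P]_t g t.
Proof.
move=> i1 i2 fg; apply: (le_trans (le_normr_Rintegral measurableT i1)).
apply: le_Rintegral => //; exact: (integrable_abse i1).
Qed.

Let cube_ge0 k t : 0 <= (1 + (X k t)%:R) ^+ 3 :> R.
Proof. by rewrite exprn_ge0// addr_ge0. Qed.

Let int_cube k : integ (fun t => (1 + (X k t)%:R) ^+ 3).
Proof.
apply: (@cint k _ 1); last by move=> t; rewrite mul1r ger0_norm.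
by apply: (adapted_comp (fun x : R => (1 + x) ^+ 3)); exact: adapted_X.
Qed.

Lemma cubic_bound (p r v x : R) : 0 <= x ->
  `|p * x ^+ 3 + r * x ^+ 2 - v| <= (`|p| + `|r| + `|v|) * (1 + x) ^+ 3.
Proof.
move=> x0; have x1 : 1 <= 1 + x by rewrite lerDl.
have h3 : x ^+ 3 <= (1 + x) ^+ 3 by rewrite ler_pXn2r ?nnegrE ?addr_ge0// lerDr.
have h2 : x ^+ 2 <= (1 + x) ^+ 3.
  apply: (@le_trans _ _ ((1 + x) ^+ 2)); last by rewrite ler_weXn2l.
  by rewrite ler_pXn2r ?nnegrE ?addr_ge0// lerDr.
have h0 : 1 <= (1 + x) ^+ 3 by rewrite exprn_ege1.
have := ler_wpM2l (normr_ge0 p) h3; have := ler_wpM2l (normr_ge0 r) h2.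
have := ler_wpM2l (normr_ge0 v) h0; rewrite mulr1.
have := ler_normB (p * x ^+ 3 + r * x ^+ 2) v.
have := ler_normD (p * x ^+ 3) (r * x ^+ 2).
rewrite (normrM p) (normrM r) (ger0_norm (exprn_ge0 3 x0)) (ger0_norm (exprn_ge0 2 x0)).
move: ((1 + x) ^+ 3) (x ^+ 3) (x ^+ 2) => c u3 u2; lra.
Qed.

Lemma innov_cube_le k t :
  `|innov k t| ^+ 3 <= 4 * (1 + mu) ^+ 3 * (1 + (X k.+1 t)%:R) ^+ 3 + 4 * (1 + (X k t)%:R) ^+ 3.
Proof.
set x : R := (X k t)%:R; set y : R := (X k.+1 t)%:R.
have x0 : 0 <= x by []. have y0 : 0 <= y by [].
have h : `|y - alpha * x - mu| <= (1 + mu) * (1 + y) + (1 + x).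
  have := mulr_ge0 mu0 y0; have := ler_wpM2r x0 al1; have := mulr_ge0 al0 x0.
  move: mu0; move: mu => m m0 ax ax1 my.
  by rewrite ler_norml; apply/andP; split; lra.
apply: (@le_trans _ _ (((1 + mu) * (1 + y) + (1 + x)) ^+ 3)).
  by rewrite ler_pXn2r ?nnegrE ?addr_ge0 ?mulr_ge0 ?addr_ge0.
rewrite -mulrA -exprMn.
have : 0 <= (1 + mu) * (1 + y) by rewrite mulr_ge0 ?addr_ge0.
have : 0 <= 1 + x by rewrite addr_ge0.
move: ((1 + mu) * (1 + y)) (1 + x) => p r r0 p0.
have := mulr_ge0 (addr_ge0 r0 p0) (sqr_ge0 (p - r)); nra.
Qed.

Lemma increment_le k t :
  `|(X k t)%:R * innov k t| <= (1 + (X k.+1 t)%:R) ^+ 3 + (2 + mu) * (1 + (X k t)%:R) ^+ 3.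
Proof.
set x : R := (X k t)%:R; set y : R := (X k.+1 t)%:R.
have x0 : 0 <= x by []. have y0 : 0 <= y by [].
have h : `|y - alpha * x - mu| <= y + x + mu.
  have := ler_wpM2r x0 al1; have := mulr_ge0 al0 x0.
  move: mu0; move: mu => m m0 ax ax1.
  by rewrite ler_norml; apply/andP; split; lra.
rewrite normrM (ger0_norm x0); apply: (le_trans (ler_wpM2l x0 h)).
have hx i : (i <= 3)%N -> x ^+ i <= (1 + x) ^+ 3.
  move=> i3; apply: (@le_trans _ _ ((1 + x) ^+ i)); last by rewrite ler_weXn2l// lerDl.
  by rewrite lerXn2r ?nnegrE ?addr_ge0// lerDr.
have hy : y ^+ 2 <= (1 + y) ^+ 3.
  apply: (@le_trans _ _ ((1 + y) ^+ 2)); last by rewrite ler_weXn2l// lerDl.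
  by rewrite lerXn2r ?nnegrE ?addr_ge0// lerDr.
have h1 := hx 1%N isT; have h2 := hx 2%N isT.
have := ler_wpM2l mu0 h1; have := sqr_ge0 (x - y); have := sqr_ge0 y.
rewrite expr1 in h1 *; nra.
Qed.

(** Expand $\cos(rS'+b)$ to second order in the step. The first-order term has mean zero; in the
    second-order term the squared innovation is replaced by its conditional variance, a cubic
    polynomial in the state whose [pi]-mean is $V$. By the Poisson equation its deviation from $V$
    is a difference of values of [G] at successive states. Subtracting $\frac{r^2}2\mathbb
    E[A\cos(rS+b)G(X)]$ from the main quantity absorbs this difference, and what is left is
    multiplication by $1-r^2V/2\approx e^{-r^2V/2}$. The constant [c1] does not depend on [tau], so
    the error of order $r^2\tau$ can be made small after summing $n$ steps; [K] and [c2] may depend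
    on [tau], since their contributions vanish anyway. *)
Lemma clt_step : exists (G : R -> R) (c0 : R), [/\ 0 <= c0,
  (forall k (c : T -> R), adapted k c -> (forall t, `|c t| <= 1) -> `|\int[P]_t (c t * G (X k t)%:R)| <= c0) &
  exists2 c1, 0 <= c1 & forall tau, 0 < tau -> exists K c2, [/\ 0 <= K, 0 <= c2 &
  forall r k (S S' A : T -> R), `|r| <= 1 -> adapted k S -> adapted k A ->
    (forall t, 0 <= A t <= 1) ->
    (forall t, S' t = S t + (X k t)%:R * innov k t) -> forall b,
  `|(\int[P]_t (A t * cos (r * S' t + b)) - r ^+ 2 / 2 * \int[P]_t (A t * cos (r * S' t + b) * G (X k.+1 t)%:R)) -
    expR (- (r ^+ 2 * V / 2)) * (\int[P]_t (A t * cos (r * S t + b)) - r ^+ 2 / 2 * \int[P]_t (A t * cos (r * S t + b) * G (X k t)%:R))|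
    <= c1 * r ^+ 2 * (tau + alpha ^+ k * K) + c2 * `|r| ^+ 3]].
Proof.
have [B B0 HB] := chain_expect_bound model alpha01 X0_cube eps_cube.
have [G [[Gc Gc0 GG] _ poisson]] := step_poisson model alpha01 X0_cube eps_cube pi_stat (alpha * (1 - alpha)) s2.
have aG k c : adapted k c -> adapted k (fun t => c t * G (X k t)%:R).
  by move=> ac; apply: adapted_op2 => //; apply: (adapted_comp G); exact: adapted_X.
have bG k c t : (forall t, `|c t| <= 1) -> `|c t * G (X k t)%:R| <= Gc * (1 + (X k t)%:R) ^+ 3.
  move=> c1; rewrite normrM -[leRHS]mul1r; apply: ler_pM => //; exact: GG.
exists G, (Gc * B); split; first by rewrite mulr_ge0// ltW.
  by move=> k c ac c1; apply: HB => //; [exact: aG|move=> t; exact: bG].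
have s20 : 0 <= s2.
  rewrite -lee_fin (_ : s2%:E = kernel (fun j => ((j%:R - (alpha * 0%:R + mu)) ^+ 2)%:E) 0%N).
    apply: kernel_ge0 => [||j]; rewrite ?al0// ?lee_fin ?sqr_ge0//.
    by move=> m; rewrite fine_ge0.
  by rewrite (kernel_centered_square model alpha01 eps_cube) mulr0 add0r.
pose W := 1 + s2.
have W0 : 0 <= W by rewrite addr_ge0.
have V0 : 0 <= V.
  have m3 : 0 <= pmf_moment pi 3 by rewrite fine_ge0// nneseries_ge0// => j _ _; rewrite lee_fin mulr_ge0 ?exprn_ge0//; case: pi_stat.
  have m2 : 0 <= pmf_moment pi 2 by rewrite fine_ge0// nneseries_ge0// => j _ _; rewrite lee_fin mulr_ge0 ?exprn_ge0//; case: pi_stat.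
  by rewrite addr_ge0 ?mulr_ge0// ?subr_ge0.
exists (3 * W + Gc); first by rewrite addr_ge0// mulr_ge0.
move=> tau tau0.
have [a [K [K0 HK]]] := chain_uniform_integrability model alpha01 X0_cube eps_cube pi_stat tau0.
(* [Ba] controls the cubic remainder where the current state is at most [a], and [Bd] the Lipschitz
   bound where the next state is at most [a]. *)
pose Ba : R := a%:R ^+ 3 * (4 * (1 + mu) ^+ 3 * B + 4 * B).
pose Bd : R := (1 + a%:R) ^+ 3 * (B + (2 + mu) * B).
have Ba0 : 0 <= Ba by rewrite mulr_ge0 ?exprn_ge0// addr_ge0// !mulr_ge0 ?exprn_ge0 ?addr_ge0// ltW.
have Bd0 : 0 <= Bd by rewrite mulr_ge0 ?exprn_ge0 ?addr_ge0// ?mulr_ge0 ?addr_ge0// ltW.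
have GB0 : 0 <= Gc * B by rewrite mulr_ge0// ltW.
have EB k : \int[P]_t ((1 + (X k t)%:R) ^+ 3) <= B.
  rewrite -[leRHS]mul1r; apply: (le_trans (ler_norm _)); apply: (HB k) => //.
    by apply: (adapted_comp (fun x : R => (1 + x) ^+ 3)); exact: adapted_X.
  by move=> t; rewrite mul1r ger0_norm.
have int_cut k : integ (fun t => (1 + (X k t)%:R) ^+ 3 * (a < X k t)%N%:R).
  apply: (@cint k _ 1).
    by exists (fun h => (1 + (head 0%N h)%:R) ^+ 3 * (a < head 0%N h)%N%:R) => t; rewrite head_hist.
  move=> t; rewrite ger0_norm ?mulr_ge0// mul1r ler_piMr//.
  by case: (_ < _)%N.
have E_innov k : \int[P]_t (`|innov k t| ^+ 3 * 0 + (4 * (1 + mu) ^+ 3 * (1 + (X k.+1 t)%:R) ^+ 3 + 4 * (1 + (X k t)%:R) ^+ 3)) <= 4 * (1 + mu) ^+ 3 * B + 4 * B.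
  under eq_Rintegral do rewrite mulr0 add0r.
  have [_ E] := Rintegral_comb4 (4 * (1 + mu) ^+ 3) 4 0 0 (int_cube k.+1) (int_cube k) (int_cube k) (int_cube k).
  have -> : \int[P]_t (4 * (1 + mu) ^+ 3 * (1 + (X k.+1 t)%:R) ^+ 3 + 4 * (1 + (X k t)%:R) ^+ 3) =
    4 * (1 + mu) ^+ 3 * \int[P]_t (1 + (X k.+1 t)%:R) ^+ 3 + 4 * \int[P]_t (1 + (X k t)%:R) ^+ 3.
    transitivity (4 * (1 + mu) ^+ 3 * \int[P]_t (1 + (X k.+1 t)%:R) ^+ 3 + 4 * \int[P]_t (1 + (X k t)%:R) ^+ 3 + 0 * \int[P]_t (1 + (X k t)%:R) ^+ 3 + 0 * \int[P]_t (1 + (X k t)%:R) ^+ 3); last by ring.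
    by rewrite -E; apply: eq_Rintegral => t _; ring.
  by rewrite lerD// ler_wpM2l ?mulr_ge0 ?exprn_ge0 ?addr_ge0.
exists K, (3 * Ba + Gc * Bd / 2 + V / 2 * (Gc * B) + V ^+ 2 * (1 + Gc * B)); split => //.
  apply: addr_ge0; [apply: addr_ge0; [apply: addr_ge0|]|].
  - exact: mulr_ge0.
  - by apply: divr_ge0 => //; exact: mulr_ge0.
  - by apply: mulr_ge0 => //; exact: divr_ge0.
  - by apply: mulr_ge0; [exact: sqr_ge0|exact: addr_ge0].
move=> r k S S' A r1 aS aA A01 SE b.
pose C t := A t * cos (r * S t + b).
pose C' t := A t * cos (r * S' t + b).
pose Sn t := A t * sin (r * S t + b).
pose M t := innov k t.
have A0 t : 0 <= A t by have /andP[] := A01 t.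
have A1 t : `|A t| <= 1 by have /andP[_] := A01 t; rewrite ger0_norm.
have aC : adapted k C by apply: adapted_op2 => //; apply: (adapted_comp (fun x : R => cos (r * x + b))).
have aSn : adapted k Sn by apply: adapted_op2 => //; apply: (adapted_comp (fun x : R => sin (r * x + b))).
have aS' : adapted k.+1 S'.
  have -> : S' = fun t => S t + (X k t)%:R * innov k t by apply/funext.
  apply: adapted_op2; first exact: adaptedS.
  apply: (adapted_op2 *%R); first by apply: adaptedS; exact: adapted_X.
  apply: (adapted_op2 (fun u v => u - alpha * v - mu)); first exact: adapted_X.
  by apply: adaptedS; exact: adapted_X.
have aC' : adapted k.+1 C'.
  apply: adapted_op2; first exact: adaptedS.
  by apply: (adapted_comp (fun x : R => cos (r * x + b))).
have nC t : `|C t| <= 1 by rewrite normrM -[leRHS]mul1r ler_pM// norm_cos_le1.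
have nC' t : `|C' t| <= 1 by rewrite normrM -[leRHS]mul1r ler_pM// norm_cos_le1.
have nSn t : `|Sn t| <= 1 by rewrite normrM -[leRHS]mul1r ler_pM// norm_sin_le1.
have one_le j t : 1 <= (1 + (X j t)%:R) ^+ 3 :> R by rewrite exprn_ege1// lerDl.
have iC : integ C by apply: (@cint k _ 1) => // t; rewrite mul1r (le_trans (nC t)).
have iC' : integ C' by apply: (@cint k.+1 _ 1) => // t; rewrite mul1r (le_trans (nC' t)).
have x1 j t : (X j t)%:R <= 1 + (X j t)%:R :> R by rewrite lerDr.
have aX j : adapted j (fun t => (X j t)%:R : R) by exact: adapted_X.
have [iD ED] : integ (fun t => Sn t * (X k t)%:R * M t) /\ \int[P]_t (Sn t * (X k t)%:R * M t) = 0.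
  apply: (step_mean model alpha01 X0_cube eps_cube (B := 1)); first exact: adapted_op2.
  move=> t; rewrite normrM mul1r normr_nat.
  apply: (@le_trans _ _ (1 * (1 + (X k t)%:R))); first by rewrite ler_pM.
  by rewrite mul1r expr2 ler_peMl ?addr_ge0// lerDl.
have sq_le t : (X k t)%:R ^+ 2 <= (1 + (X k t)%:R) ^+ 2 :> R.
  by rewrite ler_pXn2r ?nnegrE ?addr_ge0.
have aX2 : adapted k (fun t => (X k t)%:R ^+ 2 : R) by exists (fun h => (head 0%N h)%:R ^+ 2) => t; rewrite head_hist.
have [iD2 ED2] : integ (fun t => C t * (X k t)%:R ^+ 2 * M t ^+ 2) /\
    \int[P]_t (C t * (X k t)%:R ^+ 2 * M t ^+ 2) =
    \int[P]_t (C t * (X k t)%:R ^+ 2 * (alpha * (1 - alpha) * (X k t)%:R + s2)).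
  apply: (step_square model alpha01 X0_cube eps_cube (B := 1)); first exact: adapted_op2.
  move=> t; rewrite normrM mul1r (ger0_norm (sqr_ge0 _)) -[leRHS]mul1r.
  by rewrite ler_pM ?sqr_ge0.
(* The cube of a step has degree too high for third moments, so the cubic bound is used only where
   the state is at most [a]; above [a] the quadratic bound is used, and uniform integrability makes
   it small. *)
pose cut t : R := (a < X k t)%N%:R.
have acut : adapted k (fun t => cut t * (X k t)%:R ^+ 2).
  by exists (fun h => (a < head 0%N h)%N%:R * (head 0%N h)%:R ^+ 2) => t; rewrite head_hist.
have cut01 t : 0 <= cut t <= 1 by rewrite /cut; case: (_ < _)%N; rewrite lexx ler01.
have [iU EU] : integ (fun t => cut t * (X k t)%:R ^+ 2 * M t ^+ 2) /\
    \int[P]_t (cut t * (X k t)%:R ^+ 2 * M t ^+ 2) =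
    \int[P]_t (cut t * (X k t)%:R ^+ 2 * (alpha * (1 - alpha) * (X k t)%:R + s2)).
  apply: (step_square model alpha01 X0_cube eps_cube (B := 1)) => // t.
  have /andP[c0 c1] := cut01 t.
  rewrite normrM mul1r (ger0_norm (sqr_ge0 _)) ger0_norm// -[leRHS]mul1r.
  by rewrite ler_pM ?sqr_ge0.
have EU_le : \int[P]_t (cut t * (X k t)%:R ^+ 2 * M t ^+ 2) <= W * (tau + alpha ^+ k * K).
  rewrite EU; apply: (le_trans _ (ler_wpM2l W0 (HK k))).
  rewrite -RintegralZl//.
  have pw t : 0 <= cut t * (X k t)%:R ^+ 2 * (alpha * (1 - alpha) * (X k t)%:R + s2) <=
      W * ((1 + (X k t)%:R) ^+ 3 * (a < X k t)%N%:R).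
    have /andP[c0 c1] := cut01 t.
    have aa0 : 0 <= alpha * (1 - alpha) by rewrite mulr_ge0 ?subr_ge0.
    have aa1 : alpha * (1 - alpha) <= 1 by nra.
    have v0 : 0 <= alpha * (1 - alpha) * (X k t)%:R + s2 by apply: addr_ge0 => //; exact: mulr_ge0.
    have key : (X k t)%:R ^+ 2 * (alpha * (1 - alpha) * (X k t)%:R + s2) <= W * (1 + (X k t)%:R) ^+ 3.
      rewrite (_ : W * _ = (1 + (X k t)%:R) ^+ 2 * (W * (1 + (X k t)%:R))); last by ring.
      apply: ler_pM => //.
      have := ler_wpM2r (ler0n R (X k t)) aa1; have := mulr_ge0 s20 (ler0n R (X k t)).
      rewrite /W; move: v0 => _; move: s20; move: s2 (X k t)%:R => v x v0 vx ax; lra.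
    apply/andP; split.
      by apply: mulr_ge0 => //; apply: mulr_ge0 => //; exact: sqr_ge0.
    rewrite -/(cut t) -mulrA (mulrC (_ ^+ 3)) (mulrCA W); exact: ler_wpM2l.
  apply: le_Rintegral => //.
  - apply: (@cint k _ W).
      apply: adapted_op2; first exact: acut.
      by apply: (adapted_comp (fun x : R => alpha * (1 - alpha) * x + s2)).
    move=> t; have /andP[p0 p1] := pw t; rewrite ger0_norm// (le_trans p1)//.
    by rewrite ler_wpM2l// ler_piMr//; have /andP[] := cut01 t.
  - exact: (integrableZl measurableT W (int_cut k)).
  - by move=> t _; have /andP[] := pw t.
(* Taylor remainder *)
pose Rem t := 1 * C' t + (-1) * C t + r * (Sn t * (X k t)%:R * M t) + (r ^+ 2 / 2) * (C t * (X k t)%:R ^+ 2 * M t ^+ 2).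
have [iRem ERem] := Rintegral_comb4 1 (-1) r (r ^+ 2 / 2) iC' iC iD iD2.
pose z t := r * ((X k t)%:R * M t).
have RemE t : Rem t = A t * (cos (r * S t + b + z t) - cos (r * S t + b) + z t * sin (r * S t + b) + z t ^+ 2 / 2 * cos (r * S t + b)).
  rewrite /Rem /C' /C /Sn SE /z -/(M t).
  rewrite (_ : r * (S t + (X k t)%:R * M t) + b = r * S t + b + r * ((X k t)%:R * M t)); last by ring.
  by field.
have Rem_sq t : `|Rem t| <= 3 * r ^+ 2 * ((X k t)%:R ^+ 2 * M t ^+ 2).
  rewrite RemE normrM -[leRHS]mul1r; apply: ler_pM => //.
  apply: (le_trans (cos_add_taylor_sqr _ _)).
  by rewrite real_normK ?num_real// [leRHS](_ : _ = 3 * z t ^+ 2)// /z; ring.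
have Rem_cu t : `|Rem t| <= 3 * `|r| ^+ 3 * ((X k t)%:R ^+ 3 * `|M t| ^+ 3).
  rewrite RemE normrM -[leRHS]mul1r; apply: ler_pM => //.
  apply: (le_trans (cos_add_taylor_cube _ _)).
  by rewrite [leRHS](_ : _ = 3 * `|z t| ^+ 3)// /z !normrM normr_nat; ring.
have r3 : 0 <= `|r| ^+ 3 by rewrite exprn_ge0.
have [iR2 ER2] := Rintegral_comb4 (3 * r ^+ 2) (3 * `|r| ^+ 3 * a%:R ^+ 3 * (4 * (1 + mu) ^+ 3))
   (3 * `|r| ^+ 3 * a%:R ^+ 3 * 4) 0 iU (int_cube k.+1) (int_cube k) iC.
have Rem_bound : `|\int[P]_t Rem t| <= 3 * W * r ^+ 2 * (tau + alpha ^+ k * K) + 3 * Ba * `|r| ^+ 3.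
  apply: (le_trans (le_norm_Rintegral iRem iR2 _)).
    move=> t; rewrite -/(Rem t) mul0r addr0 /cut; case: ltnP => h.
      rewrite mul1r; apply: (le_trans (Rem_sq t)); rewrite -[leLHS]addr0 -addrA lerD2l.
      by rewrite addr_ge0// !mulr_ge0 ?exprn_ge0 ?addr_ge0.
    rewrite !mul0r mulr0 add0r; apply: (le_trans (Rem_cu t)).
    have xa : (X k t)%:R ^+ 3 <= a%:R ^+ 3 :> R by rewrite ler_pXn2r ?nnegrE// ler_nat.
    rewrite -!(mulrA (3 * `|r| ^+ 3)) -mulrDr ler_wpM2l ?mulr_ge0// -!(mulrA (a%:R ^+ 3)) -mulrDr.
    by rewrite ler_pM ?exprn_ge0// innov_cube_le.
  rewrite ER2 mul0r addr0 -addrA; apply: lerD.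
    rewrite [leRHS](_ : _ = 3 * r ^+ 2 * (W * (tau + alpha ^+ k * K))); last by ring.
    by apply: ler_wpM2l EU_le; apply: mulr_ge0 => //; exact: sqr_ge0.
  rewrite (_ : 3 * Ba * _ = 3 * `|r| ^+ 3 * a%:R ^+ 3 * (4 * (1 + mu) ^+ 3) * B + 3 * `|r| ^+ 3 * a%:R ^+ 3 * 4 * B); last by rewrite /Ba; ring.
  by apply: lerD; rewrite ler_wpM2l// !mulr_ge0 ?exprn_ge0 ?addr_ge0.
(* increment of the cosine against the Poisson solution *)
have iCG : integ (fun t => C t * G (X k t)%:R) by apply: (@cint k _ Gc); [exact: aG|move=> t; exact: bG].
have iCG' : integ (fun t => C' t * G (X k.+1 t)%:R) by apply: (@cint k.+1 _ Gc); [exact: aG|move=> t; exact: bG].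
have iCG1 : integ (fun t => C t * G (X k.+1 t)%:R).
  by apply: (@cint k.+1 _ Gc); [apply: aG; exact: adaptedS|move=> t; exact: bG].
pose e2 := \int[P]_t (C' t * G (X k.+1 t)%:R) - \int[P]_t (C t * G (X k.+1 t)%:R).
have e2_bound : `|e2| <= 2 * Gc * (tau + alpha ^+ k * K) + `|r| * Gc * Bd.
  rewrite /e2 -RintegralB//.
  have iB : integ (fun t => C' t * G (X k.+1 t)%:R - C t * G (X k.+1 t)%:R) := integrableB measurableT iCG' iCG1.
  have [iE EE] := Rintegral_comb4 (2 * Gc) (`|r| * Gc * (1 + a%:R) ^+ 3) (`|r| * Gc * (1 + a%:R) ^+ 3 * (2 + mu)) 0
    (int_cut k.+1) (int_cube k.+1) (int_cube k) iC.
  apply: (le_trans (le_norm_Rintegral iB iE _)).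
    move=> t; rewrite -mulrBl normrM mul0r addr0.
    have dC : `|C' t - C t| <= 2 /\ `|C' t - C t| <= `|z t|.
      rewrite /C' /C -mulrBr SE normrM; split.
        by rewrite -[leRHS]mul1r ler_pM// cos_dist_le2.
      rewrite -[leRHS]mul1r ler_pM//.
      rewrite (_ : r * (S t + _) + b = r * S t + b + z t); last by rewrite /z /M; ring.
      exact: cos_lipschitz.
    have Gx := GG (X k.+1 t)%:R (ler0n _ _).
    case: ltnP => h.
      rewrite mulr1; apply: (@le_trans _ _ (2 * (Gc * (1 + (X k.+1 t)%:R) ^+ 3))).
        by apply: ler_pM => //; exact: dC.1.
      rewrite mulrA -[leLHS]addr0 -addrA lerD2l addr_ge0// !mulr_ge0 ?exprn_ge0 ?addr_ge0//.
    rewrite mulr0 mulr0 add0r.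
    have xa : (1 + (X k.+1 t)%:R) ^+ 3 <= (1 + a%:R) ^+ 3 :> R.
      by rewrite ler_pXn2r ?nnegrE ?addr_ge0// lerD2l ler_nat.
    apply: (@le_trans _ _ (`|z t| * (Gc * (1 + a%:R) ^+ 3))).
      apply: ler_pM => //; first exact: dC.2.
      by apply: (le_trans Gx); rewrite ler_wpM2l.
    rewrite /z normrM.
    have H := increment_le k t.
    rewrite (_ : _ * _ + _ = `|r| * (Gc * (1 + a%:R) ^+ 3) * ((1 + (X k.+1 t)%:R) ^+ 3 + (2 + mu) * (1 + (X k t)%:R) ^+ 3)); last by ring.
    rewrite mulrAC ler_wpM2l// !mulr_ge0 ?exprn_ge0 ?addr_ge0//.
  rewrite EE mul0r addr0 -addrA; apply: lerD.
    rewrite ler_wpM2l ?mulr_ge0//; apply: (le_trans (HK k.+1)).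
    by rewrite lerD2l ler_wpM2r// exprS ler_piMl ?exprn_ge0.
  rewrite (_ : `|r| * Gc * Bd = `|r| * Gc * (1 + a%:R) ^+ 3 * B + `|r| * Gc * (1 + a%:R) ^+ 3 * (2 + mu) * B); last by rewrite /Bd; ring.
  by apply: lerD; rewrite ler_wpM2l// !mulr_ge0 ?exprn_ge0 ?addr_ge0.
(* The weight in the Poisson identity is the cosine before the step; the mismatch with the cosine
   after the step is the term [e2] bounded above. *)
have Po := poisson k C 1 aC nC.
have Ew : \int[P]_t (C t * (X k t)%:R ^+ 2 * M t ^+ 2) = V * \int[P]_t C t +
   \int[P]_t (C t * G (X k t)%:R) - \int[P]_t (C t * G (X k.+1 t)%:R).
  rewrite ED2 -addrA -Po -RintegralZl// -RintegralD//.
  - by apply: eq_Rintegral => t _; ring.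
  - exact: (integrableZl measurableT V iC).
  - apply: (@cint k _ (`|alpha * (1 - alpha)| + `|s2| + `|V|)).
      apply: adapted_op2 => //.
      by apply: (adapted_comp (fun x : R => alpha * (1 - alpha) * x ^+ 3 + s2 * x ^+ 2 - V)).
    move=> t; rewrite normrM -[leRHS]mul1r ler_pM//.
    exact: cubic_bound.
have IC : `|\int[P]_t C t| <= 1.
  have one_int : integ (fun _ : T => 1 : R).
    by apply: (@cint 0 _ 1); [exact: adapted_cst|move=> t; rewrite normr1 mul1r].
  apply: (le_trans (le_norm_Rintegral iC one_int nC)).
  by rewrite /Rintegral integral_probability_cst.
have ICG : `|\int[P]_t (C t * G (X k t)%:R)| <= Gc * B.
  by apply: (HB k) => //; [exact: aG|move=> t; exact: bG].
have main : \int[P]_t Rem t = 1 * \int[P]_t C' t + -1 * \int[P]_t C t + r * 0 + r ^+ 2 / 2 * \int[P]_t (C t * (X k t)%:R ^+ 2 * M t ^+ 2).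
  by rewrite -ED; exact: ERem.
rewrite -/C -/C'.
move: main Rem_bound e2_bound ICG IC; rewrite Ew /e2.
move: (\int[P]_t Rem t) (\int[P]_t C' t) (\int[P]_t C t) (\int[P]_t (C t * G (X k t)%:R))
  (\int[P]_t (C t * G (X k.+1 t)%:R)) (\int[P]_t (C' t * G (X k.+1 t)%:R)) => rho c' c g gm g' main Hrho He2 Hg Hc.
set v := V in V0 main *.
set th := tau + alpha ^+ k * K in Hrho He2 *.
have th0 : 0 <= th.
  by apply: addr_ge0; [exact: ltW|apply: mulr_ge0 => //; exact: exprn_ge0].
pose kap := r ^+ 2 * v / 2.
have r20 : 0 <= r ^+ 2 by exact: sqr_ge0.
have r2E : r ^+ 2 = `|r| ^+ 2 by rewrite real_normK ?num_real.
have kap0 : 0 <= kap by apply: divr_ge0 => //; exact: mulr_ge0.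
have Hexp := expRN_taylor kap0.
have cE : c' = rho + c - r ^+ 2 / 2 * (v * c + g - gm) by rewrite main; ring.
have -> : c' - r ^+ 2 / 2 * g' - expR (- kap) * (c - r ^+ 2 / 2 * g) =
   rho - r ^+ 2 / 2 * (g' - gm) - kap * (r ^+ 2 / 2) * g - (expR (- kap) - (1 - kap)) * (c - r ^+ 2 / 2 * g).
  by rewrite cE /kap; field.
have r4 : r ^+ 2 * r ^+ 2 <= `|r| ^+ 3.
  rewrite r2E -exprD (_ : (2 + 2)%N = 4)// exprS ler_piMl//.
have r21 : r ^+ 2 <= 1 by rewrite r2E expr_le1.
have t1 : `|r ^+ 2 / 2 * (g' - gm)| <= Gc * r ^+ 2 * th + Gc * Bd / 2 * `|r| ^+ 3.
  rewrite normrM ger0_norm ?divr_ge0//.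
  apply: (le_trans (ler_wpM2l _ He2)); first by rewrite divr_ge0.
  rewrite mulrDr; apply: lerD; first by rewrite [leLHS](_ : _ = Gc * r ^+ 2 * th)//; field.
  by rewrite r2E [leLHS](_ : _ = Gc * Bd / 2 * `|r| ^+ 3)//; field.
have t2 : `|kap * (r ^+ 2 / 2) * g| <= v / 2 * (Gc * B) * `|r| ^+ 3.
  have kr0 : 0 <= kap * (r ^+ 2 / 2) := mulr_ge0 kap0 (divr_ge0 r20 (ler0n _ 2)).
  rewrite normrM (ger0_norm kr0); apply: (le_trans (ler_wpM2l kr0 Hg)).
  apply: (@le_trans _ _ (v / 2 * (Gc * B) * (r ^+ 2 * r ^+ 2))); last first.
    by apply: ler_wpM2l => //; apply: mulr_ge0 => //; exact: divr_ge0.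
  have : 0 <= v / 2 * (Gc * B) * (r ^+ 2 * r ^+ 2).
    by apply: mulr_ge0; apply: mulr_ge0 => //; exact: divr_ge0.
  rewrite /kap (_ : r ^+ 2 * v / 2 * (r ^+ 2 / 2) * (Gc * B) = (v / 2 * (Gc * B) * (r ^+ 2 * r ^+ 2)) / 2); last by field.
  by move=> ?; rewrite ler_pdivrMr// ler_peMr// ler1n.
have t3 : `|(expR (- kap) - (1 - kap)) * (c - r ^+ 2 / 2 * g)| <= v ^+ 2 * (1 + Gc * B) * `|r| ^+ 3.
  rewrite normrM.
  have h2 : `|c - r ^+ 2 / 2 * g| <= 1 + Gc * B.
    apply: (le_trans (ler_normB _ _)); apply: lerD => //.
    rewrite normrM ger0_norm ?divr_ge0//; apply: le_trans Hg; rewrite ler_piMl//.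
    by rewrite ler_pdivrMr// mul1r (le_trans r21)// ler1n.
  apply: (le_trans (ler_pM _ _ Hexp h2)) => //.
  rewrite [leRHS](_ : _ = v ^+ 2 * `|r| ^+ 3 * (1 + Gc * B)); last by ring.
  apply: ler_wpM2r; first exact: addr_ge0.
  apply: (@le_trans _ _ (v ^+ 2 * (r ^+ 2 * r ^+ 2))); last first.
    by apply: ler_wpM2l => //; exact: sqr_ge0.
  have : 0 <= v ^+ 2 * (r ^+ 2 * r ^+ 2).
    by apply: mulr_ge0; [exact: sqr_ge0|exact: mulr_ge0].
  rewrite /kap (_ : (r ^+ 2 * v / 2) ^+ 2 = (v ^+ 2 * (r ^+ 2 * r ^+ 2)) / 4); last by field.
  by move=> ?; rewrite ler_pdivrMr// ler_peMr// ler1n.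
apply: (le_trans (ler_normB _ _)).
have n1 := ler_normB (rho - r ^+ 2 / 2 * (g' - gm)) (kap * (r ^+ 2 / 2) * g).
have n2 := ler_normB rho (r ^+ 2 / 2 * (g' - gm)).
rewrite (_ : (3 * W + Gc) * r ^+ 2 * th + _ = (3 * W * r ^+ 2 * th + 3 * Ba * `|r| ^+ 3) + (Gc * r ^+ 2 * th + Gc * Bd / 2 * `|r| ^+ 3)
  + v / 2 * (Gc * B) * `|r| ^+ 3 + v ^+ 2 * (1 + Gc * B) * `|r| ^+ 3); last by ring.
by lra.
Qed.

End MartingaleCLT.

Section CentralLimit.
Context {R : realType} {d : measure_display} {T : measurableType d}.
Variables (P : probability T R) (alpha : R) (X0 : T -> nat) (eps : nat -> T -> nat)
  (xi : nat -> nat -> T -> bool) (pi : nat -> R).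
Hypothesis model : inar_model P alpha X0 eps xi.
Hypothesis alpha01 : 0 < alpha < 1.
Hypothesis X0_cube : (expect_pow P X0 3 < +oo)%E.
Hypothesis eps_cube : (expect_pow P (eps 1%N) 3 < +oo)%E.

Local Notation X := (inar_X X0 eps xi).
Local Notation hist := (hist X0 eps xi).
Local Notation q := (fun m => fine (P [set t | eps 1%N t = m])).
Local Notation kernel := (transop alpha q).
Local Notation e k := (fine (expect_pow P (eps 1%N) k)).
Local Notation mu := (e 1).
Local Notation s2 := (e 2 - mu ^+ 2).
Local Notation adapted := (adapted X0 eps xi).
Hypothesis pi_stat : is_stationary alpha q pi.
Local Notation innov k t := ((X k.+1 t)%:R - alpha * (X k t)%:R - mu).
Local Notation V := (alpha * (1 - alpha) * pmf_moment pi 3 + s2 * pmf_moment pi 2).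
Local Notation integ f := (P.-integrable setT (EFin \o f)).

Let al0 : 0 <= alpha. Proof. by have /andP[/ltW h1 h2] := alpha01. Qed.
Let al1 : alpha < 1. Proof. by have /andP[h1 h2] := alpha01. Qed.

(** The variance of the innovation appears as the conditional variance of a step started from
    $0$. *)
Lemma innov_variance_ge0 : 0 <= s2.
Proof.
rewrite -lee_fin (_ : s2%:E = kernel (fun j => ((j%:R - (alpha * 0%:R + mu)) ^+ 2)%:E) 0%N).
  apply: kernel_ge0 => [|m|j]; rewrite ?fine_ge0 ?lee_fin ?sqr_ge0//.
  by rewrite al0 ltW.
by rewrite (kernel_centered_square model alpha01 eps_cube) mulr0 add0r.
Qed.

Lemma pmf_moment_ge0 k : 0 <= pmf_moment pi k.
Proof.
by rewrite fine_ge0// nneseries_ge0// => j _ _; rewrite lee_fin mulr_ge0 ?exprn_ge0//; case: pi_stat.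
Qed.

Lemma limit_variance_ge0 : 0 <= V.
Proof.
apply: addr_ge0; apply: mulr_ge0; rewrite ?pmf_moment_ge0 ?innov_variance_ge0//.
by rewrite mulr_ge0 ?al0// subr_ge0 ltW.
Qed.

Lemma inv_sqrt_small (c e0 : R) : 0 < e0 -> \forall n \near \oo, c / Num.sqrt n%:R <= e0.
Proof.
move=> e00; near=> n.
have n0 : 0 < n%:R :> R by rewrite ltr0n; near: n; exact: nbhs_infty_gt.
have h : `|c| <= e0 * Num.sqrt n%:R.
  rewrite -ler_pdivrMl// -[leLHS]ger0_norm; last by rewrite mulr_ge0// invr_ge0 ltW.
  rewrite -sqrtr_sqr ler_sqrt//.
  near: n; exact: nbhs_infty_ger.
rewrite ler_pdivrMr ?sqrtr_gt0//; exact: le_trans (ler_norm _) h.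
Unshelve. all: by end_near. Qed.

Section clt.
Variables (m : nat) (S : nat -> T -> R) (A : T -> R).
Hypothesis S_adapted : adapted m (S m).
Hypothesis S_integrable : integ (S m).
Hypothesis S_step : forall k t, (m <= k)%N -> S k.+1 t = S k t + (X k t)%:R * innov k t.
Hypothesis A_adapted : adapted m A.
Hypothesis A01 : forall t, 0 <= A t <= 1.

Let aS j : adapted (m + j) (S (m + j)).
Proof.
elim: j => [|j IH]; first by rewrite addn0.
rewrite addnS (_ : S _ = fun t => S (m + j)%N t + (X (m + j)%N t)%:R * innov (m + j)%N t); last first.
  by apply/funext => t; rewrite S_step// leq_addr.
apply: adapted_op2; first exact: adaptedS.
apply: (adapted_op2 *%R); first by apply: adaptedS; exact: adapted_X.
apply: (adapted_op2 (fun u v => u - alpha * v - mu)); first exact: adapted_X.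
by apply: adaptedS; exact: adapted_X.
Qed.

Let aA j : adapted (m + j) A.
Proof. by elim: j => [|j IH]; [rewrite addn0|rewrite addnS; exact: adaptedS]. Qed.

(** Iterates [clt_step] from [m] to [n] with $r=u/\sqrt n$; multiplication by $e^{-r^2V/2}\le1$ does
    not amplify errors, so they add up. The weight [A] and the value [S m] belong to the past at
    time [m]: as $rS_m\to0$, the initial expectation tends to $\mathbb E[A]\cos b$. The limit
    therefore factors, which is what the conditional statement needs. The recursion is required only
    from [m] on, since [S] will skip the outlier indices. *)
Lemma martingale_clt (u b : R) :
  \int[P]_t (A t * cos (u * (S n t / Num.sqrt n%:R) + b)) @[n --> \oo] -->
  \int[P]_t A t * (expR (- (u ^+ 2 * V / 2)) * cos b).
Proof.
have [G [c0 [c00 HG [c1 c10 Hstep]]]] := clt_step model alpha01 X0_cube eps_cube pi_stat.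
have V0 := limit_variance_ge0.
pose I r k := \int[P]_t (A t * cos (r * S k t + b)).
pose a r k := I r k - r ^+ 2 / 2 * \int[P]_t (A t * cos (r * S k t + b) * G (X k t)%:R).
have bounded_cos r j t : `|A t * cos (r * S (m + j)%N t + b)| <= 1.
  have /andP[h0 h1] := A01 t.
  by rewrite normrM -[leRHS]mul1r ler_pM// ?norm_cos_le1// ger0_norm.
have acos r j : adapted (m + j) (fun t => A t * cos (r * S (m + j)%N t + b)).
  apply: adapted_op2; first exact: aA.
  by apply: (adapted_comp (fun x : R => cos (r * x + b))); exact: aS.
have aI r j : `|I r (m + j)%N - a r (m + j)%N| <= r ^+ 2 / 2 * c0.
  rewrite /a opprB addrC subrK normrM ger0_norm ?divr_ge0 ?sqr_ge0//.
  by apply: ler_wpM2l; [rewrite divr_ge0 ?sqr_ge0|exact: HG].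
have iA : integ A.
  apply: (chain_integrable model alpha01 X0_cube eps_cube (k := m) (C := 1)) => // t.
  have /andP[h0 h1] := A01 t.
  by rewrite ger0_norm// mul1r (le_trans h1)// exprn_ege1// lerDl.
have one_int : integ (fun _ : T => 1 : R).
  apply: (chain_integrable model alpha01 X0_cube eps_cube (k := 0) (C := 1)).
    exact: adapted_cst.
  by move=> t; rewrite normr1 mul1r exprn_ege1// lerDl.
have IA01 : 0 <= \int[P]_t A t <= 1.
  apply/andP; split; first by apply: Rintegral_ge0 => t _; have /andP[] := A01 t.
  apply: (@le_trans _ _ (\int[P]_t (1 : R))); last by rewrite /Rintegral integral_probability_cst.
  by apply: le_Rintegral => // t _; have /andP[] := A01 t.
have iS : integ (fun t => `|S m t|) by exact: (integrable_abse S_integrable).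
pose ES := \int[P]_t `|S m t|.
have ES0 : 0 <= ES by exact: Rintegral_ge0.
have Im r : `|I r m - \int[P]_t A t * cos b| <= `|r| * ES.
  have i1 : integ (fun t => A t * cos (r * S m t + b)).
    apply: (chain_integrable model alpha01 X0_cube eps_cube (k := m) (C := 1)).
      by have := acos r 0%N; rewrite addn0.
    move=> t; have := bounded_cos r 0%N t; rewrite addn0 => /le_trans; apply.
    by rewrite mul1r exprn_ege1// lerDl.
  have i2 : integ (fun t => A t * cos b) by exact: (integrableZr measurableT _ iA).
  rewrite /I -RintegralZr// -RintegralB// /ES -RintegralZl//.
  apply: le_norm_Rintegral.
  - exact: (integrableB measurableT i1 i2).
  - exact: (integrableZl measurableT _ iS).
  - move=> t; have /andP[h0 h1] := A01 t.
    rewrite -mulrBr normrM -[leRHS]mul1r; apply: ler_pM => //; first by rewrite ger0_norm.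
    by rewrite (addrC (r * _)) -normrM cos_lipschitz.
have Hind tau : 0 < tau -> exists K c2, [/\ 0 <= K, 0 <= c2 & forall r j, `|r| <= 1 ->
    `|a r (m + j)%N - expR (- (j%:R * (r ^+ 2 * V / 2))) * a r m| <=
    c1 * r ^+ 2 * (j%:R * tau + K * ((1 - alpha ^+ j) / (1 - alpha))) + j%:R * (c2 * `|r| ^+ 3)].
  move=> tau0; have [K [c2 [K0 c20 H]]] := Hstep tau tau0.
  exists K, c2; split => // r j r1; elim: j => [|j IH].
    rewrite addn0 !mul0r oppr0 expR0 mul1r subrr normr0 expr0 subrr !mul0r mulr0 addr0 add0r mulr0//.
  have {}H := H r (m + j)%N (S (m + j)%N) (S (m + j).+1) A r1 (aS j) (aA j) A01 (fun t => S_step t (leq_addr j m)) b.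
  set kap := r ^+ 2 * V / 2 in IH H *.
  have kap0 : 0 <= kap by apply: divr_ge0 => //; apply: mulr_ge0 => //; exact: sqr_ge0.
  rewrite addnS (_ : expR (- (j.+1%:R * kap)) = expR (- kap) * expR (- (j%:R * kap))); last first.
    by rewrite -expRD; congr expR; rewrite -natr1; ring.
  rewrite (_ : a r (m + j).+1 - expR (- kap) * expR (- (j%:R * kap)) * a r m =
    (a r (m + j).+1 - expR (- kap) * a r (m + j)%N) + expR (- kap) * (a r (m + j)%N - expR (- (j%:R * kap)) * a r m)); last by ring.
  apply: (le_trans (ler_normD _ _)).
  have h2 : `|expR (- kap) * (a r (m + j)%N - expR (- (j%:R * kap)) * a r m)| <= c1 * r ^+ 2 * (j%:R * tau + K * ((1 - alpha ^+ j) / (1 - alpha))) + j%:R * (c2 * `|r| ^+ 3).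
    rewrite normrM ger0_norm ?expR_ge0//; apply: le_trans IH; rewrite ler_piMl//.
    by rewrite -[leRHS]expR0 ler_expR oppr_le0.
  apply: (le_trans (lerD H h2)).
  have ajm : alpha ^+ (m + j) <= alpha ^+ j by rewrite exprD ler_piMl ?exprn_ge0// exprn_ile1// ltW.
  have E : K * ((1 - alpha ^+ j.+1) / (1 - alpha)) = K * ((1 - alpha ^+ j) / (1 - alpha)) + alpha ^+ j * K.
    by rewrite exprS; field; rewrite subr_eq0 gt_eqF.
  rewrite E -natr1.
  have c1r : 0 <= c1 * r ^+ 2 by rewrite mulr_ge0 ?sqr_ge0.
  have := ler_wpM2l c1r (ler_wpM2r K0 ajm).
  move: (K * ((1 - alpha ^+ j) / (1 - alpha))) (alpha ^+ (m + j) * K) (alpha ^+ j * K) (c1 * r ^+ 2) (c2 * `|r| ^+ 3) (j%:R : R) => x1 x2 x3 x4 x5 x6 h.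
  lra.
apply/cvgrPdist_le => e0 e00.
(* Over all steps the non-vanishing part of the error is at most $c_1u^2\tau$, because $nr^2=u^2$;
   the choice makes it at most $e_0/2$. Everything else is collected in [Cst] times $|r|$. *)
pose tau := e0 / 2 / (1 + c1 * u ^+ 2).
have d0 : 0 < 1 + c1 * u ^+ 2 by rewrite ltr_pwDl// mulr_ge0 ?sqr_ge0.
have tau0 : 0 < tau by rewrite !divr_gt0.
have [K [c2 [K0 c20 H]]] := Hind tau tau0.
pose K' := K / (1 - alpha).
have a1 : 0 < 1 - alpha by rewrite subr_gt0.
have K'0 : 0 <= K' by rewrite divr_ge0// ltW.
pose Cst := c1 * K' + c2 * u ^+ 2 + c0 + ES + m%:R * V.
near=> n.
have n0 : (0 < n)%N by near: n; exact: nbhs_infty_gt.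
have mn : (m <= n)%N by near: n; exact: nbhs_infty_ge.
have sn0 : 0 < Num.sqrt n%:R :> R by rewrite sqrtr_gt0 ltr0n.
pose r := u / Num.sqrt n%:R.
have rE : `|r| = `|u| / Num.sqrt n%:R.
  by rewrite normrM (ger0_norm (_ : 0 <= (Num.sqrt n%:R)^-1))// invr_ge0 ltW.
have r1 : `|r| <= 1 by rewrite rE; near: n; exact: inv_sqrt_small.
have Cr : Cst * `|r| <= e0 / 2.
  by rewrite rE mulrA; near: n; apply: inv_sqrt_small; rewrite divr_gt0.
have r2n : n%:R * r ^+ 2 = u ^+ 2.
  by rewrite /r expr_div_n sqr_sqrtr// mulrC mulfVK// pnatr_eq0 -lt0n.
have r20 : 0 <= r ^+ 2 by exact: sqr_ge0.
have r2E : r ^+ 2 = `|r| ^+ 2 by rewrite real_normK ?num_real.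
have r2r : r ^+ 2 <= `|r| by rewrite r2E expr2 ler_piMl.
rewrite (_ : (fun t => A t * cos (u * (S n t / Num.sqrt n%:R) + b)) = (fun t => A t * cos (r * S n t + b))); last first.
  by apply/funext => t; rewrite /r mulrA mulrAC.
pose j := (n - m)%N.
have nE : n = (m + j)%N by rewrite subnKC.
have := H r j r1; rewrite -nE => H1.
have := aI r j; rewrite -nE => H2.
have := aI r 0%N; rewrite addn0 => H3.
have H4 := Im r.
rewrite -/(I r n).
set kap := r ^+ 2 * V / 2 in H1 *.
have kap0 : 0 <= kap by apply: divr_ge0 => //; exact: mulr_ge0.
pose Ej := expR (- (j%:R * kap)).
have Ej0 : 0 <= Ej by exact: expR_ge0.
have Ej1 : Ej <= 1 by rewrite -[leRHS]expR0 ler_expR oppr_le0 mulr_ge0.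
(* Only $n-m$ of the $n$ factors are produced; the [m] missing ones cost $O(r^2)$. *)
have H5 : `|Ej - expR (- (u ^+ 2 * V / 2))| <= m%:R * V * `|r|.
  have -> : expR (- (u ^+ 2 * V / 2)) = Ej * expR (- (m%:R * kap)).
    by rewrite /Ej -expRD; congr expR; rewrite -r2n {1}nE natrD /kap; field.
  rewrite (_ : Ej - Ej * expR (- (m%:R * kap)) = Ej * (1 - expR (- (m%:R * kap)))); last by ring.
  rewrite normrM (ger0_norm Ej0).
  have h1 := expR_ge1Dx (- (m%:R * kap)).
  have h2 : expR (- (m%:R * kap)) <= 1 by rewrite -[leRHS]expR0 ler_expR oppr_le0 mulr_ge0.
  rewrite ger0_norm ?subr_ge0//.
  apply: (@le_trans _ _ (1 - expR (- (m%:R * kap)))); first by rewrite ler_piMl ?subr_ge0.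
  apply: (@le_trans _ _ (m%:R * kap)); first by lra.
  rewrite -(mulrA m%:R); apply: ler_wpM2l => //.
  rewrite /kap (_ : r ^+ 2 * V / 2 = V * (r ^+ 2 / 2)); last by ring.
  apply: ler_wpM2l => //; rewrite ler_pdivrMr//; apply: (le_trans r2r).
  by rewrite ler_peMr// ler1n.
have cosb := norm_cos_le1 b.
have jn : j%:R * r ^+ 2 <= u ^+ 2 by rewrite -r2n ler_wpM2r// ler_nat leq_subr.
have B1 : c1 * r ^+ 2 * (j%:R * tau + K * ((1 - alpha ^+ j) / (1 - alpha))) + j%:R * (c2 * `|r| ^+ 3) <=
   e0 / 2 + (c1 * K' + c2 * u ^+ 2) * `|r|.
  have g1 : c1 * r ^+ 2 * (j%:R * tau) <= e0 / 2.
    rewrite (_ : c1 * r ^+ 2 * (j%:R * tau) = c1 * (j%:R * r ^+ 2) * tau); last by ring.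
    rewrite /tau mulrA ler_pdivrMr// (mulrC (e0 / 2)); apply: ler_wpM2r; first by rewrite divr_ge0// ltW.
    by apply: (le_trans (ler_wpM2l c10 jn)); rewrite lerDr.
  have g2 : c1 * r ^+ 2 * (K * ((1 - alpha ^+ j) / (1 - alpha))) <= c1 * K' * `|r|.
    rewrite (_ : c1 * r ^+ 2 * _ = c1 * K' * (r ^+ 2 * (1 - alpha ^+ j))); last by rewrite /K'; field; rewrite gt_eqF.
    apply: ler_wpM2l; first exact: mulr_ge0.
    apply: le_trans r2r; rewrite ler_piMr// gerDl oppr_le0 exprn_ge0//.
  have g3 : j%:R * (c2 * `|r| ^+ 3) <= c2 * u ^+ 2 * `|r|.
    rewrite (_ : j%:R * (c2 * `|r| ^+ 3) = c2 * (j%:R * `|r| ^+ 2) * `|r|); last by ring.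
    apply: ler_wpM2r => //; apply: ler_wpM2l => //; by rewrite -r2E.
  by rewrite mulrDr; lra.
have H3' : `|Ej * (a r m - I r m)| <= r ^+ 2 / 2 * c0.
  by rewrite normrM ger0_norm// distrC; apply: le_trans H3; rewrite ler_piMl.
have H4' : `|Ej * (I r m - \int[P]_t A t * cos b)| <= `|r| * ES.
  by rewrite normrM ger0_norm//; apply: le_trans H4; rewrite ler_piMl.
have H5' : `|(Ej - expR (- (u ^+ 2 * V / 2))) * (\int[P]_t A t * cos b)| <= m%:R * V * `|r|.
  rewrite normrM -[leRHS]mulr1; apply: ler_pM => //.
  have /andP[h0 h1] := IA01.
  by rewrite normrM ger0_norm// -[leRHS]mulr1 ler_pM.
have H0 : r ^+ 2 / 2 * c0 <= c0 * `|r| / 2.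
  by rewrite (_ : r ^+ 2 / 2 * c0 = c0 * r ^+ 2 / 2); [rewrite ler_pM2r// ler_wpM2l|ring].
rewrite distrC.
have -> : I r n - \int[P]_t A t * (expR (- (u ^+ 2 * V / 2)) * cos b) =
  (I r n - a r n) + (a r n - Ej * a r m) + Ej * (a r m - I r m) + Ej * (I r m - \int[P]_t A t * cos b) +
  (Ej - expR (- (u ^+ 2 * V / 2))) * (\int[P]_t A t * cos b) by ring.
have N4 := ler_normD ((I r n - a r n) + (a r n - Ej * a r m) + Ej * (a r m - I r m) + Ej * (I r m - \int[P]_t A t * cos b)) ((Ej - expR (- (u ^+ 2 * V / 2))) * (\int[P]_t A t * cos b)).
have N3 := ler_normD ((I r n - a r n) + (a r n - Ej * a r m) + Ej * (a r m - I r m)) (Ej * (I r m - \int[P]_t A t * cos b)).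
have N2 := ler_normD ((I r n - a r n) + (a r n - Ej * a r m)) (Ej * (a r m - I r m)).
have N1 := ler_normD (I r n - a r n) (a r n - Ej * a r m).
have := le_trans H1 B1; rewrite -/Ej => H1'.
have : Cst * `|r| = (c1 * K' + c2 * u ^+ 2) * `|r| + c0 * `|r| + `|r| * ES + m%:R * V * `|r| by rewrite /Cst; ring.
lra.
Unshelve. all: by end_near. Qed.

End clt.

End CentralLimit.

(** * Tightness and the law of large numbers through the potential sqrt(1+x^2) *)

Section SquareRootPotential.
Context {R : realType}.
Implicit Types a b : R.

Let sqrt1_ge1 a : 1 <= Num.sqrt (1 + a ^+ 2).
Proof. by rewrite -[leLHS]sqrtr1 ler_sqrt ?lerDl ?sqr_ge0// addr_ge0 ?sqr_ge0. Qed.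

Let slope a := a / Num.sqrt (1 + a ^+ 2).

Lemma norm_sqrt1_slope_le1 a : `|a / Num.sqrt (1 + a ^+ 2)| <= 1.
Proof.
have h := sqrt1_ge1 a; have s0 : 0 < Num.sqrt (1 + a ^+ 2) by exact: lt_le_trans h.
rewrite normrM normfV (gtr0_norm s0) ler_pdivrMr// mul1r -sqrtr_sqr ler_sqrt ?lerDr//.
by rewrite addr_ge0 ?sqr_ge0.
Qed.

(** The potential has second derivative at most $1$; the proof compares squares. Its companion
    [sqrt1_add_le_norm] uses that the potential and its tangent are $1$-Lipschitz. Growing only
    linearly, the potential has a finite mean as soon as the martingale is integrable. *)
Lemma sqrt1_add_le_sqr a b : Num.sqrt (1 + (a + b) ^+ 2) <=
  Num.sqrt (1 + a ^+ 2) + a / Num.sqrt (1 + a ^+ 2) * b + b ^+ 2 / 2.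
Proof.
have s1 := sqrt1_ge1 a; have := norm_sqrt1_slope_le1 a.
have sE : Num.sqrt (1 + a ^+ 2) ^+ 2 = 1 + a ^+ 2 by rewrite sqr_sqrtr// addr_ge0 ?sqr_ge0.
rewrite /slope; set s := Num.sqrt (1 + a ^+ 2) in s1 sE *.
have s0 : 0 < s by exact: lt_le_trans s1.
have : a / s * s = a by rewrite mulfVK// gt_eqF.
move: (a / s) => p pE; rewrite ler_norml => /andP[p0 p1].
have rhs0 : 0 <= s + p * b + b ^+ 2 / 2.
  have h1 : - `|b| <= p * b.
    by rewrite lerNl -mulNr; apply: (le_trans (ler_norm _)); rewrite normrM normrN ler_piMl// ler_norml p0.
  have := sqr_ge0 (`|b| - 1); rewrite sqrrB1 real_normK ?num_real//; move: (b ^+ 2) h1 => c h1 h2; lra.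
rewrite -[leRHS]ger0_norm// -sqrtr_sqr ler_sqrt ?sqr_ge0//.
have := sqr_ge0 (p * b + b ^+ 2 / 2); have := ler_wpM2r (sqr_ge0 b) s1.
rewrite (_ : (s + p * b + b ^+ 2 / 2) ^+ 2 =
  s ^+ 2 + 2 * (p * s) * b + s * b ^+ 2 + (p * b + b ^+ 2 / 2) ^+ 2); last by field.
rewrite sE pE (sqrrD a b) mulr2n -(mulrA 2 a b); set x2 := s * b ^+ 2; set x3 := (p * b + b ^+ 2 / 2) ^+ 2; move: x2 x3 (a ^+ 2) (b ^+ 2) (a * b) => x2 x3 x4 x5 x6.
lra.
Qed.

Lemma sqrt1_add_le_norm a b : Num.sqrt (1 + (a + b) ^+ 2) <=
  Num.sqrt (1 + a ^+ 2) + a / Num.sqrt (1 + a ^+ 2) * b + 2 * `|b|.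
Proof.
have s1 := sqrt1_ge1 a; have := norm_sqrt1_slope_le1 a; rewrite /slope.
have sE : Num.sqrt (1 + a ^+ 2) ^+ 2 = 1 + a ^+ 2 by rewrite sqr_sqrtr// addr_ge0 ?sqr_ge0.
have as_ : `|a| <= Num.sqrt (1 + a ^+ 2) by rewrite -sqrtr_sqr ler_sqrt ?lerDr// addr_ge0 ?sqr_ge0.
set s := Num.sqrt (1 + a ^+ 2) in s1 sE as_ *.
have s0 : 0 < s by exact: lt_le_trans s1.
move: (a / s) => p p1.
have h1 : - `|b| <= p * b.
  by rewrite lerNl -mulNr; apply: (le_trans (ler_norm _)); rewrite normrM normrN ler_piMl.
have h2 : Num.sqrt (1 + (a + b) ^+ 2) <= s + `|b|.
  have sb : 0 <= s + `|b| by apply: addr_ge0 => //; exact: ltW.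
  rewrite -[leRHS]ger0_norm// -sqrtr_sqr ler_sqrt ?sqr_ge0//.
  have : a * b <= s * `|b| by apply: (le_trans (ler_norm _)); rewrite normrM ler_wpM2r.
  have : `|b| ^+ 2 = b ^+ 2 by rewrite real_normK ?num_real.
  nra.
lra.
Qed.

Context {d : measure_display} {T : measurableType d}.
Variable P : probability T R.
Local Notation integ f := (P.-integrable setT (EFin \o f)).

Lemma integrable_sqrt1 (N : T -> R) : integ N -> integ (fun t => Num.sqrt (1 + N t ^+ 2)).
Proof.
move=> iN; have mN : measurable_fun setT N by apply/measurable_EFinP; exact: (measurable_int _ iN).
have i1 : integ (fun=> 1 : R) by exact: finite_measure_integrable_cst.
have iN1 : integ (fun t => `|N t|) by exact: (integrable_abse iN).
apply: (@integrable_le _ _ _ P setT _ (fun t => 1 + `|N t|)) => //; last first.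
- move=> t _; rewrite ger0_norm ?sqrtr_ge0//.
  have h0 : 0 <= 1 + `|N t| by [].
  rewrite -[leRHS]ger0_norm// -sqrtr_sqr ler_sqrt ?sqr_ge0//.
  by have : `|N t| ^+ 2 = N t ^+ 2 by [rewrite real_normK ?num_real]; have := normr_ge0 (N t); nra.
- exact: (integrableD measurableT i1 iN1).
- apply: (@measurableT_comp _ _ _ _ _ _ (@Num.sqrt R) _ (fun t => 1 + N t ^+ 2)).
    by apply: continuous_measurable_fun; exact: sqrt_continuous.
  by apply: measurable_funD => //; exact: measurable_funX.
Qed.

(** The linear term vanishes because the slope of the potential is a bounded function of [N] and [Z]
    is a martingale increment. At each point either the quadratic or the linear bound may be chosen,
    so increments without a second moment are allowed. *)
Lemma sqrt1_drift (N Z h : T -> R) (r : R) : integ N -> integ Z -> integ h ->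
  \int[P]_t (r * N t / Num.sqrt (1 + (r * N t) ^+ 2) * Z t) = 0 ->
  (forall t, (r * Z t) ^+ 2 / 2 <= h t \/ 2 * `|r * Z t| <= h t) ->
  \int[P]_t Num.sqrt (1 + (r * (N t + Z t)) ^+ 2) <=
  \int[P]_t Num.sqrt (1 + (r * N t) ^+ 2) + \int[P]_t h t.
Proof.
move=> iN iZ ih c0 hh.
have irN : integ (fun t => r * N t) := integrableZl measurableT r iN.
have iNZ : integ (fun t => N t + Z t) := integrableD measurableT iN iZ.
have irNZ : integ (fun t => r * (N t + Z t)) := integrableZl measurableT r iNZ.
have mN : measurable_fun setT (fun t => r * N t) by apply/measurable_EFinP; exact: (measurable_int _ irN).
have mZ : measurable_fun setT Z by apply/measurable_EFinP; exact: (measurable_int _ iZ).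
pose c t := r * N t / Num.sqrt (1 + (r * N t) ^+ 2).
have mc : measurable_fun setT c.
  apply: (@measurableT_comp _ _ _ _ _ _ slope _ (fun t => r * N t)) => //.
  apply: continuous_measurable_fun => x; apply: cvgM; first exact: cvg_id.
  apply: cvgV; first by rewrite gt_eqF// (lt_le_trans _ (sqrt1_ge1 x)).
  apply: (@continuous_comp _ _ _ (fun y : R => 1 + y ^+ 2) (@Num.sqrt R)); last exact: sqrt_continuous.
  by apply: cvgD; [exact: cvg_cst|exact: exprn_continuous].
have icZ : integ (fun t => c t * Z t).
  apply: (@integrable_le _ _ _ P setT _ (fun t => `|Z t|)) => //; first exact: measurable_funM.
    exact: (integrable_abse iZ).
  by move=> t _; rewrite normrM ler_piMl// norm_sqrt1_slope_le1.
have ircZ : integ (fun t => r * (c t * Z t)) := integrableZl measurableT r icZ.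
have i1 := integrable_sqrt1 irN; have i2 := integrable_sqrt1 irNZ.
have i3 : integ (fun t => Num.sqrt (1 + (r * N t) ^+ 2) + r * (c t * Z t)) := integrableD measurableT i1 ircZ.
apply: (@le_trans _ _ (\int[P]_t (Num.sqrt (1 + (r * N t) ^+ 2) + r * (c t * Z t) + h t))).
  apply: le_Rintegral => //; first exact: (integrableD measurableT i3 ih).
  move=> t _; rewrite mulrDr (mulrCA r).
  case: (hh t); first by have := sqrt1_add_le_sqr (r * N t) (r * Z t); rewrite /c; lra.
  by have := sqrt1_add_le_norm (r * N t) (r * Z t); rewrite /c; lra.
by rewrite RintegralD// RintegralD// RintegralZl// c0 mulr0 addr0.
Qed.

Lemma markov_Rintegral (E : set T) (h : T -> R) : measurable E -> integ h ->
  (forall t, 0 <= h t) -> (forall t, E t -> 1 <= h t) -> fine (P E) <= \int[P]_t h t.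
Proof.
move=> mE ih h0 h1.
rewrite -(setIT E) -(integral_indic P measurableT mE); apply: fine_le.
- by rewrite (integral_indic P measurableT mE) setIT fin_num_measure.
- exact: integrable_fin_num.
- apply: ge0_le_integral => //.
  + by apply/measurable_EFinP; exact: measurable_indic.
  + exact: measurable_int ih.
  + move=> t _; rewrite lee_fin indicE; case: (boolP (t \in E)) => // tE.
    by apply: h1; rewrite -inE.
Qed.

Lemma fine_probability_le (A B : set T) : measurable A -> measurable B -> A `<=` B ->
  fine (P A) <= fine (P B).
Proof. by move=> mA mB AB; apply: fine_le; rewrite ?fin_num_measure// le_measure ?inE. Qed.

Lemma fine_probabilityU_le (A B : set T) : measurable A -> measurable B ->
  fine (P (A `|` B)) <= fine (P A) + fine (P B).
Proof.
move=> mA mB; rewrite -fineD ?fin_num_measure//; apply: fine_le.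
- by rewrite fin_num_measure//; exact: measurableU.
- by rewrite fin_numD !fin_num_measure.
- exact: measureU2.
Qed.
End SquareRootPotential.

Section LawOfLargeNumbers.
Context {R : realType} {d : measure_display} {T : measurableType d}.
Variables (P : probability T R) (alpha : R) (X0 : T -> nat) (eps : nat -> T -> nat)
  (xi : nat -> nat -> T -> bool) (pi : nat -> R).
Hypothesis model : inar_model P alpha X0 eps xi.
Hypothesis alpha01 : 0 < alpha < 1.
Hypothesis X0_cube : (expect_pow P X0 3 < +oo)%E.
Hypothesis eps_cube : (expect_pow P (eps 1%N) 3 < +oo)%E.

Local Notation X := (inar_X X0 eps xi).
Local Notation hist := (hist X0 eps xi).
Local Notation q := (fun m => fine (P [set t | eps 1%N t = m])).
Local Notation kernel := (transop alpha q).
Local Notation e k := (fine (expect_pow P (eps 1%N) k)).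
Local Notation mu := (e 1).
Local Notation s2 := (e 2 - mu ^+ 2).
Local Notation adapted := (adapted X0 eps xi).
Hypothesis pi_stat : is_stationary alpha q pi.
Local Notation innov k t := ((X k.+1 t)%:R - alpha * (X k t)%:R - mu).
Local Notation integ f := (P.-integrable setT (EFin \o f)).

Let cint := chain_integrable model alpha01 X0_cube eps_cube.

Let int_cube k : integ (fun t => (1 + (X k t)%:R) ^+ 3).
Proof.
apply: (@cint k _ 1); last by move=> t; rewrite mul1r ger0_norm// exprn_ge0// addr_ge0.
by apply: (adapted_comp (fun x : R => (1 + x) ^+ 3)); exact: adapted_X.
Qed.

Let adapted_slope k (r : R) (f : T -> R) : adapted k f ->
  adapted k (fun t => r * f t / Num.sqrt (1 + (r * f t) ^+ 2)).
Proof. exact: (adapted_comp (fun x : R => r * x / Num.sqrt (1 + (r * x) ^+ 2))). Qed.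

Section tightness.
Variables (m : nat) (S : nat -> T -> R).
Hypothesis S_adapted : adapted m (S m).
Hypothesis S_integrable : integ (S m).
Hypothesis S_step : forall k t, (m <= k)%N -> S k.+1 t = S k t + (X k t)%:R * innov k t.

Let step_int k : integ (fun t => (X k t)%:R * innov k t).
Proof.
have [|//] := @step_mean _ _ _ _ _ _ _ _ model alpha01 X0_cube eps_cube k (fun t => (X k t)%:R) 1 (adapted_X _ _ _ k).
move=> t; rewrite mul1r ger0_norm//; have : 0 <= (X k t)%:R :> R by []; move: ((X k t)%:R) => x x0; nra.
Qed.

Let S_ind j : adapted (m + j) (S (m + j)) /\ integ (S (m + j)%N).
Proof.
elim: j => [|j [aS iS]]; first by rewrite addn0.
rewrite addnS (_ : S _ = fun t => S (m + j)%N t + (X (m + j)%N t)%:R * innov (m + j)%N t); last first.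
  by apply/funext => t; rewrite S_step// leq_addr.
split; last exact: (integrableD measurableT iS (step_int _)).
apply: adapted_op2; first exact: adaptedS.
apply: (adapted_op2 *%R); first by apply: adaptedS; exact: adapted_X.
apply: (adapted_op2 (fun u v => u - alpha * v - mu)); first exact: adapted_X.
by apply: adaptedS; exact: adapted_X.
Qed.

Lemma martingale_measurable n : (m <= n)%N -> measurable_fun setT (S n).
Proof. by move=> mn; have [aS _] := S_ind (n - m); rewrite subnKC// in aS; exact: (adapted_measurable model aS). Qed.

(** Each step raises the mean of the potential of $rS$ by at most $r^2C/2$, with $C$ bounding the
    second moment of a step. With $r=1/\sqrt n$ the total stays bounded in [n], and Markov's
    inequality concludes, as $|x|\le\sqrt{1+x^2}$. *)
Lemma martingale_tight (e0 : R) : 0 < e0 -> exists M, 0 < M /\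
  forall n, (0 < n)%N -> (m <= n)%N -> fine (P [set t | M < `|S n t / Num.sqrt n%:R|]) <= e0.
Proof.
move=> e00.
have [B B0 HB] := chain_expect_bound model alpha01 X0_cube eps_cube.
pose ES := \int[P]_t `|S m t|.
have iS : integ (fun t => `|S m t|) by exact: (integrable_abse S_integrable).
have ES0 : 0 <= ES by exact: Rintegral_ge0.
pose C := (alpha * (1 - alpha) + s2) * B.
have s20 := innov_variance_ge0 model alpha01 eps_cube.
have aa0 : 0 <= alpha * (1 - alpha) by have /andP[a0 a1] := alpha01; rewrite mulr_ge0 ?subr_ge0 ?ltW.
have C0 : 0 <= C by apply: mulr_ge0; [exact: addr_ge0|exact: ltW].
have sq k : integ (fun t => (X k t)%:R ^+ 2 * innov k t ^+ 2) /\
    \int[P]_t ((X k t)%:R ^+ 2 * innov k t ^+ 2) <= C.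
  have aX2 : adapted k (fun t => (X k t)%:R ^+ 2 : R).
    by apply: (adapted_comp (fun x : R => x ^+ 2)); exact: adapted_X.
  have [|i2 E2] := step_square model alpha01 X0_cube eps_cube (B := 1) aX2.
    by move=> t; rewrite mul1r ger0_norm ?sqr_ge0// ler_pXn2r ?nnegrE ?addr_ge0// lerDr.
  split => //; rewrite E2; apply: (le_trans (ler_norm _)); apply: (HB k); last exact: addr_ge0.
    apply: (adapted_op2 *%R) => //.
    by apply: (adapted_comp (fun x : R => alpha * (1 - alpha) * x + s2)); exact: adapted_X.
  move=> t; have x0 : 0 <= (X k t)%:R :> R by [].
  move: ((X k t)%:R : R) x0 (alpha * (1 - alpha)) aa0 s2 s20 => x x0 a a0 v v0.
  have ax0 := mulr_ge0 a0 x0.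
  rewrite ger0_norm; last by rewrite mulr_ge0 ?sqr_ge0 ?addr_ge0.
  have h3 : x ^+ 3 <= (1 + x) ^+ 3 by rewrite ler_pXn2r ?nnegrE ?addr_ge0// lerDr.
  have h2 : x ^+ 2 <= (1 + x) ^+ 3.
    apply: (@le_trans _ _ ((1 + x) ^+ 2)); last by rewrite ler_weXn2l// lerDl.
    by rewrite ler_pXn2r ?nnegrE ?addr_ge0// lerDr.
  have := ler_wpM2l a0 h3; have := ler_wpM2l v0 h2; move: ((1 + x) ^+ 3) => w; nra.
pose psi r k := \int[P]_t Num.sqrt (1 + (r * S k t) ^+ 2).
have psi_step r j : psi r (m + j)%N <= 1 + `|r| * ES + j%:R * (r ^+ 2 / 2 * C).
  elim: j => [|j IH].
    rewrite addn0 mul0r addr0 /psi.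
    have i1 : integ (fun=> 1 : R) by exact: finite_measure_integrable_cst.
    have i2 : integ (fun t => `|r| * `|S m t|) := integrableZl measurableT `|r| iS.
    have i3 : integ (fun t => r * S m t) := integrableZl measurableT r S_integrable.
    apply: (@le_trans _ _ (\int[P]_t (1 + `|r| * `|S m t|))).
      apply: le_Rintegral => //; first exact: integrable_sqrt1.
        exact: (integrableD measurableT i1 i2).
      move=> t _; rewrite -normrM.
      have := sqrt1_add_le_norm 0 (r * S m t); rewrite add0r.
      have h0 : 0 <= 1 + `|r * S m t| by [].
      move=> _; rewrite -[leRHS]ger0_norm// -sqrtr_sqr ler_sqrt ?sqr_ge0//.
      rewrite -(real_normK (num_real (r * S m t))); have := normr_ge0 (r * S m t).
      move: `|_| => y y0; nra.
    rewrite RintegralD// RintegralZl//.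
    by rewrite /Rintegral integral_probability_cst.
  have [aS iSj] := S_ind j.
  have [isq Esq] := sq (m + j)%N.
  have irs : integ (fun t => r ^+ 2 / 2 * ((X (m + j)%N t)%:R ^+ 2 * innov (m + j)%N t ^+ 2)) :=
    integrableZl measurableT (r ^+ 2 / 2) isq.
  rewrite addnS /psi; under eq_Rintegral do rewrite S_step ?leq_addr//.
  have E0 : \int[P]_t (r * S (m + j)%N t / Num.sqrt (1 + (r * S (m + j)%N t) ^+ 2) * ((X (m + j)%N t)%:R * innov (m + j)%N t)) = 0.
    have [||_ <-] := @step_mean _ _ _ _ _ _ _ _ model alpha01 X0_cube eps_cube (m + j)%N
      (fun t => r * S (m + j)%N t / Num.sqrt (1 + (r * S (m + j)%N t) ^+ 2) * (X (m + j)%N t)%:R) 1.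
    - by apply: (adapted_op2 *%R); [exact: adapted_slope|exact: adapted_X].
    - move=> t; rewrite normrM mul1r; have x0 : 0 <= (X (m + j)%N t)%:R :> R by [].
      rewrite (ger0_norm x0); apply: (@le_trans _ _ ((X (m + j)%N t)%:R)).
        by rewrite ler_piMl// norm_sqrt1_slope_le1.
      by move: ((X (m + j)%N t)%:R) x0 => x x0; nra.
    - by apply: eq_Rintegral => t _; rewrite mulrA.
  apply: (le_trans (sqrt1_drift iSj (step_int _) irs E0 _)).
    by move=> t; left; rewrite !exprMn; lra.
  rewrite (_ : j.+1%:R = j%:R + 1 :> R); last by rewrite natr1.
  rewrite (mulrDl _ 1) mul1r addrA; apply: lerD => //.
  by rewrite RintegralZl//; apply: ler_wpM2l => //; rewrite divr_ge0 ?sqr_ge0.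
pose M := (1 + ES + C) / e0.
have M0 : 0 < M by rewrite divr_gt0// ltr_pwDl// ltr_pwDl.
exists M; split => // n n0 mn.
have sn0 : 0 < Num.sqrt n%:R :> R by rewrite sqrtr_gt0 ltr0n.
pose r := (Num.sqrt n%:R)^-1 : R.
have r0 : 0 <= r by rewrite invr_ge0 ltW.
have r1 : r <= 1 by rewrite invf_le1// -[leLHS]sqrtr1 ler_sqrt ?ler1n.
have r2 : n%:R * r ^+ 2 = 1 by rewrite exprVn sqr_sqrtr// divff// pnatr_eq0 -lt0n.
have := psi_step r (n - m)%N; have [aS iSn] := S_ind (n - m); rewrite subnKC// in aS iSn *.
move=> hpsi.
have irS : integ (fun t => r * S n t) := integrableZl measurableT r iSn.
have ih : integ (fun t => M^-1 * Num.sqrt (1 + (r * S n t) ^+ 2)) :=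
  integrableZl measurableT M^-1 (integrable_sqrt1 irS).
have M1 : 0 <= M^-1 by rewrite invr_ge0 ltW.
apply: (@le_trans _ _ (\int[P]_t (M^-1 * Num.sqrt (1 + (r * S n t) ^+ 2)))).
  apply: markov_Rintegral => //.
  - apply: measurable_abs_gt; apply: measurable_funM => //; exact: (adapted_measurable model aS).
  - by move=> t; rewrite mulr_ge0 ?sqrtr_ge0.
  - move=> t /= Mt; rewrite ler_pdivlMl// mulr1.
    apply: (le_trans (ltW Mt)); rewrite mulrC -/r -sqrtr_sqr ler_sqrt ?lerDr//.
    by rewrite addr_ge0 ?sqr_ge0.
rewrite RintegralZl//; last exact: integrable_sqrt1.
rewrite ler_pdivrMl// /M mulfVK ?gt_eqF//; apply: (le_trans hpsi).
rewrite ger0_norm//; apply: lerD; first by rewrite lerD2l ler_piMl.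
have h : (n - m)%:R * r ^+ 2 <= 1 by rewrite -[leRHS]r2 ler_wpM2r ?sqr_ge0// ler_nat leq_subr.
have := ler_wpM2r C0 h; rewrite mul1r; move: C C0 sq psi_step M M0 M1 ih hpsi => C1 C10 *; lra.
Qed.
End tightness.
End LawOfLargeNumbers.

Lemma increment_quadratic_bound (R : realFieldType) (m C a b x g h : R) :
  1 <= a -> 1 <= b -> 0 <= m -> 0 <= C -> 0 <= x -> x <= a ^+ 2 ->
  `|g| <= C * a ^+ 2 -> `|h| <= C * b ^+ 2 ->
  `|x - m + h - g| <= (1 + m + C) * (a + b) ^+ 2.
Proof.
move=> a1 b1 m0 C0 x0 xa.
have s1 : a ^+ 2 + b ^+ 2 <= (a + b) ^+ 2 by nra.
have s2 : 1 <= (a + b) ^+ 2 by nra.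
have t1 := ler_wpM2l m0 s2; have t2 := ler_wpM2l C0 s1.
have b20 := sqr_ge0 b.
rewrite !ler_norml !(mulrDl _ _ ((a + b) ^+ 2)) mul1r.
move: ((a + b) ^+ 2) (a ^+ 2) (b ^+ 2) s1 s2 t1 t2 xa b20 => u v w s1 s2 t1 t2 xa b20.
by move=> /andP[h1 h2] /andP[h3 h4]; apply/andP; split; lra.
Qed.

Section SquareAverage.
Context {R : realType} {d : measure_display} {T : measurableType d}.
Variables (P : probability T R) (alpha : R) (X0 : T -> nat) (eps : nat -> T -> nat)
  (xi : nat -> nat -> T -> bool) (pi : nat -> R).
Hypothesis model : inar_model P alpha X0 eps xi.
Hypothesis alpha01 : 0 < alpha < 1.
Hypothesis X0_cube : (expect_pow P X0 3 < +oo)%E.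
Hypothesis eps_cube : (expect_pow P (eps 1%N) 3 < +oo)%E.

Local Notation X := (inar_X X0 eps xi).
Local Notation hist := (hist X0 eps xi).
Local Notation q := (fun m => fine (P [set t | eps 1%N t = m])).
Local Notation kernel := (transop alpha q).
Local Notation e k := (fine (expect_pow P (eps 1%N) k)).
Local Notation mu := (e 1).
Local Notation s2 := (e 2 - mu ^+ 2).
Local Notation adapted := (adapted X0 eps xi).
Hypothesis pi_stat : is_stationary alpha q pi.
Local Notation m2 := (pmf_moment pi 2).
Local Notation integ f := (P.-integrable setT (EFin \o f)).

Let int_cube k : integ (fun t => (1 + (X k t)%:R) ^+ 3).
Proof.
apply: (chain_integrable model alpha01 X0_cube eps_cube (k := k) (C := 1)); last first.
  by move=> t; rewrite mul1r ger0_norm// exprn_ge0// addr_ge0.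
by apply: (adapted_comp (fun x : R => (1 + x) ^+ 3)); exact: adapted_X.
Qed.

Lemma adapted_sum_sqr n : adapted n (fun t => \sum_(j < n) (X j t)%:R ^+ 2 : R).
Proof.
elim: n => [|n IH].
  rewrite (_ : (fun t => _) = fun=> 0); first exact: adapted_cst.
  by apply/funext => t; rewrite big_ord0.
rewrite (_ : (fun t => _) = fun t => (\sum_(j < n) (X j t)%:R ^+ 2) + (X n t)%:R ^+ 2); last first.
  by apply/funext => t; rewrite big_ord_recr.
apply: (adapted_op2 +%R); apply: adaptedS => //.
by apply: (adapted_comp (fun x : R => x ^+ 2)); exact: adapted_X.
Qed.

(** Up to the boundary terms $G(X_n)-G(X_0)$, the centered sum of squares is a martingale [N] by the
    Poisson equation. Its increments are quadratic in the states and so have only moments of order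
    $3/2$; interpolating the two bounds on the potential gives $\mathbb
    E\sqrt{1+(N_n/n)^2}-1=O(n^{-1/2})$. The boundary terms are integrable uniformly in [n] and are
    divided by [n]. *)
Lemma square_average_lln (delta e0 : R) : 0 < delta -> 0 < e0 -> \forall n \near \oo,
  fine (P [set t | delta < `|(\sum_(j < n) (X j t)%:R ^+ 2) / n%:R - m2|]) <= e0.
Proof.
move=> delta0 e00.
have [B B0 HB] := chain_expect_bound model alpha01 X0_cube eps_cube.
have [G [_ Gquad poisson]] := step_poisson model alpha01 X0_cube eps_cube pi_stat 0 1.
have [C C0 GC] := Gquad erefl.
have m20 := pmf_moment_ge0 pi_stat 2.
have aGX k : adapted k (fun t => G (X k t)%:R) by apply: (adapted_comp G); exact: adapted_X.
have iGX k : integ (fun t => G (X k t)%:R).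
  apply: (chain_integrable model alpha01 X0_cube eps_cube (k := k) (C := C)) => // t.
  apply: (le_trans (GC _ _)) => //; apply: ler_wpM2l => //.
  by rewrite ler_weXn2l// lerDl.
(* Adding the increment of the Poisson solution to the centered square produces a martingale
   difference. *)
pose Z k t := (X k t)%:R ^+ 2 - m2 + G (X k.+1 t)%:R - G (X k t)%:R.
pose N k t := \sum_(j < k) Z j t.
have NE n t : N n t = \sum_(j < n) (X j t)%:R ^+ 2 - n%:R * m2 + G (X n t)%:R - G (X 0%N t)%:R.
  rewrite /N; elim: n => [|n IH]; first by rewrite !big_ord0 mul0r subr0 add0r subrr.
  rewrite !big_ord_recr /= IH /Z -[n.+1%:R]natr1; ring.
pose p k t : R := 1 + (X k t)%:R.
have p1 k t : 1 <= p k t by rewrite lerDl.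
pose C1 := 1 + m2 + C.
have C10 : 0 <= C1 by rewrite !addr_ge0.
have ZC k t : `|Z k t| <= C1 * (p k t + p k.+1 t) ^+ 2.
  have x0 : 0 <= (X k t)%:R :> R by []. have y0 : 0 <= (X k.+1 t)%:R :> R by [].
  have h1 := GC _ x0; have h2 := GC _ y0.
  have xp : (X k t)%:R ^+ 2 <= p k t ^+ 2 :> R by rewrite ler_pXn2r ?nnegrE ?addr_ge0// lerDr.
  exact: (increment_quadratic_bound (p1 k t) (p1 k.+1 t) m20 C0 (sqr_ge0 _) xp h1 h2).
have aN k : adapted k (N k).
  rewrite (_ : N k = fun t => \sum_(j < k) (X j t)%:R ^+ 2 - k%:R * m2 + G (X k t)%:R - G (X 0%N t)%:R); last by apply/funext => t; exact: NE.
  have aG0 : adapted k (fun t => G (X 0%N t)%:R).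
    by elim: k => [|k IH]; [exact: aGX|exact: adaptedS].
  apply: (adapted_op2 (fun x y => x - y)) => //.
  apply: (adapted_op2 +%R) => //.
  by apply: (adapted_comp (fun x : R => x - k%:R * m2)); exact: adapted_sum_sqr.
have iZ k : integ (Z k).
  have i2 : integ (fun t => (X k t)%:R ^+ 2 : R).
    apply: (chain_integrable model alpha01 X0_cube eps_cube (k := k) (C := 1)).
      by apply: (adapted_comp (fun x : R => x ^+ 2)); exact: adapted_X.
    move=> t; have x0 : 0 <= (X k t)%:R :> R by [].
    move: ((X k t)%:R : R) x0 => x x0.
    by rewrite mul1r ger0_norm ?sqr_ge0//; have := mulr_ge0 x0 (sqr_ge0 x); nra.
  have i0 : integ (fun=> m2) by exact: finite_measure_integrable_cst.
  have i20 : integ (fun t => (X k t)%:R ^+ 2 - m2) := integrableB measurableT i2 i0.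
  have i3 : integ (fun t => (X k t)%:R ^+ 2 - m2 + G (X k.+1 t)%:R) := integrableD measurableT i20 (iGX k.+1).
  exact: (integrableB measurableT i3 (iGX k)).
have iN k : integ (N k).
  elim: k => [|k IH].
    rewrite (_ : N 0%N = fun=> 0); first exact: finite_measure_integrable_cst.
    by apply/funext => t; rewrite /N big_ord0.
  rewrite (_ : N k.+1 = fun t => N k t + Z k t); first exact: (integrableD measurableT IH (iZ k)).
  by apply/funext => t; rewrite /N big_ord_recr.
have cZ0 k (r : R) : \int[P]_t (r * N k t / Num.sqrt (1 + (r * N k t) ^+ 2) * Z k t) = 0.
  pose c t := r * N k t / Num.sqrt (1 + (r * N k t) ^+ 2).
  have ac : adapted k c by apply: (adapted_comp (fun x : R => r * x / Num.sqrt (1 + (r * x) ^+ 2))).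
  have cB t : `|c t| <= 1 by exact: norm_sqrt1_slope_le1.
  have mc := adapted_measurable model ac.
  have H := poisson k c 1 ac cB.
  have icf f : integ f -> integ (fun t => c t * f t).
    move=> iff; have mf : measurable_fun setT f by apply/measurable_EFinP; exact: (measurable_int _ iff).
    apply: (@integrable_le _ _ _ P setT _ (fun t => `|f t|)) => //; first exact: measurable_funM.
      exact: (integrable_abse iff).
    by move=> t _; rewrite normrM ler_piMl.
  have iA : integ (fun t => (X k t)%:R ^+ 2 - m2).
    rewrite (_ : (fun t => _) = fun t => Z k t - G (X k.+1 t)%:R + G (X k t)%:R); last first.
      by apply/funext => t; rewrite /Z; ring.
    have i1 : integ (fun t => Z k t - G (X k.+1 t)%:R) := integrableB measurableT (iZ k) (iGX k.+1).
    exact: (integrableD measurableT i1 (iGX k)).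
  have jA := icf _ iA; have j1 := icf _ (iGX k.+1); have j0 := icf _ (iGX k).
  have jA1 : integ (fun t => c t * ((X k t)%:R ^+ 2 - m2) + c t * G (X k.+1 t)%:R) := integrableD measurableT jA j1.
  transitivity (\int[P]_t (c t * ((X k t)%:R ^+ 2 - m2) + c t * G (X k.+1 t)%:R - c t * G (X k t)%:R)).
    by apply: eq_Rintegral => t _; rewrite /Z /c; ring.
  rewrite RintegralB// RintegralD//.
  rewrite (_ : \int[P]_t (c t * ((X k t)%:R ^+ 2 - m2)) =
    \int[P]_t (c t * (0 * (X k t)%:R ^+ 3 + 1 * (X k t)%:R ^+ 2 - (0 * pmf_moment pi 3 + 1 * m2)))).
    by rewrite H; ring.
  by apply: eq_Rintegral => t _; rewrite !mul0r !mul1r !add0r.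
pose K := 4 * (C1 ^+ 2 / 2 + 2 * C1).
have K0 : 0 <= K by rewrite mulr_ge0// addr_ge0 ?mulr_ge0 ?sqr_ge0.
have drift (n k : nat) : (0 < n)%N ->
    \int[P]_t Num.sqrt (1 + (n%:R^-1 * N k.+1 t) ^+ 2) <=
    \int[P]_t Num.sqrt (1 + (n%:R^-1 * N k t) ^+ 2) + K * (2 * B) / (n%:R * Num.sqrt n%:R).
  move=> n0; pose r := n%:R^-1 : R; rewrite -/r.
  have nr0 : 0 < n%:R :> R by rewrite ltr0n.
  have sn0 : 0 < Num.sqrt n%:R :> R by rewrite sqrtr_gt0.
  have sn2 : Num.sqrt n%:R ^+ 2 = n%:R :> R by rewrite sqr_sqrtr// ltW.
  pose w := (n%:R * Num.sqrt n%:R)^-1 : R.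
  have w0 : 0 <= w by rewrite invr_ge0 mulr_ge0// ltW.
  have iS : integ (fun t => p k t ^+ 3 + p k.+1 t ^+ 3) := integrableD measurableT (int_cube k) (int_cube k.+1).
  have ih : integ (fun t => K * w * (p k t ^+ 3 + p k.+1 t ^+ 3)) := integrableZl measurableT (K * w) iS.
  rewrite (_ : N k.+1 = fun t => N k t + Z k t); last by apply/funext => t; rewrite /N big_ord_recr.
  apply: (le_trans (sqrt1_drift (iN k) (iZ k) ih (cZ0 k r) _)).
    move=> t; have := ZC k t; have := p1 k t; have := p1 k.+1 t.
    move: (p k t) (p k.+1 t) (Z k t) => a b z b1 a1 zC.
    have a0 : 0 <= a by exact: le_trans a1. have b0 : 0 <= b by exact: le_trans b1.
    (* In this scale $|rz|\le C_1y^2$. If $y\le1$ the quadratic bound gives $y^4\le y^3$; if $y>1$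
       the linear bound gives $y^2\le y^3$. Either way a cube remains, of order $n^{-3/2}$, and
       $(a+b)^3\le4(a^3+b^3)$ accounts for the $4$ in [K]. *)
    pose y := (a + b) / Num.sqrt n%:R.
    have y0 : 0 <= y by apply: divr_ge0; [exact: addr_ge0|exact: ltW].
    have rz : `|r * z| <= C1 * y ^+ 2.
      rewrite normrM /r ger0_norm ?invr_ge0 ?(ltW nr0)// ler_pdivrMl//; apply: (le_trans zC).
      by rewrite /y expr_div_n sn2 le_eqVlt; apply/orP; left; apply/eqP; field; rewrite gt_eqF.
    have cube : 4 * w * (a ^+ 3 + b ^+ 3) >= y ^+ 3.
      rewrite /y expr_div_n (_ : Num.sqrt n%:R ^+ 3 = n%:R * Num.sqrt n%:R); last by rewrite exprSr sn2.
      rewrite -/w (_ : 4 * w * (a ^+ 3 + b ^+ 3) = 4 * (a ^+ 3 + b ^+ 3) * w); last by ring.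
      apply: ler_wpM2r => //.
      by have := mulr_ge0 (addr_ge0 a0 b0) (sqr_ge0 (a - b)); nra.
    have goal3 : K * w * (a ^+ 3 + b ^+ 3) >= (C1 ^+ 2 / 2 + 2 * C1) * y ^+ 3.
      rewrite (_ : K * w * _ = (C1 ^+ 2 / 2 + 2 * C1) * (4 * w * (a ^+ 3 + b ^+ 3))); last by rewrite /K; ring.
      by apply: ler_wpM2l => //; rewrite addr_ge0 ?mulr_ge0 ?sqr_ge0.
    have y3 : 0 <= y ^+ 3 by exact: exprn_ge0.
    have [y1|y1] := leP y 1.
      left; apply: le_trans goal3.
      have h1 : (r * z) ^+ 2 <= (C1 * y ^+ 2) ^+ 2.
        by rewrite -real_normK ?num_real// ler_pXn2r ?nnegrE// mulr_ge0 ?sqr_ge0.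
      have h2 : (C1 * y ^+ 2) ^+ 2 <= C1 ^+ 2 * y ^+ 3.
        rewrite exprMn; apply: ler_wpM2l; first exact: sqr_ge0.
        by rewrite -exprM ler_wiXn2l.
      have := mulr_ge0 C10 y3; rewrite (mulrDl (C1 ^+ 2 / 2)); move: h1 h2; move: (y ^+ 3) => y'; lra.
    right; apply: le_trans goal3.
    have h1 : C1 * y ^+ 2 <= C1 * y ^+ 3.
      by apply: ler_wpM2l => //; rewrite ler_weXn2l// ltW.
    have := mulr_ge0 (sqr_ge0 C1) y3; rewrite (mulrDl (C1 ^+ 2 / 2)); move: h1 rz; move: (y ^+ 3) => y'; lra.
  apply: lerD => //; rewrite RintegralZl// -mulrA (mulrC w) mulrA; apply: ler_wpM2r => //.
  apply: ler_wpM2l => //; rewrite RintegralD ?int_cube//.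
  have E3 j : \int[P]_t (p j t ^+ 3) <= B.
    rewrite -[leRHS]mul1r; apply: (le_trans (ler_norm _)); apply: (HB j) => //.
      by apply: (adapted_comp (fun x : R => (1 + x) ^+ 3)); exact: adapted_X.
    by move=> t; rewrite mul1r ger0_norm// exprn_ge0// addr_ge0.
  by have := E3 k; have := E3 k.+1; lra.
have psi n : (0 < n)%N -> \int[P]_t Num.sqrt (1 + (n%:R^-1 * N n t) ^+ 2) <= 1 + K * (2 * B) / Num.sqrt n%:R.
  move=> n0.
  suff H k : \int[P]_t Num.sqrt (1 + (n%:R^-1 * N k t) ^+ 2) <= 1 + k%:R * (K * (2 * B) / (n%:R * Num.sqrt n%:R)).
    apply: (le_trans (H n)); rewrite lerD2l le_eqVlt; apply/orP; left; apply/eqP; field.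
    by rewrite !gt_eqF ?sqrtr_gt0 ?ltr0n.
  elim: k => [|k IH].
    rewrite mul0r addr0 (_ : (fun t => _) = fun=> 1); first by rewrite /Rintegral integral_probability_cst.
    by apply/funext => t; rewrite /N big_ord0 mulr0 expr0n /= addr0 sqrtr1.
  apply: (le_trans (drift n k n0)); rewrite (_ : k.+1%:R = k%:R + 1 :> R); last by rewrite natr1.
  by rewrite (mulrDl k%:R 1) mul1r addrA; exact: lerD.
(* The amount by which the potential exceeds its minimum $1$ when its argument is at least
   $\delta/2$ in absolute value. *)
pose delta' := Num.sqrt (1 + (delta / 2) ^+ 2) - 1.
have delta'0 : 0 < delta'.
  rewrite subr_gt0 -[ltLHS]sqrtr1 ltr_sqrt ?ltrDl ?exprn_gt0 ?divr_gt0//.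
  by rewrite ltr_wpDr ?exprn_ge0// divr_ge0// ltW.
pose Cst := delta'^-1 * (K * (2 * B)) + 2 / delta * (2 * (C * B)).
near=> n.
have n0 : (0 < n)%N by near: n; exact: nbhs_infty_gt.
have nr0 : 0 < n%:R :> R by rewrite ltr0n.
have sn1 : 1 <= Num.sqrt n%:R :> R by rewrite -[leLHS]sqrtr1 ler_sqrt// ler1n.
have sn0 : 0 < Num.sqrt n%:R :> R by exact: lt_le_trans sn1.
have small : Cst / Num.sqrt n%:R <= e0 by near: n; exact: inv_sqrt_small.
have irN : integ (fun t => n%:R^-1 * N n t) := integrableZl measurableT n%:R^-1 (iN n).
have i1 := integrable_sqrt1 irN.
have i0 : integ (fun=> 1 : R) by exact: finite_measure_integrable_cst.
have i2 : integ (fun t => Num.sqrt (1 + (n%:R^-1 * N n t) ^+ 2) - 1) := integrableB measurableT i1 i0.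
have i3 : integ (fun t => delta'^-1 * (Num.sqrt (1 + (n%:R^-1 * N n t) ^+ 2) - 1)) := integrableZl measurableT delta'^-1 i2.
have i4 : integ (fun t => `|G (X n t)%:R| + `|G (X 0%N t)%:R|) :=
  integrableD measurableT (integrable_abse (iGX n)) (integrable_abse (iGX 0%N)).
have i5 : integ (fun t => 2 / delta / n%:R * (`|G (X n t)%:R| + `|G (X 0%N t)%:R|)) := integrableZl measurableT (2 / delta / n%:R) i4.
apply: (@le_trans _ _ (\int[P]_t (delta'^-1 * (Num.sqrt (1 + (n%:R^-1 * N n t) ^+ 2) - 1) +
   2 / delta / n%:R * (`|G (X n t)%:R| + `|G (X 0%N t)%:R|)))).
  have ge1 t : 0 <= Num.sqrt (1 + (n%:R^-1 * N n t) ^+ 2) - 1.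
    by rewrite subr_ge0 -[leLHS]sqrtr1 ler_sqrt ?lerDl ?sqr_ge0// addr_ge0 ?sqr_ge0.
  have p3 t : 0 <= delta'^-1 * (Num.sqrt (1 + (n%:R^-1 * N n t) ^+ 2) - 1).
    by rewrite mulr_ge0// invr_ge0 ltW.
  have p4 t : 0 <= 2 / delta / n%:R * (`|G (X n t)%:R| + `|G (X 0%N t)%:R|).
    by rewrite mulr_ge0 ?addr_ge0// !divr_ge0// ltW.
  apply: markov_Rintegral.
  - apply: measurable_abs_gt; apply: (adapted_measurable model (k := n)).
    by apply: (adapted_comp (fun x : R => x / n%:R - m2)); exact: adapted_sum_sqr.
  - exact: (integrableD measurableT i3 i5).
  - by move=> t; rewrite addr_ge0.
  - move=> t /= dt.
    have [gs|gs] := ltP (delta / 2) `|n%:R^-1 * N n t|.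
      rewrite -[leLHS]addr0; apply: lerD => //.
      rewrite ler_pdivlMl// mulr1 /delta' lerD2r ler_sqrt ?lerD2l; last by rewrite addr_ge0 ?sqr_ge0.
      by rewrite -[leRHS]real_normK ?num_real// ler_pXn2r ?nnegrE ?divr_ge0// ltW.
    rewrite -[leLHS]add0r; apply: lerD => //.
    have E : (\sum_(j < n) (X j t)%:R ^+ 2) / n%:R - m2 = n%:R^-1 * N n t - n%:R^-1 * (G (X n t)%:R - G (X 0%N t)%:R).
      by rewrite NE; field; rewrite gt_eqF.
    have h : delta / 2 <= n%:R^-1 * (`|G (X n t)%:R| + `|G (X 0%N t)%:R|).
      apply: (@le_trans _ _ (`|n%:R^-1 * (G (X n t)%:R - G (X 0%N t)%:R)|)).
        move: dt gs; rewrite E => dt gs; have := ler_normB (n%:R^-1 * N n t) (n%:R^-1 * (G (X n t)%:R - G (X 0%N t)%:R)).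
        lra.
      have nV0 : 0 <= n%:R^-1 :> R by rewrite invr_ge0 ltW.
      rewrite normrM (ger0_norm nV0); apply: ler_wpM2l => //.
      exact: ler_normB.
    rewrite -(mulrA (2 / delta)).
    rewrite [leLHS](_ : 1 = 2 / delta * (delta / 2)); last by field; rewrite gt_eqF.
    by apply: ler_wpM2l => //; rewrite divr_ge0// ltW.
rewrite RintegralD// RintegralZl// RintegralB// [X in _ - X](_ : _ = 1); last by rewrite /Rintegral integral_probability_cst.
rewrite RintegralZl// RintegralD; [|by []|exact: (integrable_abse (iGX n))|exact: (integrable_abse (iGX 0%N))].
have EG k : \int[P]_t `|G (X k t)%:R| <= C * B.
  apply: (le_trans (ler_norm _)); apply: (HB k) => //.
    by apply: (adapted_comp (fun x : R => `|G x|)); exact: adapted_X.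
  move=> t; rewrite normr_id; apply: (le_trans (GC _ _)) => //; apply: ler_wpM2l => //.
  by rewrite ler_weXn2l// lerDl.
apply: le_trans small; rewrite /Cst (mulrDl (delta'^-1 * _)); apply: lerD.
  rewrite -(mulrA delta'^-1); apply: ler_wpM2l; first by rewrite invr_ge0 ltW.
  by have := psi n n0; lra.
rewrite -(mulrA (2 / delta)) -(mulrA (2 / delta)); apply: ler_wpM2l; first by rewrite divr_ge0// ltW.
rewrite mulrC; apply: ler_pM => //.
- by rewrite addr_ge0// Rintegral_ge0.
- by have := EG n; have := EG 0%N; lra.
- rewrite lef_pV2 ?posrE//.
  have : Num.sqrt n%:R ^+ 2 = n%:R :> R by rewrite sqr_sqrtr// ltW.
  by move: sn1; move: (Num.sqrt n%:R : R) => v v1 <-; nra.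
Unshelve. all: by end_near. Qed.

End SquareAverage.

(** * Deterministic analysis of the least squares problem *)

Section ProfileLeastSquares.
Context {R : realType}.
Variables (D E c0 c1 c2 : R).

(** The minimum over $\theta'$ of the two outlier terms of $Q_n$, for $\alpha'=x$, with
    $c_0=y_{s+1}-\mu$, $c_1=-\mu$ and $c_2=-y_{s-1}$. The contaminated value $y_s$ has cancelled. *)
Definition outlier_cost (x : R) := (c0 + c1 * x + c2 * x ^+ 2) ^+ 2 / (1 + x ^+ 2).
Definition profile_cost (x : R) := D * x ^+ 2 - 2 * x * E + outlier_cost x.

Local Notation G := outlier_cost.
Local Notation F := profile_cost.

Let w_gt0 (x : R) : 0 < 1 + x ^+ 2.
Proof. by rewrite ltr_pwDl// sqr_ge0. Qed.

Let G_ge0 (x : R) : 0 <= G x.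
Proof. by rewrite divr_ge0 ?sqr_ge0// ltW. Qed.

Variable C : R.
Hypotheses (c0C : `|c0 - c2| <= C) (c1C : `|c1| <= C) (c2C : `|c2| <= C).

Let C_ge0 : 0 <= C. Proof. exact: le_trans (normr_ge0 _) c1C. Qed.

(* The remainder [M] of [c0 + c1 x + c2 x^2] modulo [1 + x^2] contributes [M^2 / w] with
   [w = 1 + x^2], bounded below by [2 t M - t^2 w] for every [t], with equality at [t = M / w]. *)
Let G_tangent (m : R) : exists2 la, `|la| <= 12 * C ^+ 2 * (1 + `|m|) &
  forall x, G m + la * (x - m) - 12 * C ^+ 2 * (x - m) ^+ 2 <= G x.
Proof.
pose t := (c0 - c2 + c1 * m) / (1 + m ^+ 2).
have wm := w_gt0 m; have C0 := C_ge0.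
have tw : t * (1 + m ^+ 2) = c0 - c2 + c1 * m by rewrite mulfVK// gt_eqF.
have t2C : `|t| <= 2 * C.
  rewrite normrM normfV (gtr0_norm wm) ler_pdivrMr//.
  apply: (le_trans (ler_normD _ _)); rewrite normrM.
  have h1 := ler_wpM2r (normr_ge0 m) c1C.
  have h2 : 1 + `|m| <= 2 * (1 + m ^+ 2).
    by rewrite -(real_normK (num_real m)); have := sqr_ge0 (`|m| - 1); have := normr_ge0 m; nra.
  have := ler_wpM2l C0 h2; move: (m ^+ 2) (`|m|) h1 => m2 m' h1; have := c0C; lra.
have tt : t ^+ 2 <= 4 * C ^+ 2.
  rewrite -(real_normK (num_real t)); have : `|t| ^+ 2 <= (2 * C) ^+ 2 by rewrite ler_pXn2r ?nnegrE ?mulr_ge0.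
  by rewrite exprMn; lra.
have c22 : c2 ^+ 2 <= C ^+ 2 by rewrite -(real_normK (num_real c2)) ler_pXn2r ?nnegrE.
exists (2 * c2 ^+ 2 * m + 2 * c2 * c1 + 2 * t * c1 - 2 * t ^+ 2 * m).
  have n1 : `|2 * c2 ^+ 2 * m| <= 2 * C ^+ 2 * `|m|.
    by rewrite normrM; apply: ler_wpM2r => //; rewrite ger0_norm; [lra|by apply: mulr_ge0 => //; exact: sqr_ge0].
  have n2 : `|2 * c2 * c1| <= 2 * C ^+ 2.
    by rewrite -mulrA normrM (ger0_norm (ler0n R 2)) normrM expr2 ler_wpM2l// ler_pM.
  have n3 : `|2 * t * c1| <= 4 * C ^+ 2.
    rewrite -mulrA normrM (ger0_norm (ler0n R 2)) normrM.
    by have := ler_pM (normr_ge0 _) (normr_ge0 _) t2C c1C; rewrite expr2; lra.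
  have n4 : `|2 * t ^+ 2 * m| <= 8 * C ^+ 2 * `|m|.
    by rewrite normrM; apply: ler_wpM2r => //; rewrite ger0_norm; [lra|by apply: mulr_ge0 => //; exact: sqr_ge0].
  have := mulr_ge0 (sqr_ge0 C) (normr_ge0 m).
  have := sqr_ge0 C; rewrite mulrDr mulr1 -(mulrA 12).
  move: n1 n2 n3 n4; rewrite -!(mulrA _ (C ^+ 2)).
  move: (2 * c2 ^+ 2 * m) (2 * c2 * c1) (2 * t * c1) (2 * t ^+ 2 * m) (C ^+ 2 * `|m|) (C ^+ 2).
  move=> x1 x2 x3 x4 y z; rewrite !ler_norml => /andP[? ?] /andP[? ?] /andP[? ?] /andP[? ?] ? ?.
  by apply/andP; split; lra.
move=> x.
have GE y : G y = c2 ^+ 2 * (1 + y ^+ 2) + 2 * c2 * (c0 - c2 + c1 * y) + (c0 - c2 + c1 * y) ^+ 2 / (1 + y ^+ 2).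
  by rewrite /G; field; rewrite gt_eqF.
have Gm : G m = c2 ^+ 2 * (1 + m ^+ 2) + 2 * c2 * (c0 - c2 + c1 * m) + (2 * t * (c0 - c2 + c1 * m) - t ^+ 2 * (1 + m ^+ 2)).
  by rewrite GE; congr (_ + _); rewrite -tw; field; rewrite gt_eqF.
have Gx : c2 ^+ 2 * (1 + x ^+ 2) + 2 * c2 * (c0 - c2 + c1 * x) + (2 * t * (c0 - c2 + c1 * x) - t ^+ 2 * (1 + x ^+ 2)) <= G x.
  rewrite GE lerD2l -subr_ge0 [leRHS](_ : _ = ((c0 - c2 + c1 * x) - t * (1 + x ^+ 2)) ^+ 2 / (1 + x ^+ 2)).
    by rewrite divr_ge0 ?sqr_ge0// ltW.
  by field; rewrite gt_eqF.
apply: le_trans Gx; rewrite Gm.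
have h1 := mulr_ge0 (sqr_ge0 c2) (sqr_ge0 (x - m)).
have h2 := ler_wpM2r (sqr_ge0 (x - m)) tt.
have h3 := mulr_ge0 (sqr_ge0 C) (sqr_ge0 (x - m)).
rewrite -subr_ge0.
rewrite [leRHS](_ : _ = c2 ^+ 2 * (x - m) ^+ 2 - t ^+ 2 * (x - m) ^+ 2 + 12 * (C ^+ 2 * (x - m) ^+ 2)); last by ring.
by move: h1 h2 h3; rewrite -(mulrA 4); move: (c2 ^+ 2 * _) (t ^+ 2 * _) (C ^+ 2 * _) => a b c; lra.
Qed.

Hypothesis D_large : 12 * C ^+ 2 < D.

Let D_gt0 : 0 < D.
Proof. by apply: le_lt_trans D_large; rewrite mulr_ge0 ?sqr_ge0. Qed.

(** At the midpoint of two minimizers [outlier_cost] has a supporting parabola of curvature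
    coefficient $-12C^2$. The term $Dx^2$ outweighs it, so the midpoint would do strictly better
    unless the two points agree. *)
Lemma profile_min_unique x y : (forall z, F x <= F z) -> (forall z, F y <= F z) -> x = y.
Proof.
move=> mx my; pose m := (x + y) / 2.
have [la _ H] := G_tangent m.
have := mx m; have := my m; have := H x; have := H y; rewrite /F.
rewrite (_ : y - m = - (x - m)); last by rewrite /m; field.
have -> : y = m - (x - m) by rewrite /m; field.
have -> : x - m = x - m by [].
move: (G x) (G _) (G m) => gx gy gm; have := D_large.
move=> Dl h1 h2 h3 h4.
have h : (D - 12 * C ^+ 2) * (x - m) ^+ 2 <= 0 by nra.
have : (x - m) ^+ 2 == 0 by rewrite eq_le sqr_ge0 andbT; rewrite pmulr_rle0 ?subr_gt0 in h.
by rewrite sqrf_eq0 subr_eq0 => /eqP xm; rewrite xm subrr subr0.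
Qed.

Lemma profile_min_exists : exists x, forall z, F x <= F z.
Proof.
have D0 := D_gt0.
(* Beyond this radius the quadratic term alone exceeds the linear one plus the value at $0$, since
   [outlier_cost] is nonnegative; the minimum over the compact interval is then global. *)
pose B := (2 * `|E| + G 0 + 1) / D + 1.
have G00 := G_ge0 0.
have B1 : 1 <= B by rewrite lerDr; apply: divr_ge0; [have := normr_ge0 E; lra|exact: ltW].
have cF : continuous F.
  move=> x; apply: cvgD.
    apply: cvgB; first by apply: cvgM; [exact: cvg_cst|exact: exprn_continuous].
    by apply: cvgM; [apply: cvgM; [exact: cvg_cst|exact: cvg_id]|exact: cvg_cst].
  apply: cvgM.
    apply: (@continuous_comp _ _ _ (fun x => c0 + c1 * x + c2 * x ^+ 2) (fun y : R => y ^+ 2)); last exact: exprn_continuous.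
    apply: cvgD; first by apply: cvgD; [exact: cvg_cst|apply: cvgM; [exact: cvg_cst|exact: cvg_id]].
    by apply: cvgM; [exact: cvg_cst|exact: exprn_continuous].
  apply: cvgV; first by rewrite gt_eqF.
  by apply: cvgD; [exact: cvg_cst|exact: exprn_continuous].
have BB : - B <= B by lra.
have [c cB Hc] := EVT_min BB (continuous_subspaceT cF).
exists c => z; have [zB|zB] := boolP (z \in `[(- B), B]); first exact: Hc.
have h0 : F c <= F 0 by apply: Hc; rewrite in_itv /=; apply/andP; split; lra.
apply: (le_trans h0); have := G_ge0 z; rewrite /F expr0n /= mulr0 mulr0 mul0r subr0 add0r => Gz.
have zB' : B <= `|z|.
  by move: zB; rewrite in_itv /= -ler_norml -ltNge => /ltW.
have DB : 2 * `|E| + G 0 + 1 <= D * `|z|.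
  apply: (@le_trans _ _ (D * B)); last by rewrite ler_pM2l.
  by rewrite /B mulrDr mulrCA divff ?gt_eqF// !mulr1; lra.
have zE : 2 * z * E <= 2 * `|z| * `|E|.
  by rewrite -!mulrA ler_pM2l// (le_trans (ler_norm _))// normrM.
rewrite -(real_normK (num_real z)) in Gz *.
have z1 : 1 <= `|z| by exact: le_trans zB'.
have : (2 * `|E| + G 0 + 1) * `|z| <= D * `|z| * `|z| by rewrite ler_wpM2r.
have := ler_wpM2l G00 z1.
move: (G 0) (G z) (`|z|) (`|E|) (2 * z * E) zE Gz z1 G00 => g0 gz z' E' ze zE Gz z1 G00; nra.
Qed.

(** $E/D$ is the vertex of the quadratic part. Comparing the minimizer with it, through the
    supporting parabola there, bounds the displacement by the slope of [outlier_cost] over the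
    remaining curvature. *)
Lemma profile_min_dist x : (forall z, F x <= F z) ->
  `|x - E / D| * (D - 12 * C ^+ 2) <= 12 * C ^+ 2 * (1 + `|E / D|).
Proof.
move=> mx; have D0 := D_gt0.
have [la laC H] := G_tangent (E / D).
have h1 := mx (E / D); have h2 := H x; set y := x - E / D in h2 *.
have h3 : (D - 12 * C ^+ 2) * y ^+ 2 <= - la * y.
  have e1 : F x - F (E / D) = D * y ^+ 2 + G x - G (E / D) by rewrite /F /y; field; rewrite gt_eqF.
  by move: h1 h2; rewrite -subr_le0 e1; move: (G x) (G _) (y ^+ 2) (C ^+ 2) => *; lra.
have [->|y0] := eqVneq y 0; first by rewrite normr0 mul0r mulr_ge0 ?addr_ge0// mulr_ge0// sqr_ge0.
apply: le_trans laC; rewrite -(ler_pM2r (_ : 0 < `|y|)) ?normr_gt0//.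
rewrite mulrAC -expr2 real_normK ?num_real// mulrC; apply: (le_trans h3).
by apply: (le_trans (ler_norm _)); rewrite normrM normrN.
Qed.
End ProfileLeastSquares.

Section LeastSquaresEstimator.
Context {R : realType}.
Variables (mu : R) (s n : nat) (y : nat -> R).
Hypothesis s_gt0 : (0 < s)%N.

Definition outlier_free_index k := (k != s) && (k != s.+1).

Local Notation D := (\sum_(1 <= k < n.+1 | outlier_free_index k) y k.-1 ^+ 2).
Local Notation E := (\sum_(1 <= k < n.+1 | outlier_free_index k) y k.-1 * (y k - mu)).
Local Notation base := (\sum_(1 <= k < n.+1 | outlier_free_index k) (y k - mu) ^+ 2).
Local Notation c0 := (y s.+1 - mu).
Local Notation c1 := (- mu).
Local Notation c2 := (- y s.-1).

(** The minimizing $\theta'$ for a given $\alpha'=a$; at $a=\alpha$ it is the centering in the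
    theorem. *)
Definition theta_hat (a : R) :=
  y s - a / (1 + a ^+ 2) * (y s.-1 + y s.+1) - (1 - a) / (1 + a ^+ 2) * mu.

Let w_gt0 (x : R) : 0 < 1 + x ^+ 2.
Proof. by rewrite ltr_pwDl// sqr_ge0. Qed.

Lemma Qn_profile a th : Qn mu s n y a th =
  \sum_(1 <= k < n.+1 | outlier_free_index k) (y k - mu) ^+ 2 +
  profile_cost D E c0 c1 c2 a + (1 + a ^+ 2) * (th - theta_hat a) ^+ 2.
Proof.
rewrite /Qn /profile_cost /outlier_cost /theta_hat.
have -> : \sum_(1 <= k < n.+1 | outlier_free_index k) (y k - a * y k.-1 - mu) ^+ 2 =
  \sum_(1 <= k < n.+1 | outlier_free_index k) (y k - mu) ^+ 2 + (D * a ^+ 2 - 2 * a * E).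
  rewrite mulr_suml mulr_sumr -sumrB -big_split /=; apply: eq_bigr => k _; ring.
by field; rewrite gt_eqF.
Qed.

(** By [Qn_profile], $Q_n$ is a constant plus the profile cost plus a square that vanishes only on
    the graph of [theta_hat]. When $D$ is large the global minimizer is therefore unique and the
    default value in [CLS_est] is not taken. *)
Lemma CLS_est_profile : let C := `|y s.-1| + `|y s.+1| + `|mu| in
  12 * C ^+ 2 < D ->
  (CLS_est mu s n y).2 = theta_hat (CLS_est mu s n y).1 /\
  `|(CLS_est mu s n y).1 - E / D| * (D - 12 * C ^+ 2) <= 12 * C ^+ 2 * (1 + `|E / D|).
Proof.
move=> C DC.
have C0 : `|c0 - c2| <= C.
  rewrite opprK; apply: (le_trans (ler_normD _ _)); apply: (le_trans (lerD (ler_normB _ _) (lexx _))).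
  by rewrite /C; lra.
have C1 : `|c1| <= C by rewrite normrN /C lerDr addr_ge0.
have C2 : `|c2| <= C by rewrite normrN /C -addrA lerDl addr_ge0.
have [a Ha] := profile_min_exists E c0 c1 c2 DC.
have Hmin : [set p : R * R | forall q : R * R, Qn mu s n y p.1 p.2 <= Qn mu s n y q.1 q.2] = [set (a, theta_hat a)].
  apply/seteqP; split => [[a' th] /= H|_ -> [x th] /=]; last first.
    rewrite !Qn_profile -!(addrA base) lerD2l /= subrr expr0n /= mulr0; apply: lerD; first exact: Ha.
    by rewrite mulr_ge0 ?sqr_ge0// ltW.
  have Ha' z : profile_cost D E c0 c1 c2 a' <= profile_cost D E c0 c1 c2 z.
    have := H (z, theta_hat z); rewrite !Qn_profile -!(addrA base) lerD2l /= subrr expr0n /= mulr0 addr0.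
    by apply: le_trans; rewrite lerDl mulr_ge0 ?sqr_ge0// ltW.
  have aa := profile_min_unique C0 C1 C2 DC Ha Ha'; subst a'.
  have := H (a, theta_hat a); rewrite !Qn_profile -!(addrA base) !lerD2l /= subrr expr0n /= mulr0.
  rewrite pmulr_rle0// => h.
  have : (th - theta_hat a) ^+ 2 == 0 by rewrite eq_le sqr_ge0 andbT.
  by rewrite sqrf_eq0 subr_eq0 => /eqP ->.
have -> : CLS_est mu s n y = (a, theta_hat a).
  rewrite /CLS_est Hmin; case: pselect => [ex|nex]; last by case: nex; exists (a, theta_hat a); split => [//|p /= ->].
  exact: xget_unique.
split => //; exact: (profile_min_dist C0 C1 C2 DC Ha).
Qed.

End LeastSquaresEstimator.

(** The bound involves [s.+1] because [Qn] reads $y_{s+1}$ even when $n\le s$. *)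
Lemma CLS_est_ext (R : realType) (mu : R) s n (y z : nat -> R) :
  (forall k, (k <= maxn n s.+1)%N -> y k = z k) -> CLS_est mu s n y = CLS_est mu s n z.
Proof.
move=> yz; suff E : Qn mu s n y = Qn mu s n z by rewrite /CLS_est E.
apply/funext => a; apply/funext => th; rewrite /Qn.
have sn : (s <= maxn n s.+1)%N by rewrite leq_max leqnSn orbT.
rewrite (yz s)// (yz s.-1) ?(leq_trans (leq_pred s) sn)// (yz s.+1) ?leq_maxr//.
congr (_ + _ + _).
rewrite big_nat_cond [RHS]big_nat_cond; apply: eq_bigr => k /andP[/andP[k0 kn] _].
have {}kn : (k <= maxn n s.+1)%N by rewrite leq_max -ltnS kn.
by rewrite (yz k)// (yz k.-1)// (leq_trans (leq_pred k) kn).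
Qed.

(** * Slutsky's argument and linearization of the estimators *)

Section Slutsky.
Context {R : realType} {d : measure_display} {T : measurableType d}.
Variable P : probability T R.
Local Notation integ f := (P.-integrable setT (EFin \o f)).

(** The difference tends to zero in probability. The exceptional event is only required to exist, so
    that a union of several bad events can be supplied directly. *)
Definition close_in_probability (Z Z' : nat -> T -> R) :=
  forall e1 e2 : R, 0 < e1 -> 0 < e2 -> \forall n \near \oo,
  exists B, [/\ measurable B, fine (P B) <= e2 & forall t, ~ B t -> `|Z n t - Z' n t| <= e1].

Definition tight (Z : nat -> T -> R) := forall e0 : R, 0 < e0 ->
  exists M, \forall n \near \oo, fine (P [set t | M < `|Z n t|]) <= e0.

Variables Z Z' : nat -> T -> R.
Hypothesis mZ : forall n, measurable_fun setT (Z n).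
Hypothesis mZ' : forall n, measurable_fun setT (Z' n).
Hypothesis ZZ' : close_in_probability Z Z'.

Lemma close_tight : tight Z' -> tight Z.
Proof.
move=> tZ' e0 e00; have e20 : 0 < e0 / 2 by rewrite divr_gt0.
have [M HM] := tZ' _ e20; exists (M + 1).
have H := ZZ' ltr01 e20.
near=> n.
have hM : fine (P [set t | M < `|Z' n t|]) <= e0 / 2 by near: n.
have [B [mB PB HB]] : exists B, [/\ measurable B, fine (P B) <= e0 / 2 & forall t, ~ B t -> `|Z n t - Z' n t| <= 1].
  by near: n.
have mM : measurable [set t | M < `|Z' n t|] by exact: measurable_abs_gt.
apply: (@le_trans _ _ (fine (P ([set t | M < `|Z' n t|] `|` B)))).
  apply: fine_probability_le; [exact: measurable_abs_gt|exact: measurableU|].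
  move=> t /= tM; have [|nB] := pselect (B t); [by right|left].
  have := HB _ nB; have := ler_normD (Z n t - Z' n t) (Z' n t); rewrite subrK; lra.
by apply: (le_trans (fine_probabilityU_le _ mM mB)); lra.
Unshelve. all: by end_near. Qed.

(** Off the exceptional event the cosine is Lipschitz, on it the difference is at most $2$. With
    [close_tight] this transfers both inputs of [levy_criterion]. *)
Lemma close_cos (A : T -> R) (u b l : R) : measurable_fun setT A -> (forall t, 0 <= A t <= 1) ->
  \int[P]_t (A t * cos (u * Z' n t + b)) @[n --> \oo] --> l ->
  \int[P]_t (A t * cos (u * Z n t + b)) @[n --> \oo] --> l.
Proof.
move=> mA A01 cZ'; apply/cvgrPdist_le => e0 e00.
have e30 : 0 < e0 / 4 by rewrite divr_gt0.
pose e1 := e0 / 4 / (1 + `|u|).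
have u1 : 0 < 1 + `|u| by rewrite ltr_pwDl.
have e10 : 0 < e1 by rewrite divr_gt0.
have ue1 : `|u| * e1 <= e0 / 4.
  by rewrite /e1 mulrA ler_pdivrMr// mulrC ler_pM2l// lerDr.
have H := ZZ' e10 e30; have /cvgrPdist_le/(_ _ e30) H' := cZ'.
have icos (W : T -> R) : measurable_fun setT W -> integ (fun t => A t * cos (u * W t + b)).
  move=> mW; apply: (@integrable_bounded _ _ _ P setT _ 1) => //.
    apply: measurable_funM => //; apply: (@measurableT_comp _ _ _ _ _ _ (@cos R) _ (fun t => u * W t + b)).
      by apply: continuous_measurable_fun; exact: continuous_cos.
    by apply: measurable_funD => //; exact: measurable_funM.
  move=> t; have /andP[h0 h1] := A01 t.
  by rewrite normrM -[leRHS]mul1r ler_pM// ?norm_cos_le1// ger0_norm.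
near=> n.
have h1 : `|l - \int[P]_t (A t * cos (u * Z' n t + b))| <= e0 / 4 by near: n.
have [B [mB PB HB]] : exists B, [/\ measurable B, fine (P B) <= e0 / 4 & forall t, ~ B t -> `|Z n t - Z' n t| <= e1].
  by near: n.
have iB : integ (\1_B : T -> R).
  by apply: (@integrable_bounded _ _ _ P setT _ 1) => // t; rewrite ger0_norm// indicE; case: (_ \in _).
have i2B : integ (fun t => 2 * \1_B t) := integrableZl measurableT 2 iB.
have ie : integ (fun=> `|u| * e1) by exact: finite_measure_integrable_cst.
have h2 : `|\int[P]_t (A t * cos (u * Z' n t + b)) - \int[P]_t (A t * cos (u * Z n t + b))| <= `|u| * e1 + 2 * fine (P B).
  have EB : \int[P]_t (\1_B t) = fine (P B) by rewrite /Rintegral (integral_indic P measurableT mB) setIT.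
  rewrite -RintegralB ?icos//.
  apply: (@le_trans _ _ (\int[P]_t (`|u| * e1 + 2 * \1_B t))).
    apply: le_norm_Rintegral; [exact: (integrableB measurableT (icos _ (mZ' n)) (icos _ (mZ n)))|exact: (integrableD measurableT ie i2B)|].
    move=> t; have /andP[a0 a1] := A01 t.
    rewrite -mulrBr normrM (ger0_norm a0); apply: (@le_trans _ _ `|cos (u * Z' n t + b) - cos (u * Z n t + b)|).
      by rewrite ler_piMl.
    have [tB|tB] := pselect (B t).
      rewrite indicE mem_set// mulr1; apply: (@le_trans _ _ 2); last by rewrite lerDr mulr_ge0// ltW.
      apply: (le_trans (ler_normB _ _)).
      by have := norm_cos_le1 (u * Z' n t + b); have := norm_cos_le1 (u * Z n t + b); lra.
    rewrite indicE memNset// mulr0 addr0 distrC.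
    have := cos_lipschitz (u * Z' n t + b) (u * (Z n t - Z' n t)).
    rewrite (_ : u * Z' n t + b + u * (Z n t - Z' n t) = u * Z n t + b); last by ring.
    by move/le_trans; apply; rewrite normrM ler_wpM2l// HB.
  have E2 : \int[P]_t (2 * \1_B t) = 2 * fine (P B) by rewrite -EB; exact: RintegralZl.
  rewrite RintegralD// E2.
  by rewrite lerD2r /Rintegral integral_probability_cst.
have := ler_distD (\int[P]_t (A t * cos (u * Z' n t + b))) l (\int[P]_t (A t * cos (u * Z n t + b))).
lra.
Unshelve. all: by end_near. Qed.

End Slutsky.

(* [D (ahat - alpha) = S]: replacing the minimizer [a] by [ahat] and [D / n] by its limit [m] both cost little. *)
Lemma estimator_linearization (R : realType) (n a ahat alpha D S K M m eta e1 : R) :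
  0 < n -> 0 < m -> 0 <= K -> 0 <= M -> `|alpha| <= 1 ->
  ahat - alpha = S / D ->
  `|a - ahat| * (D - K) <= K * (1 + `|ahat|) ->
  `|D / n - m| <= eta -> eta <= m / 2 ->
  `|S / Num.sqrt n| <= M ->
  4 * K <= n * m ->
  1 <= n -> 2 * M * eta <= e1 / 2 * m ^+ 2 -> 8 * K * (1 + M / m) / m / Num.sqrt n <= e1 / 2 ->
  `|Num.sqrt n * (a - alpha) - S / Num.sqrt n / m| <= e1.
Proof.
move=> n0 m0 K0 M0 al1 ahE aK Dm eta2 SM Kn n1 Me Ke.
have r1 : 1 <= Num.sqrt n by rewrite -[leLHS]sqrtr1 ler_sqrt// ltW.
have r2 : Num.sqrt n ^+ 2 = n by rewrite sqr_sqrtr// ltW.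
move: (Num.sqrt n) r1 r2 SM Ke => r r1 r2 SM Ke.
have r0 : 0 < r by exact: lt_le_trans r1.
have Dn : n * m / 2 <= D.
  have : m / 2 <= D / n by move: Dm; rewrite ler_norml => /andP[h _]; lra.
  by rewrite ler_pdivlMr// => h; move: h; rewrite mulrC mulrA.
have D0 : 0 < D by apply: lt_le_trans Dn; rewrite divr_gt0// mulr_gt0.
pose U := S / r.
have SE : S = U * r by rewrite /U mulfVK// gt_eqF.
have U1 : `|U| <= M by [].
have ah1 : `|ahat| <= 1 + 2 * (M / m).
  rewrite (_ : ahat = alpha + S / D); last by rewrite -ahE addrC subrK.
  apply: (le_trans (ler_normD _ _)); apply: lerD => //.
  rewrite SE normrM normrM normfV (gtr0_norm r0) (gtr0_norm D0) ler_pdivrMr//.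
  apply: (@le_trans _ _ (2 * (M / m) * (n * m / 2))); last by apply: ler_wpM2l => //; rewrite mulr_ge0// divr_ge0// ltW.
  rewrite (_ : 2 * (M / m) * (n * m / 2) = M * n); last by field; rewrite gt_eqF.
  by apply: ler_pM => //; [exact: ltW|rewrite -r2 expr2 ler_peMr// ltW].
have DK : n * m / 4 <= D - K by lra.
have t1 : `|r * (a - ahat)| <= e1 / 2.
  apply: le_trans Ke; rewrite normrM (gtr0_norm r0).
  have nm : 0 < n * m / 4 by rewrite divr_gt0// mulr_gt0.
  have h : `|a - ahat| * (n * m / 4) <= K * (2 + 2 * (M / m)).
    apply: (@le_trans _ _ (`|a - ahat| * (D - K))); first exact: ler_wpM2l.
    by apply: (le_trans aK); apply: ler_wpM2l => //; lra.
  rewrite -ler_pdivlMr// in h; apply: (le_trans (ler_wpM2l (ltW r0) h)).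
  rewrite le_eqVlt; apply/orP; left; apply/eqP; rewrite -r2; field.
  by rewrite !gt_eqF.
have t2 : `|U * (n / D - m^-1)| <= e1 / 2.
  rewrite (_ : n / D - m^-1 = (m - D / n) * (n / (D * m))); last first.
    by field; rewrite !gt_eqF.
  rewrite (normrM U) (normrM (m - D / n)) (distrC m).
  have nDm : 0 <= n / (D * m) by apply: divr_ge0; [exact: ltW|apply: mulr_ge0; exact: ltW].
  rewrite (ger0_norm nDm).
  have h1 : n / (D * m) <= 2 / m ^+ 2.
    rewrite ler_pdivrMr ?mulr_gt0// mulrAC ler_pdivlMr ?exprn_gt0//.
    by have := ler_wpM2r (ltW m0) Dn; rewrite expr2; lra.
  have eta0 : 0 <= eta by exact: le_trans Dm.
  apply: (@le_trans _ _ (M * (eta * (2 / m ^+ 2)))); last first.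
    by rewrite (_ : M * _ = 2 * M * eta / m ^+ 2) ?ler_pdivrMr ?exprn_gt0//; ring.
  apply: ler_pM => //; [by rewrite mulr_ge0|exact: ler_pM].
rewrite (_ : r * (a - alpha) - S / r / m = r * (a - ahat) + U * (n / D - m^-1)); last first.
  rewrite (_ : a - alpha = (a - ahat) + S / D); last by rewrite -ahE; ring.
  by rewrite /U -r2; field; rewrite !gt_eqF.
by apply: (le_trans (ler_normD _ _)); lra.
Qed.

(** An exact identity: the remainder is $(a-\alpha)^2$ times a rational function of $a$, with a
    linear numerator over a multiple of $1+a^2$. It is bounded on the whole line, so [L] is uniform
    in [a]. *)
Lemma theta_hat_taylor (R : realType) (mu : R) s (y : nat -> R) (alpha : R) :
  exists2 L, 0 <= L & forall a,
  `|theta_hat mu s y a - theta_hat mu s y alpha -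
    ((alpha ^+ 2 - 1) * (y s.-1 + y s.+1) + (1 + 2 * alpha - alpha ^+ 2) * mu) / (1 + alpha ^+ 2) ^+ 2 * (a - alpha)|
  <= L * (a - alpha) ^+ 2.
Proof.
rewrite /theta_hat; move: (y s.-1 + y s.+1) (y s) => m y0.
have w0 (x : R) : 1 <= 1 + x ^+ 2 by rewrite lerDl sqr_ge0.
pose N0 := mu + alpha * (m - mu).
pose N1 := (m - mu) * (1 + alpha ^+ 2) - 2 * alpha * N0.
exists (`|N0 * (1 + alpha ^+ 2)| + `|N1| * (`|alpha| + 1)); first by rewrite addr_ge0// mulr_ge0// addr_ge0.
move=> a; have wa := w0 a; have wal := w0 alpha.
have wa0 : 0 < 1 + a ^+ 2 by exact: lt_le_trans wa.
have wal0 : 0 < 1 + alpha ^+ 2 by exact: lt_le_trans wal.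
rewrite (_ : _ - _ = (N0 * (1 + alpha ^+ 2) + N1 * (alpha + a)) / ((1 + a ^+ 2) * (1 + alpha ^+ 2) ^+ 2) * (a - alpha) ^+ 2); last first.
  by rewrite /N1 /N0; field; rewrite !gt_eqF.
rewrite normrM (ger0_norm (sqr_ge0 (a - alpha))); apply: ler_wpM2r; first exact: sqr_ge0.
have w2 : 1 <= (1 + alpha ^+ 2) ^+ 2 by rewrite exprn_ege1.
have ww : 1 + a ^+ 2 <= (1 + a ^+ 2) * (1 + alpha ^+ 2) ^+ 2 by rewrite ler_peMr// ltW.
have ww0 : 0 < (1 + a ^+ 2) * (1 + alpha ^+ 2) ^+ 2 by exact: lt_le_trans ww.
rewrite normrM normfV (gtr0_norm ww0) ler_pdivrMr//.
have L0 : 0 <= `|N0 * (1 + alpha ^+ 2)| + `|N1| * (`|alpha| + 1).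
  by rewrite addr_ge0// mulr_ge0// addr_ge0.
apply: (le_trans _ (ler_wpM2l L0 ww)); apply: (le_trans (ler_normD _ _)).
rewrite (mulrDl `|N0 * _|); apply: lerD; first by rewrite ler_peMr.
rewrite (normrM N1) -(mulrA `|N1|); apply: ler_wpM2l => //; apply: (le_trans (ler_normD _ _)).
rewrite -(real_normK (num_real a)); have := normr_ge0 a; have := normr_ge0 alpha.
move: (`|a|) (`|alpha|) => p r r0 p0; have := mulr_ge0 r0 (sqr_ge0 p); have := sqr_ge0 (p - 1); nra.
Qed.

(** * Limit laws of the two estimators *)

Section OutlierEstimator.
Context {R : realType} {d : measure_display} {T : measurableType d}.
Variables (P : probability T R) (alpha : R) (X0 : T -> nat) (eps : nat -> T -> nat)
  (xi : nat -> nat -> T -> bool) (pi : nat -> R).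
Hypothesis model : inar_model P alpha X0 eps xi.
Hypothesis alpha01 : 0 < alpha < 1.
Hypothesis X0_cube : (expect_pow P X0 3 < +oo)%E.
Hypothesis eps_cube : (expect_pow P (eps 1%N) 3 < +oo)%E.

Local Notation X := (inar_X X0 eps xi).
Local Notation hist := (hist X0 eps xi).
Local Notation q := (fun m => fine (P [set t | eps 1%N t = m])).
Local Notation kernel := (transop alpha q).
Local Notation e k := (fine (expect_pow P (eps 1%N) k)).
Local Notation mu := (e 1).
Local Notation s2 := (e 2 - mu ^+ 2).
Local Notation adapted := (adapted X0 eps xi).
Hypothesis pi_stat : is_stationary alpha q pi.
Hypothesis eps_nonzero : (0 < P [set t | eps 1%N t <> 0%N])%E.
Variables (s theta : nat).
Hypothesis s_gt0 : (0 < s)%N.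
Local Notation innov k t := ((X k.+1 t)%:R - alpha * (X k t)%:R - mu).
Local Notation V := (alpha * (1 - alpha) * pmf_moment pi 3 + s2 * pmf_moment pi 2).
Local Notation m2 := (pmf_moment pi 2).
Local Notation integ f := (P.-integrable setT (EFin \o f)).
Local Notation Y := (inar_Y X s theta : nat -> T -> R).
Local Notation est n t := (CLS_est mu s n (fun k => Y k t)).
Local Notation free := (outlier_free_index s).

(** In the stationary second moment equation all terms are nonnegative and one of them is the second
    moment of the innovation, positive because the innovation is not almost surely zero. *)
Let m2_gt0 : 0 < m2.
Proof.
have q_ge0 m : 0 <= q m by rewrite fine_ge0.
have e_ge0 k : 0 <= e k by rewrite fine_ge0// integral_ge0// => t _; rewrite lee_fin exprn_ge0.
have me m : measurable [set t | eps 1%N t = m] by case: model => /(_ (Some (inl 1%N)) m isT).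
have e2_gt0 : 0 < e 2.
  have iE : integ (fun t => (eps 1%N t)%:R ^+ 2).
    apply/integrableP; split.
      apply/measurable_EFinP; apply: (@measurableT_comp _ _ _ _ _ _ (fun j : nat => j%:R ^+ 2 : R)) => //.
      move=> _ B _; rewrite setTI (_ : _ @^-1` B = \bigcup_(j in B) [set t | eps 1%N t = j]).
        by apply: bigcup_measurable => j _; exact: me.
      by apply/seteqP; split => [t Bt|t [j Bj /= ->]//]; exists (eps 1%N t).
    have h2 := eps_moment2 model eps_cube.
    under eq_integral => t _ do rewrite /= ger0_norm ?sqr_ge0//.
    rewrite (@integral_nat_valued _ _ _ P (eps 1%N) (fun j => (j%:R ^+ 2)%:E) me); last first.
      by move=> j; rewrite lee_fin sqr_ge0.
    apply: (@le_lt_trans _ _ (e 2)%:E); last exact: ltry.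
    rewrite -h2 le_eqVlt; apply/orP; left; apply/eqP; apply: eq_eseriesr => j _.
    by rewrite (EFinM (j%:R ^+ 2)) fineK// fin_num_measure.
  have -> : e 2 = \int[P]_t ((eps 1%N t)%:R ^+ 2) by [].
  have mN : measurable [set t | eps 1%N t <> 0%N].
    by rewrite (_ : [set t | _] = ~` [set t | eps 1%N t = 0%N])//; exact: measurableC.
  apply: (@lt_le_trans _ _ (fine (P [set t | eps 1%N t <> 0%N]))).
    by rewrite fine_gt0// eps_nonzero/= ltey_eq fin_num_measure.
  apply: markov_Rintegral => // t /= /eqP t0.
  by rewrite -natrX ler1n expn_gt0 lt0n t0.
have [_ mE _] := stationary_moment_eqs alpha01 q_ge0 (eps_moment0 model eps_cube)
  (eps_moment1 model eps_cube) (eps_moment2 model eps_cube) (eps_moment3 model eps_cube) pi_stat.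
have /andP[a0 a1] := alpha01.
have m1 := pmf_moment_ge0 pi_stat 1; have m20 := pmf_moment_ge0 pi_stat 2.
rewrite lt_def m20 andbT; apply/eqP => m2E; move: mE; rewrite m2E mulr0 add0r.
have qq : 0 <= (alpha * (1 - alpha) + 2 * alpha * mu) * pmf_moment pi 1.
  by apply: mulr_ge0 => //; rewrite addr_ge0// ?mulr_ge0// ?subr_ge0 ltW.
rewrite /moment2_lin; move: qq e2_gt0; move: (_ * pmf_moment pi 1) (e 2) => a b h1 h2 h3; lra.
Qed.

(** The sums run over $j=k-1$ and skip $k=s$ and $k=s+1$, the only terms involving $Y_s$; on the
    others $Y$ coincides with $X$. Since $E=\alpha D+S$, the ratio $E/D$ differs from $\alpha$ by
    $S/D$. *)
Let S n t : R := \sum_(j < n | free j.+1) (X j t)%:R * innov j t.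
Let D n t : R := \sum_(j < n | free j.+1) (X j t)%:R ^+ 2.

Let free_Y j t : free j.+1 -> Y j t = (X j t)%:R /\ Y j.+1 t = (X j.+1 t)%:R.
Proof.
by rewrite /outlier_free_index eqSS => /andP[/negbTE h1 /negbTE h2]; rewrite /inar_Y h1 h2 !addr0.
Qed.

Let sum_sqrE n t : \sum_(1 <= k < n.+1 | free k) Y k.-1 t ^+ 2 = D n t.
Proof.
by rewrite big_add1 big_mkord; apply: eq_bigr => j /(free_Y t)[-> _].
Qed.

Let sum_crossE n t : \sum_(1 <= k < n.+1 | free k) Y k.-1 t * (Y k t - mu) = alpha * D n t + S n t.
Proof.
rewrite big_add1 big_mkord mulr_sumr -big_split; apply: eq_bigr => j /(free_Y t)[-> ->].
by transitivity (alpha * (X j t)%:R ^+ 2 + (X j t)%:R * innov j t) => //; ring.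
Qed.

Let S_step k t : (s.+1 <= k)%N -> S k.+1 t = S k t + (X k t)%:R * innov k t.
Proof.
move=> sk; rewrite /S big_mkcond big_ord_recr /= -big_mkcond /=.
by rewrite /outlier_free_index eqSS !gtn_eqF// ltnW.
Qed.

Let D_step k t : (s.+1 <= k)%N -> D k.+1 t = D k t + (X k t)%:R ^+ 2.
Proof.
move=> sk; rewrite /D big_mkcond big_ord_recr /= -big_mkcond /=.
by rewrite /outlier_free_index eqSS !gtn_eqF// ltnW.
Qed.

(** The squares lost by skipping the outlier indices. They are frozen from time $s+1$ on, hence
    negligible after division by [n]. *)
Let W t := \sum_(j < s.+1) (X j t)%:R ^+ 2 - D s.+1 t.

Let D_sum n t : (s.+1 <= n)%N -> D n t = \sum_(j < n) (X j t)%:R ^+ 2 - W t.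
Proof.
move=> /subnKC <-; elim: (n - s.+1)%N => [|j IH]; first by rewrite addn0 /W opprB addrC subrK.
rewrite addnS D_step ?leq_addr// IH; move: (s.+1 + j)%N => k.
by rewrite big_ord_recr /=; ring.
Qed.

Let S_adapted_int n : adapted n (S n) /\ integ (S n).
Proof.
elim: n => [|n [aS iS]].
  rewrite (_ : S 0%N = fun=> 0); last by apply/funext => t; rewrite /S big_ord0.
  by split; [exact: adapted_cst|exact: finite_measure_integrable_cst].
have [fn|fn] := boolP (free n.+1); last first.
  rewrite (_ : S n.+1 = S n); first by split => //; exact: adaptedS.
  by apply/funext => t; rewrite /S big_mkcond big_ord_recr /= -big_mkcond (negbTE fn) addr0.
rewrite (_ : S n.+1 = fun t => S n t + (X n t)%:R * innov n t); last first.
  by apply/funext => t; rewrite /S big_mkcond big_ord_recr /= -big_mkcond fn.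
have [|iX _] := step_mean model alpha01 X0_cube eps_cube (B := 1) (adapted_X X0 eps xi n).
  move=> t; rewrite mul1r ger0_norm//; have : 0 <= (X n t)%:R :> R by [].
  by move: ((X n t)%:R) => x x0; nra.
split; last exact: (integrableD measurableT iS iX).
apply: (adapted_op2 +%R); first exact: adaptedS.
apply: (adapted_op2 *%R); first by apply: adaptedS; exact: adapted_X.
apply: (adapted_op2 (fun u v => u - alpha * v - mu)); first exact: adapted_X.
by apply: adaptedS; exact: adapted_X.
Qed.

Let nth_hist k j t : (j <= k)%N -> nth 0%N (hist k t) (k - j) = X j t.
Proof.
elim: k => [|k IH]; first by rewrite leqn0 => /eqP ->.
rewrite leq_eqVlt => /orP[/eqP ->|jk]; first by rewrite subnn -(head_hist X0 eps xi) nth0.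
by rewrite subSn// /= IH.
Qed.

Let est_adapted n : exists F : seq nat -> R * R, forall t, est n t = F (hist (maxn n s.+1) t).
Proof.
exists (fun h => CLS_est mu s n (fun k => (nth 0%N h (maxn n s.+1 - k))%:R + if k == s then theta%:R else 0)) => t.
by apply: CLS_est_ext => k kn; rewrite nth_hist.
Qed.

Let X_adapted k j : (j <= k)%N -> adapted k (fun t => (X j t)%:R : R).
Proof. by move=> jk; exists (fun h => (nth 0%N h (k - j))%:R) => t; rewrite nth_hist. Qed.

Let Y_adapted k j : (j <= k)%N -> adapted k (Y j).
Proof.
by move=> jk; apply: (adapted_comp (fun x : R => x + if j == s then theta%:R else 0)); exact: X_adapted.
Qed.

Let mY j : measurable_fun setT (Y j).
Proof. exact: (adapted_measurable model (Y_adapted (leqnn j))). Qed.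

Let mX j : measurable_fun setT (fun t => (X j t)%:R : R).
Proof. exact: (adapted_measurable model (X_adapted (leqnn j))). Qed.

Let mW : measurable_fun setT W.
Proof.
apply: measurable_funB.
  exact: (adapted_measurable model (adapted_sum_sqr X0 eps xi s.+1)).
rewrite (_ : D s.+1 = fun t => \sum_(j < s.+1) (if free j.+1 then (X j t)%:R ^+ 2 else 0)); last first.
  by apply/funext => t; rewrite /D big_mkcond.
by apply: measurable_sum => j; case: (free j.+1) => //; exact: measurable_funX.
Qed.

Let mS n : measurable_fun setT (S n).
Proof. by have [aS _] := S_adapted_int n; exact: (adapted_measurable model aS). Qed.

Let mest1 n : measurable_fun setT (fun t => (est n t).1).
Proof.
have [F FE] := est_adapted n.
by apply: (adapted_measurable model (k := maxn n s.+1)); exists (fun h => (F h).1) => t; rewrite FE.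
Qed.

Let mest2 n : measurable_fun setT (fun t => (est n t).2).
Proof.
have [F FE] := est_adapted n.
by apply: (adapted_measurable model (k := maxn n s.+1)); exists (fun h => (F h).2) => t; rewrite FE.
Qed.

Local Notation Z n t := (Num.sqrt n%:R * ((est n t).1 - alpha)).
Local Notation U n t := (S n t / Num.sqrt n%:R).

(** Four bad events of probability at most $e_2/4$ are discarded: average of squares far from [m2],
    large [W], large normalized martingale, large values near the outlier. On the complement the
    deterministic lemmas [CLS_est_profile] and [estimator_linearization] apply. *)
Let estimator_good (e1 e2 : R) : 0 < e1 -> 0 < e2 -> \forall n \near \oo,
  exists B, [/\ measurable B, fine (P B) <= e2 &
    forall t, ~ B t -> (est n t).2 = theta_hat mu s (fun k => Y k t) (est n t).1 /\
      `|Z n t - U n t / m2| <= e1].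
Proof.
move=> e10 e20.
have e40 : 0 < e2 / 4 by rewrite divr_gt0.
have [aS iS] := S_adapted_int s.+1.
have [M [M0 HM]] := martingale_tight model alpha01 X0_cube eps_cube aS iS S_step e40.
have [w w0 Hw] := tail_small P mW e40.
pose Cr t := `|Y s.-1 t| + `|Y s.+1 t| + `|mu|.
have mCr : measurable_fun setT Cr.
  by apply: measurable_funD => //; apply: measurable_funD; exact: measurableT_comp.
have [c c0 Hc] := tail_small P mCr e40.
pose K := 12 * c ^+ 2.
have K0 : 0 < K by rewrite mulr_gt0// exprn_gt0.
(* The first bound keeps $D/n$ above $m_2/2$; the second makes the error of replacing $n/D$ by
   $1/m_2$ at most $e_1/2$. *)
pose eta := Num.min (m2 / 2) (e1 * m2 ^+ 2 / (4 * M)).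
have eta0 : 0 < eta by rewrite lt_min !divr_gt0// ?mulr_gt0// exprn_gt0.
have eta1 : eta <= m2 / 2 by rewrite ge_min lexx.
have eta2 : 2 * M * eta <= e1 / 2 * m2 ^+ 2.
  have : eta <= e1 * m2 ^+ 2 / (4 * M) by rewrite ge_min lexx orbT.
  by rewrite ler_pdivlMr ?mulr_gt0//; lra.
have eh0 : 0 < eta / 2 by rewrite divr_gt0.
have L := square_average_lln model alpha01 X0_cube eps_cube pi_stat eh0 e40.
near=> n.
have hL : fine (P [set t | eta / 2 < `|(\sum_(j < n) (X j t)%:R ^+ 2) / n%:R - m2|]) <= e2 / 4 by near: n.
have n0 : (0 < n)%N by near: n; exact: nbhs_infty_gt.
have sn : (s.+1 <= n)%N by near: n; exact: nbhs_infty_ge.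
have nr0 : 0 < n%:R :> R by rewrite ltr0n.
have n1 : 1 <= n%:R :> R by rewrite ler1n.
have r1 : 1 <= Num.sqrt n%:R :> R by rewrite -[leLHS]sqrtr1 ler_sqrt.
have hK : 4 * K <= n%:R * m2.
  by rewrite -ler_pdivrMr//; near: n; exact: nbhs_infty_ger.
have hKe : 8 * K * (1 + M / m2) / m2 / Num.sqrt n%:R <= e1 / 2.
  by near: n; apply: inv_sqrt_small; rewrite divr_gt0.
have hw : w / Num.sqrt n%:R <= eta / 2 by near: n; exact: inv_sqrt_small.
have hwn : w / n%:R <= eta / 2.
  apply: le_trans hw; apply: ler_wpM2l; first exact: ltW.
  rewrite lef_pV2 ?posrE//; last exact: lt_le_trans r1.
  have : Num.sqrt n%:R ^+ 2 = n%:R :> R by rewrite sqr_sqrtr// ltW.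
  by move: r1; move: (Num.sqrt n%:R : R) => v v1 <-; nra.
have hM := HM n n0 sn.
pose B1 := [set t | eta / 2 < `|(\sum_(j < n) (X j t)%:R ^+ 2) / n%:R - m2|].
pose B2 := [set t | w < `|W t|].
pose B3 := [set t | M < `|U n t|].
pose B4 := [set t | c < `|Cr t|].
have mB1 : measurable B1.
  apply: measurable_abs_gt; apply: (adapted_measurable model (k := n)).
  by apply: (adapted_comp (fun x : R => x / n%:R - m2)); exact: adapted_sum_sqr.
have mB2 : measurable B2 by exact: measurable_abs_gt.
have mB3 : measurable B3 by apply: measurable_abs_gt; apply: measurable_funM.
have mB4 : measurable B4 by exact: measurable_abs_gt.
have mB12 : measurable (B1 `|` B2) by exact: measurableU.
have mB34 : measurable (B3 `|` B4) by exact: measurableU.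
exists ((B1 `|` B2) `|` (B3 `|` B4)); split; first exact: measurableU.
  have h1 := fine_probabilityU_le P mB12 mB34.
  have h2 := fine_probabilityU_le P mB1 mB2; have h3 := fine_probabilityU_le P mB3 mB4.
  by apply: (le_trans h1); move: hL hM Hw Hc; rewrite -/B1 -/B2 -/B3 -/B4; lra.
move=> t nB.
have g1 : `|(\sum_(j < n) (X j t)%:R ^+ 2) / n%:R - m2| <= eta / 2.
  by rewrite leNgt; apply/negP => h; apply: nB; left; left.
have g2 : `|W t| <= w by rewrite leNgt; apply/negP => h; apply: nB; left; right.
have g3 : `|U n t| <= M by rewrite leNgt; apply/negP => h; apply: nB; right; left.
have g4 : Cr t <= c.
  by apply: (le_trans (ler_norm _)); rewrite leNgt; apply/negP => h; apply: nB; right; right.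
have Cr0 : 0 <= Cr t by rewrite !addr_ge0.
have KC : 12 * Cr t ^+ 2 <= K by rewrite ler_pM2l// ler_pXn2r ?nnegrE// ltW.
have Dm : `|D n t / n%:R - m2| <= eta.
  rewrite D_sum// mulrBl addrAC; apply: (le_trans (ler_normB _ _)).
  have : `|W t / n%:R| <= w / n%:R.
    by rewrite normrM normfV (gtr0_norm nr0) ler_pM2r// invr_gt0.
  lra.
have Dn : n%:R * m2 / 2 <= D n t.
  have : m2 / 2 <= D n t / n%:R by move: Dm; rewrite ler_norml => /andP[h _]; lra.
  by rewrite ler_pdivlMr// => h; move: h; rewrite mulrC mulrA.
have KD : K < D n t by lra.
have D0 : 0 < D n t by exact: lt_trans K0 KD.
have DC : 12 * (`|Y s.-1 t| + `|Y s.+1 t| + `|mu|) ^+ 2 < \sum_(1 <= k < n.+1 | free k) Y k.-1 t ^+ 2.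
  by rewrite sum_sqrE; exact: le_lt_trans KC KD.
have [th ab] := CLS_est_profile (y := fun k => Y k t) DC.
split => //; rewrite sum_sqrE sum_crossE in ab.
pose ah := (alpha * D n t + S n t) / D n t.
have ahE : ah - alpha = S n t / D n t by rewrite /ah; field; rewrite gt_eqF.
have al1 : `|alpha| <= 1 by have /andP[a0 a1] := alpha01; rewrite ger0_norm ltW.
have abK : `|(est n t).1 - ah| * (D n t - K) <= K * (1 + `|ah|).
  apply: (@le_trans _ _ (`|(est n t).1 - ah| * (D n t - 12 * Cr t ^+ 2))).
    by apply: ler_wpM2l => //; rewrite lerD2l lerN2.
  by apply: (le_trans ab); apply: ler_wpM2r => //; rewrite addr_ge0.
exact: (estimator_linearization nr0 m2_gt0 (ltW K0) (ltW M0) al1 ahE abK Dm eta1 g3 hK n1 eta2 hKe).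
Unshelve. all: by end_near. Qed.

Let limit_variance := V / m2 ^+ 2.

(** The weight [A] from the past at time $s+1$ factors out of the limit. Taking it constant gives
    the unconditional law, taking an indicator gives the conditional one. *)
Lemma alpha_estimator_cos (A : T -> R) (u b : R) : adapted s.+1 A -> (forall t, 0 <= A t <= 1) ->
  \int[P]_t (A t * cos (u * Z n t + b)) @[n --> \oo] -->
  \int[P]_t A t * (expR (- (u ^+ 2 * limit_variance / 2)) * cos b).
Proof.
move=> aA A01; apply: (close_cos (P := P) (Z := fun n t => Z n t) (Z' := fun n t => U n t / m2)) => //.
- by move=> n; apply: measurable_funM => //; apply: measurable_funB.
- by move=> n; do 2 apply: measurable_funM => //.
- move=> e1 e2 e10 e20; apply: filterS (estimator_good e10 e20) => n [B [mB PB HB]].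
  by exists B; split => // t /HB[].
- exact: (adapted_measurable model aA).
have [aS iS] := S_adapted_int s.+1.
have := martingale_clt model alpha01 X0_cube eps_cube pi_stat aS iS S_step aA A01 (u := u / m2) (b := b).
rewrite (_ : (u / m2) ^+ 2 * V / 2 = u ^+ 2 * limit_variance / 2); last first.
  by rewrite /limit_variance expr_div_n; field; rewrite gt_eqF.
apply: cvg_trans; apply: near_eq_cvg; near=> n.
by congr (Rintegral _ _ _); apply/funext => t; congr (_ * cos (_ + _)); ring.
Unshelve. all: by end_near. Qed.

Lemma alpha_estimator_tight : tight P (fun n t => Z n t).
Proof.
have mU n : measurable_fun setT (fun t => U n t / m2) by do 2 apply: measurable_funM => //.
apply: (close_tight (Z' := fun n t => U n t / m2)) => //.
- by move=> n; apply: measurable_funM => //; apply: measurable_funB.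
- move=> e1 e2 e10 e20; apply: filterS (estimator_good e10 e20) => n [B [mB PB HB]].
  by exists B; split => // t /HB[].
move=> e0 e00; have [aS iS] := S_adapted_int s.+1.
have [M [M0 HM]] := martingale_tight model alpha01 X0_cube eps_cube aS iS S_step e00.
exists (M / m2); near=> n.
have n0 : (0 < n)%N by near: n; exact: nbhs_infty_gt.
have sn : (s.+1 <= n)%N by near: n; exact: nbhs_infty_ge.
rewrite (_ : [set t | _] = [set t | M < `|U n t|]); first exact: HM.
apply/seteqP; split => t /=; rewrite (normrM (U n t)) (ger0_norm (_ : 0 <= m2^-1)) ?ltr_pM2r ?invr_gt0 ?invr_ge0 ?ltW//.
Unshelve. all: by end_near. Qed.

Let mZ n : measurable_fun setT (fun t => Z n t).
Proof. by apply: measurable_funM => //; exact: measurable_funB. Qed.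

Let limit_variance_ge0' : 0 <= limit_variance.
Proof.
rewrite /limit_variance; apply: divr_ge0; last exact: sqr_ge0.
exact: (limit_variance_ge0 model alpha01 eps_cube pi_stat).
Qed.

Lemma alpha_estimator_law : cvg_law P (fun n t => Z n t) (V / m2 ^+ 2).
Proof.
apply: levy_criterion => //; last exact: alpha_estimator_tight.
move=> u b.
have a1 : adapted s.+1 (fun=> 1 : R) by exact: adapted_cst.
have := alpha_estimator_cos (u := u) (b := b) a1.
rewrite (_ : \int[P]_t (1 : R) = fine (P setT)); last first.
  by rewrite /Rintegral integral_probability_cst probability_setT.
move=> H; rewrite (_ : (fun n => _) = (fun n => \int[P]_t (1 * cos (u * Z n t + b)))); last first.
  by apply/funext => n; apply: eq_Rintegral => t _; rewrite mul1r.
by apply: H => t; rewrite lexx ler01.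
Qed.

Section conditional.
Variables m1 m3 : nat.
Let A := [set t | Y s.-1 t = m1%:R /\ Y s.+1 t = m3%:R].
(** The derivative of [theta_hat] at [alpha] on the event [A], where it is deterministic; its square
    turns $\sigma_{\alpha,\varepsilon}^2$ into $c_{\alpha,\varepsilon}^2$. *)
Let k0 : R := ((alpha ^+ 2 - 1) * (m1%:R + m3%:R) + (1 + 2 * alpha - alpha ^+ 2) * mu) / (1 + alpha ^+ 2) ^+ 2.

Let A_adapted : adapted s.+1 (\1_A : T -> R).
Proof.
rewrite (_ : \1_A = fun t => ((Y s.-1 t == m1%:R) && (Y s.+1 t == m3%:R))%:R); last first.
  apply/funext => t; rewrite indicE; congr (_ %:R); congr nat_of_bool.
  by apply/idP/andP; rewrite inE => -[/eqP h1 /eqP h2].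
apply: (adapted_op2 (fun x y => ((x == m1%:R) && (y == m3%:R))%:R)); apply: Y_adapted => //.
exact: leq_trans (leq_pred s) (leqnSn s).
Qed.

Let mA : measurable A.
Proof.
rewrite (_ : A = [set t | 1 / 2 < `|\1_A t : R|]).
  by apply: measurable_abs_gt; exact: (adapted_measurable model A_adapted).
apply/seteqP; split => t /= At; first by rewrite indicE mem_set// normr1; lra.
by apply: contrapT => nA; move: At; rewrite indicE memNset// normr0; lra.
Qed.

Let A01 t : 0 <= (\1_A t : R) <= 1.
Proof. by rewrite indicE; case: (_ \in _); rewrite ?lexx ?ler01. Qed.

Local Notation err n t := (Num.sqrt n%:R * ((est n t).2 - theta_hat mu s (fun k => Y k t) alpha)).
(** Multiplication by the indicator makes the error comparable with its linearization on the whole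
    space, since the value [k0] of the derivative is correct only on [A]. *)
Let Z3 n t : R := \1_A t * err n t.
Let Z4 n t : R := \1_A t * (k0 * Z n t).

Let mth : measurable_fun setT (fun t => theta_hat mu s (fun k => Y k t) alpha).
Proof.
by apply: measurable_funB => //; apply: measurable_funB => //; apply: measurable_funM => //; apply: measurable_funD.
Qed.

Let mZ3 n : measurable_fun setT (Z3 n).
Proof.
apply: measurable_funM; first exact: measurable_indic.
by apply: measurable_funM => //; exact: measurable_funB.
Qed.

Let mZ4 n : measurable_fun setT (Z4 n).
Proof. by apply: measurable_funM; [exact: measurable_indic|exact: measurable_funM]. Qed.

(** The delta method: on [A] the difference is at most $L Z_n^2/\sqrt n$, and $Z_n$ is tight. *)
Let Z34 : close_in_probability P Z3 Z4.
Proof.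
move=> e1 e2 e10 e20; have e3 : 0 < e2 / 2 by rewrite divr_gt0.
have [L L0 HL] : exists2 L, 0 <= L & forall t a, A t ->
   `|theta_hat mu s (fun k => Y k t) a - theta_hat mu s (fun k => Y k t) alpha - k0 * (a - alpha)| <= L * (a - alpha) ^+ 2.
  (* The Taylor bound is applied to one deterministic sequence with the prescribed values at $s-1$
     and $s+1$, so that [L] is the same for all [t] in [A]; the true $Y_s$ only adds a constant that
     cancels in differences. *)
  have [L L0 HL] := theta_hat_taylor mu s (fun k => if k == s.-1 then m1%:R else if k == s.+1 then m3%:R else 0) alpha.
  exists L => // t a [h1 h2].
  have ss : s.-1 != s by rewrite neq_ltn prednK// leqnn.
  have ss1 : s.-1 != s.+1 by rewrite neq_ltn ltnS leq_pred.
  have E c : theta_hat mu s (fun k => Y k t) c = theta_hat mu s (fun k => if k == s.-1 then m1%:R else if k == s.+1 then m3%:R else 0) c + Y s t.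
    by rewrite /theta_hat h1 h2 eqxx [s == _]eq_sym (negbTE ss) (eq_sym s.+1) (negbTE ss1) eqxx (ltn_eqF (leqnn s.+1)); ring.
  have := HL a; rewrite eqxx (eq_sym s.+1) (negbTE ss1) eqxx -/k0 !E.
  by congr (`|_| <= _); ring.
have [M HM] := alpha_estimator_tight e3.
have H := estimator_good ltr01 e3.
near=> n.
have [B [mB PB HB]] : exists B, [/\ measurable B, fine (P B) <= e2 / 2 &
    forall t, ~ B t -> (est n t).2 = theta_hat mu s (fun k => Y k t) (est n t).1 /\ `|Z n t - U n t / m2| <= 1] by near: n.
have PM : fine (P [set t | M < `|Z n t|]) <= e2 / 2 by near: n.
have n0 : (0 < n)%N by near: n; exact: nbhs_infty_gt.
have r0 : 0 < Num.sqrt n%:R :> R by rewrite sqrtr_gt0 ltr0n.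
have small : L * M ^+ 2 / Num.sqrt n%:R <= e1 by near: n; exact: inv_sqrt_small.
have mM : measurable [set t | M < `|Z n t|] by exact: measurable_abs_gt.
exists (B `|` [set t | M < `|Z n t|]); split; first exact: measurableU.
  by apply: (le_trans (fine_probabilityU_le P mB mM)); lra.
move=> t nB; rewrite /Z3 /Z4 -mulrBr.
have [At|nA] := pselect (A t); last by rewrite indicE memNset// mul0r normr0 ltW.
rewrite indicE mem_set// mul1r.
have [-> _] := HB t (fun h => nB (or_introl h)).
have ZM : `|Z n t| <= M by rewrite leNgt; apply/negP => h; apply: nB; right.
rewrite mulrCA -mulrBr; apply: le_trans small.
rewrite normrM (gtr0_norm r0) ler_pdivlMr//.
have hZ : Z n t ^+ 2 <= M ^+ 2.
  by rewrite -(real_normK (num_real (Z n t))) ler_pXn2r ?nnegrE// (le_trans _ ZM).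
apply: le_trans (ler_wpM2l L0 hZ); rewrite exprMn (mulrCA L).
have := ler_wpM2l (sqr_ge0 (Num.sqrt n%:R)) (HL t (est n t).1 At).
by move=> h; rewrite [leLHS]mulrAC -(expr2 (Num.sqrt n%:R)).
Unshelve. all: by end_near. Qed.

(** Integration over [A] does not see the indicator, so the error may be replaced by [Z3], then by
    [Z4], whose cosine expectations are those of the estimator of $\alpha$ at frequency $u k_0$. *)
Lemma theta_estimator_law : cvg_law_on P A (fun n t => err n t) (V / m2 ^+ 2 * k0 ^+ 2).
Proof.
suff H : cvg_law_on P A Z3 (V / m2 ^+ 2 * k0 ^+ 2).
  move=> f cf bf; have := H f cf bf; rewrite (_ : (fun n => (\int[P]_(t in A) (f (Z3 n t))%:E)%E) =
    (fun n => (\int[P]_(t in A) (f (err n t))%:E)%E))//.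
  apply/funext => n; apply: eq_integral => t tA.
  by rewrite /Z3 indicE tA mul1r.
apply: levy_criterion => //.
- by rewrite mulr_ge0// sqr_ge0.
- move=> u b.
  have H : \int[P]_t (\1_A t * cos (u * Z4 n t + b)) @[n --> \oo] -->
     \int[P]_t \1_A t * (expR (- (u ^+ 2 * (V / m2 ^+ 2 * k0 ^+ 2) / 2)) * cos b).
    have := alpha_estimator_cos (u := u * k0) (b := b) A_adapted A01.
    rewrite (_ : (u * k0) ^+ 2 * limit_variance / 2 = u ^+ 2 * (V / m2 ^+ 2 * k0 ^+ 2) / 2); last first.
      by rewrite /limit_variance; ring.
    apply: cvg_trans; apply: near_eq_cvg; near=> n.
    congr (Rintegral _ _ _); apply/funext => t; rewrite /Z4 indicE.
    by case: (t \in A); rewrite ?mul0r// !mul1r mulrA.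
  have := close_cos mZ3 mZ4 Z34 (adapted_measurable model A_adapted) A01 H.
  rewrite (_ : \int[P]_t \1_A t = fine (P A)); last first.
    by rewrite /Rintegral (integral_indic P measurableT mA) setIT.
  rewrite (_ : (fun n => \int[P]_(t in A) cos (u * Z3 n t + b)) = (fun n => \int[P]_t (\1_A t * cos (u * Z3 n t + b))))//.
  apply/funext => n; rewrite Rintegral_mkcond patch_indic.
  by apply: eq_Rintegral => t _; rewrite /= mulrC.
- apply: (close_tight mZ3 mZ4 Z34) => e0 e00.
  have [M HM] := alpha_estimator_tight e00; exists (`|k0| * M).
  apply: filterS HM => n; apply: le_trans; apply: fine_probability_le; [exact: measurable_abs_gt|exact: measurable_abs_gt|].
  move=> t /= h; rewrite ltNge; apply/negP => ZM; move: h; apply/negP; rewrite -leNgt /Z4 normrM.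
  rewrite normrM; apply: (@le_trans _ _ (`|k0| * `|Z n t|)); last exact: ler_wpM2l.
  have /andP[a0 a1] := A01 t.
  by rewrite ger0_norm// ler_piMl// mulr_ge0.
Unshelve. all: by end_near. Qed.
End conditional.

End OutlierEstimator.

Theorem theorem3p2p2 (R : realType) (d : measure_display) (T : measurableType d)
  (P : probability T R) (alpha : R) (X0 : T -> nat) (eps : nat -> T -> nat)
  (xi : nat -> nat -> T -> bool) (s theta : nat) (pi : nat -> R) :
  0 < alpha < 1 ->
  (0 < s)%N -> (0 < theta)%N ->
  inar_model P alpha X0 eps xi ->
  (expect_pow P (eps 1%N) 2%N < +oo)%E ->
  (0 < P [set t | eps 1%N t <> 0%N])%E ->
  (expect_pow P X0 2%N < +oo)%E ->
  (expect_pow P X0 3%N < +oo)%E ->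
  (expect_pow P (eps 1%N) 3%N < +oo)%E ->
  is_stationary alpha (fun m => fine (P [set t | eps 1 t = m])) pi ->
  let mu := fine (expect_pow P (eps 1) 1) in
  let sigeps2 := fine (expect_pow P (eps 1) 2) - mu ^+ 2 in
  let sig2 := sigma2_alpha_eps alpha sigeps2 pi in
  let Y : nat -> T -> R := inar_Y (inar_X X0 eps xi) s theta in
  let est n t := CLS_est mu s n (fun k => Y k t) in
  cvg_law P (fun n t => Num.sqrt n%:R * ((est n t).1 - alpha)) sig2 /\
  (forall m1 m2 : nat,
     let A := [set t | Y s.-1 t = m1%:R /\ Y s.+1 t = m2%:R] in
     (0 < P A)%E ->
     cvg_law_on P A
       (fun n t => Num.sqrt n%:R *
          ((est n t).2 - (Y s t - alpha / (1 + alpha ^+ 2) * (Y s.-1 t + Y s.+1 t)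
                          - (1 - alpha) / (1 + alpha ^+ 2) * mu)))
       (sig2 / (1 + alpha ^+ 2) ^+ 4 *
        ((alpha ^+ 2 - 1) * (m1%:R + m2%:R) + (1 + 2 * alpha - alpha ^+ 2) * mu) ^+ 2)).
Proof.
move=> alpha01 s_gt0 _ model _ eps_nonzero _ X0_cube eps_cube pi_stat mu sigeps2 sig2 Y est; split.
  exact: (alpha_estimator_law model alpha01 X0_cube eps_cube pi_stat eps_nonzero s theta).
move=> m1 m2 A _.
have := theta_estimator_law model alpha01 X0_cube eps_cube pi_stat eps_nonzero s_gt0 (theta := theta) (m1 := m1) (m3 := m2).
(* Only the variances remain to be matched: squaring [k0] produces the fourth power of
   $1+\alpha^2$. *)
congr (cvg_law_on _ _ _ _); rewrite expr_div_n -exprM.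
rewrite /sig2 /sigma2_alpha_eps -/mu -/sigeps2.
by rewrite mulrA mulrAC.
Qed.
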